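(* Let $\mathbf{F}\in\{\mathbf{R},\mathbf{C}\}$, let $x_*\in\mathbf{F}^d$, and let $A_1,\dots,A_n\in\mathbf{H}_d$ be positive semidefinite. Suppose the measurements are exact: $y_i=\langle A_i, x_*x_*^*\rangle$ for $i=1,\dots,n$ (i.e. $y=\mathcal{A}(x_*x_*^* )$). Consider the problem $$\min_{x\in\mathbf{F}^d} f(x),\qquad f(x)=\|y-\mathcal{A}(xx^* )\|^2=\sum_{i=1}^n\big(y_i-\langle A_i,xx^*\rangle\big)^2 .$$ 1. Suppose that for some $m,\delta_L,\delta_U>0$, $$\tfrac1n\|\mathcal{A}^*\mathcal{A}(x_*x_*^* )\|_{\mathrm{op}}\le (1+m+\delta_U)\|x_*\|^2,$$ and for all $x\in\mathbf{F}^d$, $$\tfrac1n\|\mathcal{A}(xx^*-x_*x_*^* )\|^2\ge(1-\delta_L)\big[m\|xx^*-x_*x_*^*\|_F^2+(\|x\|^2-\|x_*\|^2)^2\big],$$ and suppose $m^2+2m-2>3(m^2+2m)\delta_L+2(m+1)\delta_U$. Then every second-order critical point $x$ of this problem satisfies $xx^*=x_*x_*^*$, i.e. $x=x_*s$ for some $s\in\mathbf{F}$ with $|s|=1$. 2. For fixed $x_*$, suppose $A_i=a_ia_i^*$ (or $A_i=\operatorname{Re}(a_ia_i^* )$ if $\mathbf{F}=\mathbf{R}$ and the $a_i$ are complex), where $a_1,\dots,a_n$ are i.i.d. real or complex standard Gaussian vectors. Let $m_4=\mathbb{E}|z|^4-1$ where $z$ is a standard normal random variable of the same type (so $m_4=2$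 in the real case and $m_4=1$ in the complex case). Then there are universal constants $c_1,c_2>0$ such that, if $n\ge c_1 d\log d$, with probability at least $1-c_2n^{-2}$ the conditions of part 1 hold with $m=m_4$ (for some $\delta_L,\delta_U>0$ satisfying the inequality of part 1).
   Context: $\mathbf{H}_d$ denotes the set of $d\times d$ Hermitian matrices over $\mathbf{F}$, with Frobenius inner product $\langle A,B\rangle=\operatorname{Re}\operatorname{tr}(A^*B)$ (real for Hermitian matrices). The linear operator $\mathcal{A}:\mathbf{H}_d\to\mathbf{R}^n$ is $\mathcal{A}(S)=(\langle A_1,S\rangle,\dots,\langle A_n,S\rangle)$ and its adjoint is $\mathcal{A}^*(z)=\sum_i z_iA_i$. $\|\cdot\|_{\mathrm{op}}$ is the operator norm, $\|\cdot\|_F$ the Frobenius norm. A second-order critical point is a point where the gradient of the objective is zero and the Hessian quadratic form is positive semidefinite; in the complex case the objective is regarded as a function of the real and imaginary parts of the variable.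
   Formalization: In part 2 the case F = C with real Gaussian a_i is excluded; there the claim fails: for x_* = (1,i), x = (1,-i) all measurements agree although xx* differs from x_*x_*^*, so the lower condition cannot hold. *)

(* Defs.v *)
(* The field F in {R, C} is encoded by a boolean
   [cplx]: F = C when [cplx = true], F = R (embedded in R[i] as the numbers
   with zero imaginary part) when [cplx = false]. *)
From HB Require Import structures.
From mathcomp Require Import all_boot all_order all_algebra.
From mathcomp Require Import all_classical all_reals all_analysis.
From mathcomp Require Import complex.

Set Implicit Arguments.
Unset Strict Implicit.
Unset Printing Implicit Defensive.

Import Order.TTheory GRing.Theory Num.Theory.
Local Open Scope ring_scope.
Local Open Scope complex_scope.
Local Open Scope classical_set_scope.

Section Defs.
Variable R : realType.
Local Notation C := R[i].

Definition inF (cplx : bool) (z : C) : bool := cplx || (complex.Im z == 0).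

Definition Fvec (cplx : bool) (d : nat) (v : 'cV[C]_d) : Prop :=
  forall j, inF cplx (v j 0).
Definition Fmx (cplx : bool) (d : nat) (A : 'M[C]_d) : Prop :=
  forall i j, inF cplx (A i j).

Definition adjmx (p q : nat) (M : 'M[C]_(p, q)) : 'M[C]_(q, p) :=
  (map_mx conjc M)^T.

Definition hermitian (d : nat) (A : 'M[C]_d) : Prop := adjmx A = A.

Definition inH (cplx : bool) (d : nat) (A : 'M[C]_d) : Prop :=
  Fmx cplx A /\ hermitian A.

Definition psd (cplx : bool) (d : nat) (A : 'M[C]_d) : Prop :=
  inH cplx A /\ forall v : 'cV[C]_d, Fvec cplx v -> 0 <= (adjmx v *m A *m v) 0 0.

Definition hip (d : nat) (A B : 'M[C]_d) : R := complex.Re (\tr (adjmx A *m B)).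

Definition outer (d : nat) (x : 'cV[C]_d) : 'M[C]_d := x *m adjmx x.

Definition opA (n d : nat) (As : 'I_n -> 'M[C]_d) (S : 'M[C]_d) : 'I_n -> R :=
  fun i => hip (As i) S.
Definition opAadj (n d : nat) (As : 'I_n -> 'M[C]_d) (z : 'I_n -> R) : 'M[C]_d :=
  \sum_(i < n) (z i)%:C *: As i.

Definition sqnormR (n : nat) (z : 'I_n -> R) : R := \sum_(i < n) z i ^+ 2.
Definition sqnormv (d : nat) (v : 'cV[C]_d) : R :=
  \sum_(j < d) (complex.Re (v j 0) ^+ 2 + complex.Im (v j 0) ^+ 2).
Definition frob2 (d : nat) (M : 'M[C]_d) : R :=
  \sum_(i < d) \sum_(j < d) (complex.Re (M i j) ^+ 2 + complex.Im (M i j) ^+ 2).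

Definition opnorm (cplx : bool) (d : nat) (M : 'M[C]_d) : R :=
  sup [set Num.sqrt (sqnormv (M *m v)) | v in [set v | Fvec cplx v /\ sqnormv v <= 1]].

Definition fobj (n d : nat) (As : 'I_n -> 'M[C]_d) (y : 'I_n -> R)
    (x : 'cV[C]_d) : R :=
  \sum_(i < n) (y i - hip (As i) (outer x)) ^+ 2.

(* second-order critical point of a real-valued function g on F^d, regarded as
   a function of the real and imaginary parts: for every (real) direction
   v in F^d the directional derivative at x vanishes (zero gradient) and the
   second directional derivative, i.e. the Hessian quadratic form at v, is
   nonnegative. *)
Definition second_order_critical (cplx : bool) (d : nat) (g : 'cV[C]_d -> R)
    (x : 'cV[C]_d) : Prop :=
  Fvec cplx x /\
  forall v : 'cV[C]_d, Fvec cplx v ->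
    let phi := fun t : R => g (x + t%:C *: v) in
    derivable phi 0 1 /\ derive1 phi 0 = 0 /\ 0 <= derive1 (derive1 phi) 0.

Definition upper_cond (cplx : bool) (n d : nat) (As : 'I_n -> 'M[C]_d)
    (xs : 'cV[C]_d) (m dU : R) : Prop :=
  n%:R^-1 * opnorm cplx (opAadj As (opA As (outer xs))) <= (1 + m + dU) * sqnormv xs.

Definition lower_cond (cplx : bool) (n d : nat) (As : 'I_n -> 'M[C]_d)
    (xs : 'cV[C]_d) (m dL : R) : Prop :=
  forall x : 'cV[C]_d, Fvec cplx x ->
    n%:R^-1 * sqnormR (opA As (outer x - outer xs))
      >= (1 - dL) * (m * frob2 (outer x - outer xs) + (sqnormv x - sqnormv xs) ^+ 2).

Definition gap_ineq (m dL dU : R) : Prop :=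
  m ^+ 2 + 2 * m - 2 > 3 * (m ^+ 2 + 2 * m) * dL + 2 * (m + 1) * dU.

Definition mutually_independent (dsp : measure_display) (T : measurableType dsp)
    (P : probability T R) (I : finType) (J : {set I}) (X : I -> T -> R) : Prop :=
  forall K : {set I}, K \subset J ->
  forall B : I -> set R, (forall k, k \in K -> measurable (B k)) ->
    P (\bigcap_(k in [set k | k \in K]) (X k @^-1` B k)) =
    (\prod_(k in K) P (X k @^-1` B k))%E.

(* X has law N(mu, s^2) (s = standard deviation) *)
Definition has_normal_law (dsp : measure_display) (T : measurableType dsp)
    (P : probability T R) (X : T -> R) (mu s : R) : Prop :=
  measurable_fun setT X /\
  forall B : set R, measurable B -> P (X @^-1` B) = normal_prob mu s B.

(* Gaussian vectors a_1..a_n in C^d built from real random variables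
   g i j false (real part) and g i j true (imaginary part).
   gc = true : standard complex Gaussian (Re, Im iid N(0,1/2));
   gc = false: standard real Gaussian (entries iid N(0,1), imaginary part 0). *)
Definition gauss_vec (dsp : measure_display) (T : measurableType dsp)
    (gc : bool) (n d : nat) (g : 'I_n -> 'I_d -> bool -> T -> R)
    (i : 'I_n) (w : T) : 'cV[C]_d :=
  \col_(j < d) (if gc then (g i j false w) +i* (g i j true w)
                else (g i j false w)%:C).

Definition iid_std_gaussian (dsp : measure_display) (T : measurableType dsp)
    (P : probability T R) (gc : bool) (n d : nat)
    (g : 'I_n -> 'I_d -> bool -> T -> R) : Prop :=
  let X := fun k : 'I_n * 'I_d * bool => g k.1.1 k.1.2 k.2 in
  if gc then
    mutually_independent P [set: 'I_n * 'I_d * bool] X /\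
    (forall i j b, has_normal_law P (g i j b) 0 (Num.sqrt (2^-1)))
  else
    mutually_independent P [set k | ~~ k.2] X /\
    (forall i j, has_normal_law P (g i j false) 0 1).

Definition sensing_mx (cplx : bool) (d : nat) (a : 'cV[C]_d) : 'M[C]_d :=
  if cplx then outer a else map_mx (fun z => (complex.Re z)%:C) (outer a).

(* m_4 = E|z|^4 - 1 for z standard normal of the type of the a_i *)
Definition m4 (gc : bool) : R := if gc then 1 else 2.

End Defs.

(* Main.v *)
(* Part 1.  Let [r_i = <A_i, xx* - zz*>] with [z = x_*], at a critical point [x],
   and let [v] be the component of [z] orthogonal to [x].  The first-order
   condition gives [sum r_i v*A_i v = - sum r_i^2]; the Hessian in the direction
   [v], together with [(Re v*A_i x)^2 <= (v*A_i v) (x*A_i x)] for semidefinite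
   [A_i], then yields
   [3 sum r_i^2 <= 2 v* A^*A(zz* ) v <= 2 n (1+m+dU) |z|^2 |v|^2],
   which contradicts the lower bound on [sum r_i^2] unless [xx* = zz*].

   Part 2.  Only two facts about the Gaussian vectors [a] are used:
   [E |a*u|^4 = (1+m) |u|^4], from which all mixed second moments follow by
   polarization, and [E exp(3/8 |a*u|^2) <= 2] for [|u| <= 1].
   - Upper bound: after truncating the weights [|a_i* z|^2] at level [8 ln n], a
     Chernoff bound controls the form [sum |a_i* z|^2 |a_i* u|^2] at a fixed [u]
     with probability [1 - exp(- c n / ln n)]; a grid of constant mesh, which has
     [exp(O(d))] points, suffices because the form is semidefinite.
   - Lower bound: [xx* - zz*] is a multiple of [yy* - y'y'*] with [y], [y'] in the
     unit ball and [||yy* - y'y'*||_F] bounded below, so an additive error is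
     harmless.  Since [exp(- l Z)] is integrable for every [Z >= 0], a fixed pair
     [(y, y')] fails with probability [exp(- c n)], and one can afford a grid of
     mesh [n^-6], with [exp(O(d ln n))] points.
   Both union bounds close because [n >= c1 d ln d] forces [d ln n <= eps n]. *)
Require Import Defs.
From HB Require Import structures.
From mathcomp Require Import all_boot all_order all_algebra.
From mathcomp Require Import all_classical all_reals all_analysis.
From mathcomp Require Import measurable_realfun complex zify ring lra.

Set Implicit Arguments.
Unset Strict Implicit.
Unset Printing Implicit Defensive.

Import Order.TTheory GRing.Theory Num.Theory.
Import numFieldNormedType.Exports.
Local Open Scope ring_scope.
Local Open Scope complex_scope.
Local Open Scope classical_set_scope.

(** * The normal law *)

Section NormalIntegrals.
Import HBNNSimple.
Context {R : realType}.
Local Notation lam := (@lebesgue_measure R).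

(** The gap condition is what remains after optimizing over the norm of [x]: for the lower-bound
    form D, completing a square gives (m+1) D >= m (m+2) |z|^2 |v|^2, so the two bounds on sum r_i^2
    are incompatible once 3 (1-dL) m (m+2) > 2 (m+1) (1+m+dU). The two unequal grids come from two
    obstacles. A product |a* z|^2 |a* u|^2 has no exponential moment, hence the truncation; it
    leaves a Chernoff parameter of order 1 / ln n, so the upper bound cannot pay for more than
    exp(O(d)) points. Neither rotation invariance nor joint Gaussian laws are used. Every Gaussian
    fact concerns one real linear form of the coordinates, whose law is found by adding independent
    coordinates one at a time; its moments are read off the exact value of E exp(theta X^2). *)

Lemma lebesgue_measure_affine (c b : R) (A : set R) : c != 0 -> measurable A ->
  lam A = (`|c|%:E * lam ((fun x : R => c * x + b)%R @^-1` A))%E.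
Proof.
move=> c0 mA.
pose f (x : measurableTypeR R) : measurableTypeR R := c * x + b.
have mf : measurable_fun setT f.
  by apply: measurable_funD => //; exact: measurable_funM.
pose m1 := measure_function_pushforward__canonical__measure_function_Measure lam mf.
pose m2 : {measure set (measurableTypeR R) -> \bar R} := mscale (@NngNum _ `|c| (normr_ge0 _)) m1.
rewrite [RHS](_ : _ = m2 A)//.
apply: lebesgue_measure_unique => // _ [[u v] _ <-].
rewrite /m2 /= lebesgue_measure_itv/= /mscale/= /pushforward.
have [c_lt0|c_gt0|] := ltgtP c 0; last by move/eqP; rewrite (negbTE c0).
  (* A negative slope reverses the interval, so its closed end moves to the left. *)
  rewrite (_ : f @^-1` _ = `[(v - b) / c, (u - b) / c[%classic); last first.
    apply/seteqP; split => x; rewrite /= !in_itv/=.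
      by rewrite ler_ndivrMr// ltr_ndivlMr// => /andP[]; rewrite -lerBrDr -ltrBlDr; rewrite ![c * _]mulrC => -> ->.
    by rewrite ler_ndivrMr// ltr_ndivlMr// => /andP[]; rewrite -lerBrDr -ltrBlDr; rewrite ![c * _]mulrC => -> ->.
  rewrite lebesgue_measure_itv/= !lte_fin ltr_nM2r ?invr_lt0// ltrD2r.
  case: ifP => uv; last by rewrite mule0.
  rewrite !EFinN -!EFinD -EFinM; congr EFin; rewrite ltr0_norm//.
  by field.
rewrite (_ : f @^-1` _ = `](u - b) / c, (v - b) / c]%classic); last first.
  apply/seteqP; split => x; rewrite /= !in_itv/=.
    by rewrite ler_pdivlMr// ltr_pdivrMr// => /andP[]; rewrite -lerBrDr -ltrBlDr; rewrite ![c * _]mulrC => -> ->.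
  by rewrite ler_pdivlMr// ltr_pdivrMr// => /andP[]; rewrite -lerBrDr -ltrBlDr; rewrite ![c * _]mulrC => -> ->.
rewrite lebesgue_measure_itv/= !lte_fin ltr_pM2r ?invr_gt0// ltrD2r.
case: ifP => uv; last by rewrite mule0.
rewrite !EFinN -!EFinD -EFinM; congr EFin; rewrite gtr0_norm//.
by field.
Qed.

Lemma integral_affine (c b : R) (f : R -> \bar R) : c != 0 ->
  measurable_fun setT f -> (forall x, 0 <= f x)%E ->
  (\int[lam]_x f x = `|c|%:E * \int[lam]_x f (c * x + b)%R)%E.
Proof.
move=> c0 mf f0.
pose g (x : measurableTypeR R) : measurableTypeR R := c * x + b.
have mg : measurable_fun setT g.
  by apply: measurable_funD => //; exact: measurable_funM.
pose m1 := measure_function_pushforward__canonical__measure_function_Measure lam mg.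
pose m2 : {measure set (measurableTypeR R) -> \bar R} := mscale (@NngNum _ `|c| (normr_ge0 _)) m1.
transitivity (\int[m2]_x f x)%E.
  apply: eq_measure_integral => A mA _.
  by rewrite /= /mscale/= /pushforward; exact: lebesgue_measure_affine.
rewrite ge0_integral_mscale//=; congr (_ * _)%E.
by rewrite ge0_integral_pushforward.
Qed.

(** The hypothesis on [nu] is the case of indicators; linearity gives simple functions and monotone
    convergence the rest. *)
Lemma density_integral d (T : measurableType d) (mu nu : {measure set T -> \bar R})
    (g : T -> R) (f : T -> \bar R) :
  measurable_fun setT g -> (forall x, 0 <= g x) ->
  (forall A, measurable A -> nu A = \int[mu]_(x in A) (g x)%:E)%E ->
  measurable_fun setT f -> (forall x, 0 <= f x)%E ->
  (\int[nu]_x f x = \int[mu]_x (f x * (g x)%:E))%E.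
Proof.
move=> mg g0 nuE mf f0.
pose f_ := nnsfun_approx measurableT mf.
transitivity (limn (fun n => \int[nu]_x (f_ n x)%:E)%E).
  rewrite -monotone_convergence//.
  - apply: eq_integral => y _; apply/esym/cvg_lim => //.
    by apply: cvg_nnsfun_approx.
  - by move=> n; exact/measurable_EFinP/measurable_funP.
  - by move=> n y _; rewrite lee_fin.
  - by move=> y _ m n mn; rewrite lee_fin; exact/lefP/nd_nnsfun_approx.
rewrite [X in limn X](_ : _ = (fun n => \int[mu]_x ((f_ n x)%:E * (g x)%:E))%E).
  rewrite -monotone_convergence//; last 3 first.
    - move=> n; apply: emeasurable_funM; last exact/measurable_EFinP.
      exact/measurable_EFinP/measurable_funP.
    - by move=> n x _; rewrite mule_ge0// lee_fin.
    - move=> x _ m n mn; apply: lee_wpmul2r; first by rewrite lee_fin.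
      by rewrite lee_fin; exact/lefP/nd_nnsfun_approx.
  apply: eq_integral => x _; apply/cvg_lim => //.
  apply: cvgeZr => //.
  by apply: cvg_nnsfun_approx.
apply/funext => n.
transitivity (\sum_(k \in range (f_ n))
    \int[nu]_x (k * \1_(f_ n @^-1` [set k]) x)%:E)%E.
  under eq_integral do rewrite fimfunE -fsumEFin//.
  rewrite ge0_integral_fsum//.
  - by move=> y; exact/measurable_EFinP/measurable_funM.
  - by move=> y x _; rewrite nnfun_muleindic_ge0.
transitivity (\sum_(k \in range (f_ n))
    \int[mu]_x ((k * \1_(f_ n @^-1` [set k]) x)%:E * (g x)%:E))%E; last first.
  rewrite -ge0_integral_fsum//.
  - apply: eq_integral => x _; rewrite [in RHS]fimfunE -fsumEFin// ge0_mule_fsuml//.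
    by move=> y; rewrite nnfun_muleindic_ge0.
  - move=> y; apply: emeasurable_funM; last exact/measurable_EFinP.
    exact/measurable_EFinP/measurable_funM.
  - by move=> y x _; rewrite mule_ge0 ?nnfun_muleindic_ge0// lee_fin.
apply: eq_fsbigr => r _; rewrite integralZl_indic_nnsfun// integral_indic//= setIT.
rewrite nuE//.
have [r0|r0] := ltP r 0.
  rewrite preimage_nnfun0// integral_set0 mule0.
  by rewrite integral0_eq// => x _; rewrite indic0 mulr0 mul0e.
rewrite -ge0_integralZl//; last 2 first.
  - by apply: measurable_funTS; exact/measurable_EFinP.
  - by move=> x _; rewrite lee_fin.
rewrite [RHS](_ : _ = \int[mu]_(x in setT) ((fun x => r%:E * (g x)%:E) \_ (f_ n @^-1` [set r])) x)%E.
  by rewrite -integral_mkcond.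
apply: eq_integral => x _; rewrite patchE indicE.
by case: ifPn => _; rewrite ?mulr1 // mulr0 mul0e.
Qed.

End NormalIntegrals.

Section NormalLaw.
Context {R : realType} d (T : measurableType d) (P : probability T R).
Local Notation lam := (@lebesgue_measure R).

Lemma normal_law_integral (X : T -> R) (s : R) (f : R -> \bar R) :
  has_normal_law P X 0 s -> measurable_fun setT f -> (forall x, 0 <= f x)%E ->
  (\int[P]_w f (X w) = \int[lam]_x (f x * (normal_pdf 0 s x)%:E))%E.
Proof.
move=> [mX XE] mf f0.
have mY : measurable_fun setT (X : T -> measurableTypeR R) by [].
pose m1 := measure_function_pushforward__canonical__measure_function_Measure P mY.
rewrite -(@density_integral _ _ _ lam m1)//.
- by rewrite ge0_integral_pushforward.
- exact: measurable_normal_pdf.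
- by move=> x; exact: normal_pdf_ge0.
Qed.

Lemma normal_pdf_mul (s c x : R) : c != 0 -> s != 0 ->
  `|c| * normal_pdf 0 (`|c| * s) (c * x) = normal_pdf 0 s x.
Proof.
move=> c0 s0; rewrite !normal_pdfE ?mulf_neq0 ?normr_eq0//.
rewrite mulrA; congr (_ * _).
  rewrite /normal_peak.
  have -> : (`|c| * s) ^+ 2 * pi *+ 2 = `|c| ^+ 2 * (s ^+ 2 * pi *+ 2) by ring.
  rewrite sqrtrM ?sqr_ge0// sqrtr_sqr normr_id invfM mulrA divff ?mul1r//.
  by rewrite normr_eq0.
rewrite /normal_fun !subr0 !exprMn real_normK ?num_real//; congr expR.
by field; rewrite c0 s0.
Qed.

Lemma normal_law_scale (X : T -> R) (s c : R) : s != 0 -> c != 0 ->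
  has_normal_law P X 0 s ->
  has_normal_law P (fun w => c * X w) 0 (`|c| * s).
Proof.
move=> s0 c0 [mX XE]; split; first exact: measurable_funM.
move=> B mB.
have mcB : measurable ((fun x : R => c * x) @^-1` B).
  by rewrite -[X in measurable X]setTI; exact: (@measurable_funM _ _ R setT (cst c) id).
rewrite (_ : _ @^-1` B = X @^-1` ((fun x : R => c * x) @^-1` B))// XE//.
rewrite /normal_prob integral_mkcond [RHS]integral_mkcond.
rewrite [RHS](@integral_affine _ c 0)//; last 2 first.
- apply/(measurable_restrictT _ _).1 => //.
  by apply: measurable_funTS; apply/measurable_EFinP; exact: measurable_normal_pdf.
- by move=> x; rewrite patchE; case: ifP => // _; rewrite lee_fin normal_pdf_ge0.
rewrite -ge0_integralZl//.
- apply: eq_integral => x _; rewrite !patchE addr0.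
  rewrite (_ : (x \in _) = (c * x \in B)); last by apply/idP/idP; rewrite !inE.
  by case: ifP => _; rewrite ?mule0// -EFinM normal_pdf_mul.
- apply: (measurableT_comp (f := (fun x => (normal_pdf 0 (`|c| * s) x)%:E) \_ B)).
    apply/(measurable_restrictT _ _).1 => //.
    by apply: measurable_funTS; apply/measurable_EFinP; exact: measurable_normal_pdf.
  by apply: measurable_funD => //; exact: measurable_funM.
- by move=> x _; rewrite patchE; case: ifP => // _; rewrite lee_fin normal_pdf_ge0.
Qed.

(** Completing the square: the joint density of [U] and [U + V] equals the density of the sum times
    the conditional density of [U] given the sum, which is again normal. *)
Lemma normal_pdf_convolve (s t x z : R) : s != 0 -> t != 0 ->
  normal_pdf 0 s x * normal_pdf x t z =
  normal_pdf 0 (Num.sqrt (s ^+ 2 + t ^+ 2)) z *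
  normal_pdf (z * (s ^+ 2 / (s ^+ 2 + t ^+ 2)))
    (s * t / Num.sqrt (s ^+ 2 + t ^+ 2)) x.
Proof.
move=> s0 t0.
have s2 : 0 < s ^+ 2 by rewrite exprn_even_gt0.
have t2 : 0 < t ^+ 2 by rewrite exprn_even_gt0.
set r := Num.sqrt _.
have r2 : r ^+ 2 = s ^+ 2 + t ^+ 2 by rewrite sqr_sqrtr// addr_ge0// ltW.
have r0 : r != 0 by rewrite -sqrf_eq0 r2 gt_eqF// addr_gt0.
rewrite !normal_pdfE ?mulf_neq0 ?invr_eq0//.
rewrite mulrACA [RHS]mulrACA; congr (_ * _).
  rewrite /normal_peak -!invfM; congr (_^-1).
  have p0 (u : R) : 0 <= u ^+ 2 * pi *+ 2.
    by rewrite mulrn_wge0// mulr_ge0// ?sqr_ge0 ?pi_ge0.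
  rewrite -[LHS]sqrtrM// -[RHS]sqrtrM//; congr (Num.sqrt _).
  by field.
rewrite /normal_fun -!expRD; congr expR.
rewrite !subr0 !expr_div_n -r2.
have -> : s ^+ 2 = r ^+ 2 - t ^+ 2 by rewrite r2; ring.
have H : r ^+ 2 - t ^+ 2 != 0 by rewrite r2 addrK gt_eqF.
rewrite exprMn (_ : s ^+ 2 = r ^+ 2 - t ^+ 2); last by rewrite r2; ring.
by field; rewrite r0 t0 H.
Qed.

End NormalLaw.

(** * Independent pairs and sums of independent normal variables *)

Section IndepPair.
Context {R : realType} d (T : measurableType d) (P : probability T R).
Local Notation lam := (@lebesgue_measure R).

Definition indep_pair (U V : T -> R) := forall A B : set R,
  measurable A -> measurable B ->
  P (U @^-1` A `&` V @^-1` B) = (P (U @^-1` A) * P (V @^-1` B))%E.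

(** Independence says that the joint law agrees with the product of the two laws on rectangles,
    hence everywhere by uniqueness of the product measure; Tonelli then gives the iterated
    integral. *)
Lemma indep_pair_integral (U V : T -> R) (h : R * R -> \bar R) :
  measurable_fun setT U -> measurable_fun setT V -> indep_pair U V ->
  measurable_fun setT h -> (forall z, 0 <= h z)%E ->
  (\int[P]_w h (U w, V w) = \int[P]_w \int[P]_w' h (U w, V w'))%E.
Proof.
move=> mU mV UV mh h0.
pose U' : {mfun T >-> R} := HB.pack U (isMeasurableFun.Build _ _ _ _ _ mU).
pose V' : {mfun T >-> R} := HB.pack V (isMeasurableFun.Build _ _ _ _ _ mV).
pose mu1 := distribution P U'.
pose mu2 := distribution P V'.
have mUV : measurable_fun setT (fun w => (U w, V w)).
  exact: measurable_fun_pair.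
pose m1 := measure_function_pushforward__canonical__measure_function_Measure P mUV.
transitivity (\int[m1]_z h z)%E.
  by rewrite ge0_integral_pushforward.
transitivity (\int[mu1 \x mu2]_z h z)%E.
  apply: eq_measure_integral => A mA _.
  apply/esym; apply: (@product_measure_unique _ _ _ _ _ mu1 mu2) => //.
rewrite fubini_tonelli1//.
rewrite ge0_integral_pushforward//; last 2 first.
- exact: measurable_fun_fubini_tonelli_F.
- by move=> x _; apply: integral_ge0.
apply: eq_integral => w _; rewrite /= /fubini_F ge0_integral_pushforward//.
by apply: measurableT_comp => //; exact: measurable_pair1.
Qed.

Lemma indep_pair_mul (U V : T -> R) :
  measurable_fun setT U -> measurable_fun setT V -> indep_pair U V ->
  (forall w, 0 <= U w) -> (forall w, 0 <= V w) ->
  (\int[P]_w (U w * V w)%:E = \int[P]_w (U w)%:E * \int[P]_w (V w)%:E)%E.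
Proof.
move=> mU mV UV U0 V0.
(* The absolute value makes [h] nonnegative on the whole plane; [U] and [V] only provide this along
   their values. *)
pose h (z : R * R) := `|z.1 * z.2|%:E.
transitivity (\int[P]_w h (U w, V w))%E.
  by apply: eq_integral => w _; rewrite /h/= ger0_norm ?mulr_ge0.
rewrite (indep_pair_integral mU mV UV); last 2 first.
- apply/measurable_EFinP; apply: measurableT_comp => //.
  by apply: measurable_funM.
- by move=> z; rewrite lee_fin.
rewrite -ge0_integralZr//; last 3 first.
- exact/measurable_EFinP.
- by move=> w _; rewrite lee_fin.
- by apply: integral_ge0 => w _; rewrite lee_fin.
apply: eq_integral => w _; rewrite -ge0_integralZl//; last 3 first.
- exact/measurable_EFinP.
- by move=> x _; rewrite lee_fin.
- by rewrite lee_fin.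
by apply: eq_integral => w' _; rewrite /h/= ger0_norm ?mulr_ge0.
Qed.

(** Given [U = x], the sum is normal around [x]. After Tonelli, [normal_pdf_convolve] leaves the
    integral in [x] of a normal density, which is 1. *)
Lemma normal_law_add (U V : T -> R) (s t : R) : s != 0 -> t != 0 ->
  indep_pair U V -> has_normal_law P U 0 s -> has_normal_law P V 0 t ->
  has_normal_law P (fun w => U w + V w) 0 (Num.sqrt (s ^+ 2 + t ^+ 2)).
Proof.
move=> s0 t0 UV lU lV; have [mU UE] := lU; have [mV VE] := lV.
have mUV : measurable_fun setT (fun w => U w + V w) by exact: measurable_funD.
split => // B mB.
have mB' : measurable ((fun w => U w + V w) @^-1` B).
  by rewrite -[X in measurable X]setTI; exact: mUV.
transitivity (\int[P]_w (\1_((fun w => U w + V w) @^-1` B) w)%:E)%E.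
  by rewrite integral_indic// setIT.
rewrite /normal_prob.
pose h (z : R * R) : \bar R := (\1_B (z.1 + z.2))%:E.
have mh : measurable_fun setT h.
  apply/measurable_EFinP.
  apply: (@measurableT_comp _ _ _ _ _ _ (\1_B : R -> R) _ (fun z : R * R => z.1 + z.2)).
    exact: measurable_indic.
  by apply: measurable_funD.
transitivity (\int[P]_w h (U w, V w))%E.
  by apply: eq_integral => w _; rewrite /h !indicE /=; congr (_%:R)%:E; apply/idP/idP; rewrite !inE.
rewrite (indep_pair_integral mU mV UV)//; last by move=> z; rewrite lee_fin.
pose F (x : R) : \bar R := (\int[P]_w' h (x, V w'))%E.
have FE x : F x = (\int[lam]_z ((\1_B z * normal_pdf x t z)%:E))%E.
  rewrite /F (@normal_law_integral _ _ _ _ V t (fun y => h (x, y)))//; last 2 first.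
  - by apply: measurableT_comp => //; exact: measurable_pair1.
  - by move=> y; rewrite lee_fin.
  rewrite [RHS](@integral_affine _ 1 x) ?oner_neq0//; last 2 first.
  - apply/measurable_EFinP; apply: measurable_funM => //.
    exact: measurable_normal_pdf.
  - by move=> z; rewrite lee_fin mulr_ge0// normal_pdf_ge0.
  rewrite normr1 mul1e; apply: eq_integral => y _.
  rewrite mul1r /h/= -EFinM addrC; congr (_ * _)%:E.
  by rewrite !normal_pdfE// /normal_fun addrK subr0.
rewrite -/(F _).
transitivity (\int[P]_w F (U w))%E => //.
have mk : measurable_fun (setT : set (R * R))
    (fun z => (\1_B z.2 * (normal_pdf 0 s z.1 * normal_pdf z.1 t z.2))%:E).
  apply/measurable_EFinP; apply: measurable_funM.
    apply: (@measurableT_comp _ _ _ _ _ _ (\1_B : R -> R) _ snd) => //.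
  under eq_fun do rewrite normal_pdf_convolve//.
  apply: measurable_funM.
    by apply: measurableT_comp (measurable_normal_pdf _ _) _ => //; exact: measurable_snd.
  have r0 : s * t / Num.sqrt (s ^+ 2 + t ^+ 2) != 0.
    rewrite !mulf_neq0// invr_eq0 gt_eqF// sqrtr_gt0 ltr_pwDl ?sqr_ge0//.
    by rewrite exprn_even_gt0.
  under eq_fun do rewrite normal_pdfE//.
  apply: measurable_funM => //; apply: measurableT_comp => //.
  apply: measurable_funM => //; apply: measurableT_comp => //.
  apply: measurable_funX; apply: measurable_funB; first exact: measurable_fst.
  by apply: measurable_funM => //; exact: measurable_snd.
have k0 (z : R * R) :
    (0 <= (\1_B z.2 * (normal_pdf 0 s z.1 * normal_pdf z.1 t z.2))%:E)%E.
  by rewrite lee_fin !mulr_ge0 ?normal_pdf_ge0.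
have mF : measurable_fun setT F.
  apply: (@measurable_fun_fubini_tonelli_F _ _ _ _ _ P (fun z : R * T => h (z.1, V z.2))) => //.
    apply: (measurableT_comp mh); apply: measurable_fun_pair => //.
    exact: measurableT_comp.
  by move=> z; rewrite lee_fin.
rewrite (@normal_law_integral _ _ _ _ U s F)//; last first.
  by move=> x; apply: integral_ge0 => w _; rewrite lee_fin.
transitivity (\int[lam]_x \int[lam]_z
    (\1_B z * (normal_pdf 0 s x * normal_pdf x t z))%:E)%E.
  apply: eq_integral => x _; rewrite FE -ge0_integralZr//; last 3 first.
  - apply/measurable_EFinP; apply: measurable_funM => //.
    exact: measurable_normal_pdf.
  - by move=> z _; rewrite lee_fin mulr_ge0// normal_pdf_ge0.
  - by rewrite lee_fin normal_pdf_ge0.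
  by apply: eq_integral => z _; rewrite -EFinM -mulrA [_ * normal_pdf 0 s x]mulrC.
rewrite (@fubini_tonelli _ _ _ _ _ lam lam (fun z => (\1_B z.2 * (normal_pdf 0 s z.1 * normal_pdf z.1 t z.2))%:E))//.
rewrite [RHS]integral_mkcond; apply: eq_integral => z _ /=.
under eq_integral do rewrite normal_pdf_convolve// mulrA EFinM.
rewrite ge0_integralZl//; last 3 first.
- by apply/measurable_EFinP; exact: measurable_normal_pdf.
- by move=> x _; rewrite lee_fin normal_pdf_ge0.
- by rewrite lee_fin mulr_ge0// normal_pdf_ge0.
rewrite integral_normal_pdf mule1 patchE indicE.
by case: ifPn => _; rewrite ?mul1r ?mul0r.
Qed.

(** The exponential factor tilts the density of deviation [s] into that of deviation [s / r], up to
    the factor [r^-1]. Parametrizing by [r] instead of the exponent makes the value rational;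
    [r < 1] gives a positive exponent and [r > 1] a negative one. *)
Lemma normal_exp_sqr (X : T -> R) (s r : R) : 0 < s -> 0 < r ->
  has_normal_law P X 0 s ->
  (\int[P]_w (expR ((1 - r ^+ 2) / (s ^+ 2 *+ 2) * X w ^+ 2))%:E = (r^-1)%:E)%E.
Proof.
move=> s0 r0 lX.
rewrite (@normal_law_integral _ _ _ _ X s
  (fun x => (expR ((1 - r ^+ 2) / (s ^+ 2 *+ 2) * x ^+ 2))%:E))//; last first.
  apply/measurable_EFinP; apply: measurableT_comp => //.
  by apply: measurable_funM => //; exact: measurable_funX.
transitivity (\int[lam]_x ((r^-1)%:E * (normal_pdf 0 (s / r) x)%:E))%E.
  apply: eq_integral => x _; rewrite -!EFinM; congr EFin.
  rewrite !normal_pdfE ?mulf_neq0 ?invr_eq0 ?gt_eqF//.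
  rewrite mulrCA -expRD [RHS]mulrA; congr (_ * expR _).
    rewrite /normal_peak.
    have -> : (s / r) ^+ 2 * pi *+ 2 = r^-1 ^+ 2 * (s ^+ 2 * pi *+ 2).
      by rewrite exprMn; ring.
    rewrite sqrtrM ?sqr_ge0// sqrtr_sqr ger0_norm ?invr_ge0 ?ltW//.
    by rewrite invfM invrK mulrA mulVf ?mul1r// gt_eqF.
  by rewrite !subr0; field; rewrite !gt_eqF.
rewrite ge0_integralZl//; last 3 first.
- by apply/measurable_EFinP; exact: measurable_normal_pdf.
- by move=> x _; rewrite lee_fin normal_pdf_ge0.
- by rewrite lee_fin invr_ge0 ltW.
by rewrite integral_normal_pdf mule1.
Qed.

End IndepPair.

(** * Finite expectations and the moments of a normal variable *)

Section Expectations.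
Context {R : realType} d (T : measurableType d) (P : probability T R).

Implicit Types (f g : T -> R) (a b c t v C : R).

(** Bundles measurability, nonnegativity and a finite value, so that expectations can be handled as
    real numbers although the integral is extended-real. *)
Definition Ex_is (f : T -> R) (v : R) :=
  [/\ measurable_fun setT f, (forall w, 0 <= f w) & (\int[P]_w (f w)%:E = v%:E)%E].

Definition Ex_le (f : T -> R) (C : R) := exists2 v, Ex_is f v & v <= C.

Lemma Ex_is_ge0 f a : Ex_is f a -> 0 <= a.
Proof.
move=> [_ f0 fE]; rewrite -lee_fin -fE; apply: integral_ge0 => w _.
by rewrite lee_fin.
Qed.

Lemma Ex_isD f g a b : Ex_is f a -> Ex_is g b ->
  Ex_is (fun w => f w + g w) (a + b).
Proof.
move=> [mf f0 fE] [mg g0 gE]; split; first exact: measurable_funD.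
  by move=> w; rewrite addr_ge0.
under eq_integral do rewrite EFinD.
rewrite ge0_integralD//; last 4 first.
- by move=> w _; rewrite lee_fin.
- exact/measurable_EFinP.
- by move=> w _; rewrite lee_fin.
- exact/measurable_EFinP.
by rewrite fE gE.
Qed.

Lemma Ex_isZ c f a : 0 <= c -> Ex_is f a -> Ex_is (fun w => c * f w) (c * a).
Proof.
move=> c0 [mf f0 fE]; split; first exact: measurable_funM.
  by move=> w; rewrite mulr_ge0.
under eq_integral do rewrite EFinM.
rewrite ge0_integralZl//; last 2 first.
- exact/measurable_EFinP.
- by move=> w _; rewrite lee_fin.
by rewrite fE.
Qed.

Lemma Ex_is_cst c : 0 <= c -> Ex_is (fun=> c) c.
Proof.
move=> c0; split => //.
by rewrite integral_cst//= (@probability_setT _ _ _ P) mule1.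
Qed.

Lemma Ex_is_dom f g b : measurable_fun setT f -> (forall w, 0 <= f w) ->
  (forall w, f w <= g w) -> Ex_is g b -> Ex_le f b.
Proof.
move=> mf f0 fg [mg g0 gE].
have le : (\int[P]_w (f w)%:E <= b%:E)%E.
  rewrite -gE; apply: ge0_le_integral => //.
  - by move=> w _; rewrite lee_fin.
  - exact/measurable_EFinP.
  - exact/measurable_EFinP.
  - by move=> w _; rewrite lee_fin.
have ge : (0 <= \int[P]_w (f w)%:E)%E.
  by apply: integral_ge0 => w _; rewrite lee_fin.
have fin : (\int[P]_w (f w)%:E)%E \is a fin_num.
  by rewrite ge0_fin_numE// (le_lt_trans le)// ltry.
exists (fine (\int[P]_w (f w)%:E)%E); first by split => //; rewrite fineK.
by rewrite -lee_fin fineK.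
Qed.

Lemma Ex_is_uniq f a b : Ex_is f a -> Ex_is f b -> a = b.
Proof. by move=> [_ _ fE] [_ _]; rewrite fE => -[]. Qed.

Lemma Ex_is_le f g a b : Ex_is f a -> Ex_is g b -> (forall w, f w <= g w) -> a <= b.
Proof.
move=> fa gb fg; have [mf f0 _] := fa.
have [c fc cb] := Ex_is_dom mf f0 fg gb.
by rewrite (Ex_is_uniq fa fc).
Qed.

(** Replaces subtraction of expectations without signed integrals: [f] has a finite expectation
    because [f + g] dominates it, and additivity then determines the value. *)
Lemma Ex_is_cancel f g b c : measurable_fun setT f -> (forall w, 0 <= f w) ->
  Ex_is g b -> Ex_is (fun w => f w + g w) c -> Ex_is f (c - b).
Proof.
move=> mf f0 gb fgc; have [_ g0 _] := gb.
have [a fa _] : Ex_le f c by apply: Ex_is_dom fgc => // w; rewrite lerDl.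
by have <- := Ex_is_uniq (Ex_isD fa gb) fgc; rewrite addrK.
Qed.

Lemma Ex_leD f g a b : Ex_le f a -> Ex_le g b -> Ex_le (fun w => f w + g w) (a + b).
Proof.
move=> [a' fa a'a] [b' gb b'b]; exists (a' + b'); first exact: Ex_isD.
exact: lerD.
Qed.

Lemma Ex_leZ c f a : 0 <= c -> Ex_le f a -> Ex_le (fun w => c * f w) (c * a).
Proof.
move=> c0 [a' fa a'a]; exists (c * a'); first exact: Ex_isZ.
by rewrite ler_wpM2l.
Qed.

Lemma Ex_le_dom f g b : measurable_fun setT f -> (forall w, 0 <= f w) ->
  (forall w, f w <= g w) -> Ex_le g b -> Ex_le f b.
Proof.
move=> mf f0 fg [c gc cb]; have [a fa ac] := Ex_is_dom mf f0 fg gc.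
by exists a => //; exact: le_trans cb.
Qed.

Lemma Ex_le_trans f a b : a <= b -> Ex_le f a -> Ex_le f b.
Proof. by move=> ab [c fc ca]; exists c => //; exact: le_trans ab. Qed.

Lemma Ex_le_markov f a t : 0 < t -> Ex_le f a ->
  (P [set w | (t <= f w)%R] <= (a / t)%:E)%E.
Proof.
move=> t0 [v [mf f0 fE] va].
have mE : measurable [set w | (t <= f w)%R].
  rewrite (_ : [set w | _] = f @^-1` `[t, +oo[%classic).
    by rewrite -[X in measurable X]setTI; exact: mf.
  by apply/seteqP; split => w /=; rewrite in_itv/= andbT.
rewrite -(setIT [set w | _]) -integral_indic//.
have H : (\int[P]_w (\1_[set w | (t <= f w)%R] w)%:E <= (v / t)%:E)%E.
  rewrite mulrC EFinM -fE -ge0_integralZl//; last 3 first.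
  - exact/measurable_EFinP.
  - by move=> w _; rewrite lee_fin.
  - by rewrite lee_fin invr_ge0 ltW.
  apply: ge0_le_integral => //.
  - exact/measurable_EFinP/measurable_indic.
  - by apply/measurable_EFinP; exact: measurable_funM.
  - move=> w _; rewrite -EFinM lee_fin indicE; case: (boolP (w \in _)) => [|_].
      by rewrite inE/= mulrC ler_pdivlMr// mul1r.
    by rewrite mulr_ge0// invr_ge0 ltW.
by apply: (le_trans H); rewrite lee_fin ler_pM2r// invr_gt0.
Qed.

Lemma expR_ge_quad (y : R) : 0 <= y -> 1 + y + y ^+ 2 / 2 <= expR y.
Proof.
move=> y0.
have -> : 1 + y + y ^+ 2 / 2 = series (exp_coeff y) 3%N.
  rewrite /series/= !big_nat_recr//= big_nil /exp_coeff/=.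
  by rewrite expr0 expr1 fact0 (_ : 1`! = 1)%N// (_ : 2`! = 2)%N//; field.
apply: nondecreasing_cvgn_le; last exact: is_cvg_series_exp_coeff.
apply/nondecreasing_seqP => n; rewrite /series/= big_nat_recr//= lerDl.
by rewrite /exp_coeff/= divr_ge0// exprn_ge0.
Qed.

(** Inverts the lower bound for [expR y], since (1 - y + y^2/2) (1 + y + y^2/2) = 1 + y^4/4 >= 1. *)
Lemma expRN_le_quad (y : R) : 0 <= y -> expR (- y) <= 1 - y + y ^+ 2 / 2.
Proof.
move=> y0; have h := expR_ge_quad y0.
have p : 0 < 1 + y + y ^+ 2 / 2 by have := sqr_ge0 y; lra.
rewrite expRN; apply: (@le_trans _ _ (1 + y + y ^+ 2 / 2)^-1).
  by rewrite lef_pV2// posrE expR_gt0.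
rewrite -[leLHS]mul1r ler_pdivrMr//.
have -> : (1 - y + y ^+ 2 / 2) * (1 + y + y ^+ 2 / 2) = 1 + (y ^+ 2 / 2) ^+ 2 by field.
by rewrite lerDl sqr_ge0.
Qed.

Section Moments.
Variables (X : T -> R) (s : R).
Hypotheses (s0 : 0 < s) (lX : has_normal_law P X 0 s).

Let mX : measurable_fun setT X. Proof. by case: lX. Qed.

Lemma normal_Ex_expsqr r : 0 < r ->
  Ex_is (fun w => expR ((1 - r ^+ 2) / (s ^+ 2 *+ 2) * X w ^+ 2)) r^-1.
Proof.
move=> r0; split.
- apply: measurableT_comp => //; apply: measurable_funM => //.
  exact: measurable_funX.
- by move=> w; rewrite expR_ge0.
- exact: normal_exp_sqr.
Qed.

Let mX2 : measurable_fun setT (fun w => X w ^+ 2).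
Proof. exact: measurable_funX. Qed.

Let mX4 : measurable_fun setT (fun w => X w ^+ 4).
Proof. exact: measurable_funX. Qed.

Let th_ge0 r : 0 < r -> r < 1 -> 0 < (1 - r ^+ 2) / (s ^+ 2 *+ 2).
Proof.
move=> r0 r1; rewrite divr_gt0 ?pmulrn_lgt0 ?exprn_gt0// subr_gt0.
by rewrite exprn_ilt1 ?ltW.
Qed.

Let th_le0 r : 1 < r -> 0 < - ((1 - r ^+ 2) / (s ^+ 2 *+ 2)).
Proof.
move=> r1; rewrite -mulNr opprB divr_gt0 ?pmulrn_lgt0 ?exprn_gt0// subr_gt0.
by rewrite exprn_egt1.
Qed.

(** Finiteness is settled before the value: with [r = 1/2] the exponential moment is finite, and it
    dominates a multiple of [X ^+ 2]. *)
Let X2_Ex : exists a, Ex_is (fun w => X w ^+ 2) a.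
Proof.
have h2 : (0 : R) < 1 / 2 by lra.
have t0 := th_ge0 h2 ltac:(lra); set t := (_ / (s ^+ 2 *+ 2)) in t0.
have [a Xa _] : Ex_le (fun w => X w ^+ 2) (t^-1 * (1 / 2)^-1).
  apply: Ex_is_dom (Ex_isZ _ (normal_Ex_expsqr h2)) => //.
  - by move=> w; exact: sqr_ge0.
  - move=> w; rewrite -/t [leRHS]mulrC ler_pdivlMr// mulrC.
    by have := expR_ge1Dx (t * X w ^+ 2); lra.
  - by rewrite invr_ge0 ltW.
by exists a.
Qed.

Let X4_Ex : exists a, Ex_is (fun w => X w ^+ 4) a.
Proof.
have h2 : (0 : R) < 1 / 2 by lra.
have t0 := th_ge0 h2 ltac:(lra); set t := (_ / (s ^+ 2 *+ 2)) in t0.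
have [a Xa _] : Ex_le (fun w => X w ^+ 4) ((2 / t ^+ 2) * (1 / 2)^-1).
  apply: Ex_is_dom (Ex_isZ _ (normal_Ex_expsqr h2)) => //.
  - by move=> w; rewrite -[4%N]/(2 * 2)%N exprM sqr_ge0.
  - move=> w; rewrite -/t mulrAC ler_pdivlMr ?exprn_gt0//.
    have h := mulr_ge0 (ltW t0) (sqr_ge0 (X w)); move: h (expR_ge_quad h).
    rewrite (_ : X w ^+ 4 = (X w ^+ 2) ^+ 2); last by rewrite -exprM.
    set A := X w ^+ 2; move=> ? ?; lra.
  - by rewrite divr_ge0 ?sqr_ge0.
by exists a.
Qed.

Let le_small (x y C : R) : (forall e, 0 < e -> e < 1 -> x <= y + e * C) -> x <= y.
Proof.
move=> H; rewrite leNgt; apply/negP => yx.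
have D0 : 0 < 1 + `|C| by rewrite ltr_pwDl.
pose e := Num.min (1 / 2) ((x - y) / (2 * (1 + `|C|))).
have e0 : 0 < e.
  by rewrite lt_min divr_gt0//= ?divr_gt0 ?mulr_gt0 ?subr_gt0//; lra.
have e1 : e < 1 by rewrite gt_min; apply/orP; left; lra.
have := H e e0 e1; rewrite leNgt => /negP; apply.
have : e * (2 * (1 + `|C|)) <= x - y.
  by rewrite -ler_pdivlMr ?mulr_gt0// ge_min lexx orbT.
have := ler_norm C.
have := normr_ge0 C.
nra.
Qed.

(* Both moments are squeezed out of the exact value of [E exp(theta X^2)] by
   letting [theta] tend to 0 from either side. *)
Lemma normal_moment2 : Ex_is (fun w => X w ^+ 2) (s ^+ 2).
Proof.
have [a Xa] := X2_Ex; suff -> : s ^+ 2 = a by [].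
have s20 : 0 < s ^+ 2 by rewrite exprn_gt0.
have key r : 0 < r -> (1 - r ^+ 2) / 2 * (a / s ^+ 2) + 1 <= r^-1.
  move=> r0; have Xr := normal_Ex_expsqr r0.
  have tE : (1 - r ^+ 2) / (s ^+ 2 *+ 2) * a = (1 - r ^+ 2) / 2 * (a / s ^+ 2).
    by field; rewrite gt_eqF.
  rewrite -tE; set t := (_ / (s ^+ 2 *+ 2)) in Xr *.
  have [t0|t0] := leP 0 t.
    apply: (Ex_is_le (Ex_isD (Ex_isZ t0 Xa) (Ex_is_cst ler01)) Xr) => w.
    by rewrite addrC expR_ge1Dx.
  have nt0 : 0 <= - t by rewrite oppr_ge0 ltW.
  have := Ex_is_le (Ex_is_cst ler01) (Ex_isD Xr (Ex_isZ nt0 Xa)).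
  rewrite mulNr lerBrDr addrC; apply => w.
  by rewrite mulNr lerBrDr expR_ge1Dx.
have [nu anu] : exists nu, nu = a / s ^+ 2 by exists (a / s ^+ 2).
rewrite -anu in key.
have nu0 : 0 <= nu by rewrite anu divr_ge0 ?(Ex_is_ge0 Xa)// ltW.
suff nu1 : nu = 1.
  by move: anu; rewrite nu1 => /(congr1 (fun z => z * s ^+ 2)); rewrite divfK ?gt_eqF// mul1r.
have key' r : 0 < r -> ((1 - r ^+ 2) / 2 * nu + 1) * r <= 1.
  by move=> r0; rewrite -ler_pdivlMr// mul1r key.
apply/eqP; rewrite eq_le; apply/andP; split.
  apply: (@le_small _ _ (2 * nu)) => e e0 e1.
  have := key' (1 - e) ltac:(lra).
  rewrite (_ : (_ / 2 * nu + 1) * _ = 1 - e + e * ((1 - e / 2) * (1 - e) * nu)); last by field.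
  move=> h; have {}h : e * ((1 - e / 2) * (1 - e) * nu) <= e * 1 by lra.
  rewrite ler_pM2l// in h.
  have : 0 <= e ^+ 2 * nu by rewrite mulr_ge0 ?sqr_ge0.
  have : 0 <= e * nu by rewrite mulr_ge0// ltW.
  move: h; rewrite (_ : _ * _ * nu = nu - 3 / 2 * (e * nu) + e ^+ 2 * nu / 2); last by field.
  move=> ? ? ?; lra.
apply: (@le_small _ _ (2 * nu)) => e e0 e1.
have := key' (1 + e) ltac:(lra).
rewrite (_ : (_ / 2 * nu + 1) * _ = 1 + e - e * ((1 + e / 2) * (1 + e) * nu)); last by field.
move=> h; have {}h : e * 1 <= e * ((1 + e / 2) * (1 + e) * nu) by lra.
rewrite ler_pM2l// in h.
have : 0 <= e * nu by rewrite mulr_ge0// ltW.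
have : e ^+ 2 * nu <= e * nu by rewrite ler_wpM2r// expr2 ler_piMl ?ltW.
move: h; rewrite (_ : _ * _ * nu = nu + 3 / 2 * (e * nu) + e ^+ 2 * nu / 2); last by field.
move=> ? ? ?; lra.
Qed.

Lemma normal_moment4 : Ex_is (fun w => X w ^+ 4) (3 * s ^+ 4).
Proof.
have [b Xb] := X4_Ex; have Xa := normal_moment2.
suff -> : 3 * s ^+ 4 = b by [].
have s40 : 0 < s ^+ 4 by rewrite exprn_gt0.
have [nu bnu] : exists nu, nu = b / s ^+ 4 by exists (b / s ^+ 4).
have nu0 : 0 <= nu by rewrite bnu divr_ge0 ?(Ex_is_ge0 Xb)// ltW.
have tE r : (1 - r ^+ 2) / (s ^+ 2 *+ 2) * s ^+ 2 = (1 - r ^+ 2) / 2.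
  by field; rewrite gt_eqF.
have tE2 r : ((1 - r ^+ 2) / (s ^+ 2 *+ 2)) ^+ 2 * b = ((1 - r ^+ 2) / 2) ^+ 2 * nu.
  by rewrite bnu; field; rewrite gt_eqF.
have key1 r : 0 < r -> r < 1 ->
    (1 + (1 - r ^+ 2) / 2 + ((1 - r ^+ 2) / 2) ^+ 2 * nu / 2) * r <= 1.
  move=> r0 r1; rewrite -ler_pdivlMr// mul1r.
  have t0 := th_ge0 r0 r1; have Xr := normal_Ex_expsqr r0.
  rewrite -tE2 -[X in 1 + X]tE; set t := (_ / (s ^+ 2 *+ 2)) in t0 Xr *.
  have t2 : 0 <= t ^+ 2 / 2 by rewrite divr_ge0 ?sqr_ge0.
  rewrite (_ : t ^+ 2 * b / 2 = t ^+ 2 / 2 * b); last by field.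
  apply: (Ex_is_le (Ex_isD (Ex_isD (Ex_is_cst ler01) (Ex_isZ (ltW t0) Xa)) (Ex_isZ t2 Xb)) Xr).
  move=> w; apply: le_trans (expR_ge_quad _); last by rewrite mulr_ge0 ?sqr_ge0// ltW.
  rewrite (_ : X w ^+ 4 = (X w ^+ 2) ^+ 2); last by rewrite -exprM.
  by set A := X w ^+ 2; lra.
have key2 r : 1 < r ->
    1 <= (1 + (1 - r ^+ 2) / 2 + ((1 - r ^+ 2) / 2) ^+ 2 * nu / 2) * r.
  move=> r1; have r0 : 0 < r by lra.
  rewrite -ler_pdivrMr// mul1r.
  have t0 := th_le0 r1; have Xr := normal_Ex_expsqr r0.
  rewrite -tE2 -[X in 1 + X]tE; set t := (_ / (s ^+ 2 *+ 2)) in t0 Xr *.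
  have t2 : 0 <= t ^+ 2 / 2 by rewrite divr_ge0 ?sqr_ge0.
  rewrite (_ : t ^+ 2 * b / 2 = t ^+ 2 / 2 * b); last by field.
  have := Ex_is_le (Ex_isD Xr (Ex_isZ (ltW t0) Xa)) (Ex_isD (Ex_is_cst ler01) (Ex_isZ t2 Xb)).
  rewrite mulNr lerBlDr addrAC; apply => w; rewrite -?lerBlDr.
  have := expRN_le_quad (mulr_ge0 (ltW t0) (sqr_ge0 (X w))).
  rewrite mulNr opprK; set A := X w ^+ 2.
  rewrite (_ : X w ^+ 4 = A ^+ 2); last by rewrite -exprM.
  by move=> ?; lra.
suff nu3 : nu = 3.
  by move: bnu; rewrite nu3 => /(congr1 (fun z => z * s ^+ 4)); rewrite divfK ?gt_eqF.
apply/eqP; rewrite eq_le; apply/andP; split.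
  apply: (@le_small _ _ (2 * nu)) => e e0 e1.
  have := key1 (1 - e) ltac:(lra) ltac:(lra).
  (* Because the second moment is exact, the terms of order [e] cancel; dividing by [e ^+ 2] leaves
     [nu <= 3] up to an error of order [e]. *)
  rewrite (_ : _ * (1 - e) = 1 + e ^+ 2 * ((1 - e / 2) ^+ 2 * (1 - e) * nu / 2 - 3 / 2 + e / 2)); last by field.
  rewrite gerDl pmulr_rle0 ?exprn_gt0// => h.
  have h0 : 0 <= e * nu by rewrite mulr_ge0// ltW.
  have h1 : e ^+ 2 * nu <= e * nu by rewrite ler_wpM2r// expr2 ler_piMl ?ltW.
  have h2 : 0 <= e ^+ 2 * nu by rewrite mulr_ge0// sqr_ge0.
  have h3 : e ^+ 3 * nu <= e ^+ 2 * nu by rewrite ler_wpM2r// (exprS e 2) ler_piMl ?sqr_ge0 ?ltW.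
  move: h; rewrite (_ : (1 - e / 2) ^+ 2 * (1 - e) * nu = nu - 2 * (e * nu) + 5 / 4 * (e ^+ 2 * nu) - e ^+ 3 * nu / 4); last by field.
  move=> h; lra.
apply: (@le_small _ _ (5 * nu)) => e e0 e1.
have := key2 (1 + e) ltac:(lra).
rewrite (_ : _ * (1 + e) = 1 + e ^+ 2 * ((1 + e / 2) ^+ 2 * (1 + e) * nu / 2 - 3 / 2 - e / 2)); last by field.
rewrite lerDl pmulr_rge0 ?exprn_gt0// => h.
have h0 : 0 <= e * nu by rewrite mulr_ge0// ltW.
have h1 : e ^+ 2 * nu <= e * nu by rewrite ler_wpM2r// expr2 ler_piMl ?ltW.
have h3 : e ^+ 3 * nu <= e ^+ 2 * nu by rewrite ler_wpM2r// (exprS e 2) ler_piMl ?sqr_ge0 ?ltW.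
move: h; rewrite (_ : (1 + e / 2) ^+ 2 * (1 + e) * nu = nu + 2 * (e * nu) + 5 / 4 * (e ^+ 2 * nu) + e ^+ 3 * nu / 4); last by field.
move=> h; lra.
Qed.

End Moments.
End Expectations.

(** * Independence of blocks of coordinates *)

Section Blocks.
Context {R : realType} d (T : measurableType d) (P : probability T R).
Variables (I : finType) (J : {set I}) (X : I -> T -> R).
Hypothesis mX : forall k, k \in J -> measurable_fun setT (X k).
Hypothesis indX : mutually_independent P J X.
Implicit Types (A B : {set I}) (S : set T).

(** The pi-system of finite-dimensional rectangles in the coordinates of [A]; it generates the
    sigma-algebra of that block. *)
Definition cylinders A : set (set T) :=
  [set S | exists2 E : I -> set R, (forall k, measurable (E k)) &
           S = \bigcap_(k in [set k | k \in A]) (X k @^-1` E k)].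

(** Measurability for the sigma-algebra of the coordinates in [A] alone: the form in which functions
    of disjoint blocks inherit independence. *)
Definition block_measurable A (f : T -> R) :=
  @measurable_fun _ _ (g_sigma_algebraType (cylinders A)) R setT f.

Lemma cylinders_setI A : setI_closed (cylinders A).
Proof.
move=> _ _ [E mE ->] [F mF ->]; exists (fun k => E k `&` F k).
  by move=> k; exact: measurableI.
rewrite -bigcapI; apply: eq_bigcapr => k _; exact: preimage_setI.
Qed.

Lemma cylinders_setT A : cylinders A setT.
Proof.
exists (fun=> setT) => //.
by apply/seteqP; split => // w _ k _.
Qed.

Lemma cylinders_sub A B : A \subset B -> cylinders A `<=` cylinders B.
Proof.
move=> /fintype.subsetP AB _ [E mE ->].
exists (fun k => if k \in A then E k else setT).
  by move=> k; case: ifP.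
apply/seteqP; split => w H k /= kA.
  by case: ifP => // kA'; exact: H.
by have := H k (AB _ kA) => /=; rewrite kA.
Qed.

Lemma cylinders_measurable A : A \subset J -> cylinders A `<=` measurable.
Proof.
move=> /fintype.subsetP AJ _ [E mE ->].
apply: fin_bigcap_measurable; first exact: finite_finpred.
by move=> k /= kA; rewrite -[X in measurable X]setTI; apply: mX => //; exact: AJ.
Qed.

Lemma block_measurable_sub A B f : A \subset B ->
  block_measurable A f -> block_measurable B f.
Proof.
move=> AB mf _ Y mY; have := mf measurableT Y mY.
by apply: sub_smallest2r; [exact: smallest_sigma_algebra|exact: cylinders_sub].
Qed.

Lemma block_measurableW A f : A \subset J -> block_measurable A f ->
  measurable_fun setT f.
Proof.
move=> AJ mf _ Y mY; have := mf measurableT Y mY.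
apply: smallest_sub; first exact: sigma_algebra_measurable.
exact: cylinders_measurable.
Qed.

Lemma block_measurable_coord A k : k \in A -> measurable_fun setT (X k) ->
  block_measurable A (X k).
Proof.
move=> kA mXk _ Y mY; apply: sub_sigma_algebra; rewrite setTI.
exists (fun j => if j == k then Y else setT); first by move=> j; case: ifP.
apply/seteqP; split => [w Hw j /= jA|w H].
  by case: eqP => // ->.
by have := H k kA => /=; rewrite eqxx.
Qed.

(** As the blocks are disjoint, both rectangles come from one family [G]; the product formula over
    [A], [B] and their union gives the claim. *)
Lemma indep_cylinders A B S S' : A \subset J -> B \subset J -> fintype.disjoint (mem A) (mem B) ->
  cylinders A S -> cylinders B S' -> P (S `&` S') = (P S * P S')%E.
Proof.
move=> AJ BJ AB [E mE ->] [F mF ->].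
pose G k := if k \in A then E k else F k.
have mG k : measurable (G k) by rewrite /G; case: ifP.
have EG k : k \in A -> E k = G k by rewrite /G => ->.
have FG k : k \in B -> F k = G k.
  by move=> kB; rewrite /G (disjointFl AB kB).
have -> : \bigcap_(k in [set k | k \in A]) X k @^-1` E k =
          \bigcap_(k in [set k | k \in A]) X k @^-1` G k.
  by apply: eq_bigcapr => k kA; rewrite EG.
have -> : \bigcap_(k in [set k | k \in B]) X k @^-1` F k =
          \bigcap_(k in [set k | k \in B]) X k @^-1` G k.
  by apply: eq_bigcapr => k kB; rewrite FG.
rewrite !indX//.
have AUB : (A :|: B)%SET \subset J by rewrite finset.subUset AJ.
transitivity (P (\bigcap_(k in [set k | k \in (A :|: B)%SET]) (X k @^-1` G k))).
  rewrite -bigcap_setU; congr (P (\bigcap_(k in _) _)).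
  by apply/seteqP; split => k /=; rewrite finset.in_setU => /orP.
rewrite indX// -bigU//=; apply: eq_bigl => k.
by rewrite finset.in_setU.
Qed.

(** Two finite measures, P(. & S0) and P(.) P(S0), that agree on a pi-system agree on the generated
    sigma-algebra. Applied once for each block, the other event being held fixed. *)
Lemma indep_sigma A B S S' : A \subset J -> B \subset J -> fintype.disjoint (mem A) (mem B) ->
  <<s cylinders A >> S -> <<s cylinders B >> S' -> P (S `&` S') = (P S * P S')%E.
Proof.
move=> AJ BJ AB.
have sm (C : {set I}) S0 : C \subset J -> <<s cylinders C >> S0 -> measurable S0.
  move=> CJ; apply: smallest_sub; first exact: sigma_algebra_measurable.
  exact: cylinders_measurable.
have gen (C : {set I}) (CJ : C \subset J) S0 (mS0 : measurable S0) :
    (forall S1, cylinders C S1 -> P (S1 `&` S0) = (P S1 * P S0)%E) ->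
    forall S1, <<s cylinders C >> S1 -> P (S1 `&` S0) = (P S1 * P S0)%E.
  move=> H S1 CS1.
  have PS0 : (fine (P S0))%:E = P S0 by rewrite fineK// fin_num_measure.
  pose m1 := mrestr P mS0.
  pose m2 : {measure set T -> \bar R} := mscale (NngNum (fine_ge0 (measure_ge0 P S0))) P.
  have := @g_sigma_algebra_measure_unique _ _ T (cylinders C)
    (cylinders_measurable CJ) (fun=> setT) (fun=> cylinders_setT C) _ m1 m2
    (@cylinders_setI C) _ _ S1 CS1.
  rewrite /m1 /m2 /mrestr/= /mscale/= PS0 muleC; apply.
  - by rewrite bigcup_const.
  - by move=> S2 CS2; rewrite /mrestr muleC; exact: H.
  - by move=> k; rewrite /mrestr setTI; apply: le_lt_trans (probability_le1 P mS0) _; rewrite ltry.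
move=> AS BS'; apply: (gen A AJ S' (sm _ _ BJ BS')) => // S1 AS1.
rewrite setIC muleC; apply: (gen B BJ S1 (cylinders_measurable AJ AS1)) => // S2 BS2.
by rewrite setIC muleC; exact: (indep_cylinders AJ BJ AB AS1 BS2).
Qed.

Lemma indep_pair_block A B U V : A \subset J -> B \subset J -> fintype.disjoint (mem A) (mem B) ->
  block_measurable A U -> block_measurable B V -> indep_pair P U V.
Proof.
move=> AJ BJ AB mU mV E F mE mF; apply: (indep_sigma AJ BJ AB).
  by have := mU measurableT E mE; rewrite setTI.
by have := mV measurableT F mF; rewrite setTI.
Qed.

(** The induction carries the block of the partial product along with its expectation: disjointness
    of this block from the next one is what lets the expectations multiply. *)
Lemma Ex_is_prod_block (K : eqType) (s : seq K) (A : K -> {set I})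
    (U : K -> T -> R) (v : K -> R) :
  uniq s -> (forall i j, i != j -> fintype.disjoint (mem (A i)) (mem (A j))) ->
  (forall i, A i \subset J) ->
  (forall i, block_measurable (A i) (U i)) -> (forall i, Ex_is P (U i) (v i)) ->
  block_measurable (\bigcup_(i <- s) A i)%SET (fun w => \prod_(i <- s) U i w) /\
  Ex_is P (fun w => \prod_(i <- s) U i w) (\prod_(i <- s) v i).
Proof.
move=> us dis AJ mU Uv; elim: s us => [|i s IH] /=.
  move=> _; rewrite !big_nil; under eq_fun do rewrite big_nil.
  by split; [exact: measurable_cst|exact: Ex_is_cst].
move=> /andP[nis us]; have [mp Ep] := IH us.
have UE : (fun w => \prod_(j <- i :: s) U j w) =
    (fun w => U i w * \prod_(j <- s) U j w).
  by apply/funext => w; rewrite big_cons.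
rewrite UE !big_cons.
have sJ : (\bigcup_(i <- s) A i)%SET \subset J.
  by rewrite big_seq; elim/big_ind: _ => [|B C|j _]; rewrite ?finset.sub0set ?finset.subUset// => -> ->.
split.
  apply: measurable_funM.
    by apply: block_measurable_sub (mU i); exact: finset.subsetUl.
  by apply: block_measurable_sub mp; exact: finset.subsetUr.
have [mUi Ui0 UiE] := Uv i; have [mP P0 PE] := Ep.
split.
- exact: measurable_funM.
- by move=> w; rewrite mulr_ge0.
rewrite indep_pair_mul ?UiE ?PE//.
apply: (@indep_pair_block (A i) (\bigcup_(i <- s) A i)%SET) => //.
rewrite big_seq; elim/big_ind: _ => [|B C|j js].
- by rewrite disjoint_sym finset.disjoints_subset finset.sub0set.
- by rewrite !finset.disjoints_subset finset.setCU finset.subsetI => -> ->.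
- by apply: dis; apply: contraNneq nis => ->.
Qed.

(** Coordinates are added one at a time, the partial sum being independent of the next one by its
    block. A form with zero coefficients has no density, hence the alternative. *)
Lemma normal_linear_form (s : seq I) (c : I -> R) (sigma : R) :
  uniq s -> {subset s <= J} -> 0 < sigma ->
  (forall k, k \in J -> has_normal_law P (X k) 0 sigma) ->
  block_measurable [set k in s]%SET (fun w => \sum_(k <- s) c k * X k w) /\
  ((\sum_(k <- s) c k ^+ 2 = 0 /\ (fun w => \sum_(k <- s) c k * X k w) = cst 0) \/
   (0 < \sum_(k <- s) c k ^+ 2 /\
    has_normal_law P (fun w => \sum_(k <- s) c k * X k w) 0
      (sigma * Num.sqrt (\sum_(k <- s) c k ^+ 2)))).
Proof.
move=> us sJ sg0 lX; elim: s us sJ => [|k s IH] /= us sJ.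
  have L0 : (fun w => \sum_(k <- [::]) c k * X k w) = cst 0.
    by apply/funext => w; rewrite big_nil.
  by rewrite L0 big_nil; split; [exact: measurable_cst|left].
move: us => /andP[ks us].
have kJ : k \in J by apply: sJ; rewrite mem_head.
have sJ' : {subset s <= J} by move=> j js; apply: sJ; rewrite in_cons js orbT.
have [mL IHL] := IH us sJ'.
have mk : block_measurable [set k]%SET (fun w => c k * X k w).
  apply: measurable_funM; first exact: measurable_cst.
  by apply: block_measurable_coord; [rewrite finset.in_set1|exact: mX].
have LE : (fun w => \sum_(j <- k :: s) c j * X j w) =
    (fun w => c k * X k w + \sum_(j <- s) c j * X j w).
  by apply/funext => w; rewrite big_cons.
rewrite LE big_cons; split.
  apply: measurable_funD.
    by apply: block_measurable_sub mk; apply/fintype.subsetP => j; rewrite !finset.inE => ->.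
  apply: block_measurable_sub mL; apply/fintype.subsetP => j.
  by rewrite !finset.inE => ->; rewrite orbT.
have [ck0|ck0] := eqVneq (c k) 0.
  rewrite ck0 expr0n/= add0r.
  rewrite (_ : (fun w => _) = (fun w => \sum_(j <- s) c j * X j w))//.
  by apply/funext => w; rewrite mul0r add0r.
right.
have ck2 : 0 < c k ^+ 2 by rewrite exprn_even_gt0.
have lk : has_normal_law P (fun w => c k * X k w) 0 (`|c k| * sigma).
  by apply: normal_law_scale => //; [rewrite gt_eqF|exact: lX].
case: IHL => [[-> L0]|[sp lL]].
  rewrite addr0; split => //.
  rewrite (_ : (fun w => _) = (fun w => c k * X k w)); last first.
    by apply/funext => w; rewrite (congr1 (@^~ w) L0)/= addr0.
  by rewrite sqrtr_sqr mulrC.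
split; first by rewrite addr_gt0.
rewrite (_ : sigma * _ = Num.sqrt ((`|c k| * sigma) ^+ 2 +
    (sigma * Num.sqrt (\sum_(j <- s) c j ^+ 2)) ^+ 2)); last first.
  rewrite !exprMn sqr_sqrtr ?(ltW sp)// real_normK ?num_real//.
  rewrite [_ * sigma ^+ 2]mulrC -mulrDr.
  by rewrite sqrtrM ?sqr_ge0// sqrtr_sqr gtr0_norm//.
apply: normal_law_add => //.
- by rewrite mulf_neq0 ?normr_eq0// gt_eqF.
- by rewrite mulf_neq0 ?gt_eqF// sqrtr_gt0.
apply: (@indep_pair_block [set k]%SET [set j in s]%SET) => //.
- by rewrite finset.sub1set.
- by apply/fintype.subsetP => j; rewrite finset.inE => /sJ'.
- by rewrite finset.disjoints1 finset.inE.
Qed.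

End Blocks.

(** * Moments of Gaussian measurements *)

Section Amplitude.
Context {R : realType}.
Local Notation C := R[i].
Local Notation Re := complex.Re.
Local Notation Im := complex.Im.

(** [reip] and [imip] are the real and imaginary parts of a* u, and [sqamp] is |a* u|^2. Working
    with real sums keeps all later identities within ordered real algebra. *)
Definition reip d (a u : 'cV[C]_d) : R :=
  \sum_(j < d) (Re (a j 0) * Re (u j 0) + Im (a j 0) * Im (u j 0)).
Definition imip d (a u : 'cV[C]_d) : R :=
  \sum_(j < d) (Re (a j 0) * Im (u j 0) - Im (a j 0) * Re (u j 0)).
Definition sqamp d (a u : 'cV[C]_d) : R := reip a u ^+ 2 + imip a u ^+ 2.

Lemma sqamp_ge0 d (a u : 'cV[C]_d) : 0 <= sqamp a u.
Proof. by rewrite addr_ge0 ?sqr_ge0. Qed.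

End Amplitude.

Section GaussianAmplitude.
Context {R : realType} dsp (T : measurableType dsp) (P : probability T R).
Variables (gc : bool) (n d : nat) (g : 'I_n -> 'I_d -> bool -> T -> R).
Hypothesis iid : iid_std_gaussian P gc g.
Local Notation C := R[i].
Local Notation Re := complex.Re.
Local Notation Im := complex.Im.

Definition gcoord (k : 'I_n * 'I_d * bool) := g k.1.1 k.1.2 k.2.
Definition gindex : {set 'I_n * 'I_d * bool} :=
  if gc then finset.setTfor _ else [set k | ~~ k.2]%SET.
Definition gsigma : R := if gc then Num.sqrt 2^-1 else 1.

Lemma gcoord_indep : mutually_independent P gindex gcoord.
Proof. by move: iid; rewrite /iid_std_gaussian /gindex; case: (gc) => -[]. Qed.

Lemma gsigma_gt0 : 0 < gsigma.
Proof. by rewrite /gsigma; case: (gc); rewrite ?sqrtr_gt0. Qed.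

Lemma gcoord_law k : k \in gindex -> has_normal_law P (gcoord k) 0 gsigma.
Proof.
move: iid; rewrite /iid_std_gaussian /gindex /gsigma /gcoord.
case: (gc) => -[_ H]; first by move=> _; exact: H.
by rewrite finset.inE => /negbTE ->; exact: H.
Qed.

Lemma gcoord_meas k : k \in gindex -> measurable_fun setT (gcoord k).
Proof. by move=> /gcoord_law[]. Qed.

Definition gparts : seq bool := if gc then [:: false; true] else [:: false].

Definition gseq (i : 'I_n) : seq ('I_n * 'I_d * bool) :=
  [seq (i, j, b) | j <- enum 'I_d, b <- gparts].

Definition gblock (i : 'I_n) : {set 'I_n * 'I_d * bool} := [set k in gseq i]%SET.

Lemma gseq_uniq i : uniq (gseq i).
Proof.
apply: allpairs_uniq; [exact: enum_uniq|by rewrite /gparts; case: (gc)|].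
by move=> [j b] [j' b'] _ _ /= [-> ->].
Qed.

Lemma gseq_sub i : {subset gseq i <= gindex}.
Proof.
move=> k /allpairsP[[j b] [_ /= bp ->]]; rewrite /gindex.
move: bp; rewrite /gparts; case: (gc); rewrite !finset.inE//=.
by move=> /eqP ->.
Qed.

Lemma gblock_sub i : gblock i \subset gindex.
Proof. by apply/fintype.subsetP => k; rewrite finset.inE => /gseq_sub. Qed.

Lemma gblock_disj i j : i != j ->
  fintype.disjoint (mem (gblock i)) (mem (gblock j)).
Proof.
move=> ij; rewrite disjoint_subset; apply/fintype.subsetP => k.
rewrite !inE => /allpairsP[[a b] [_ _ ->]] /=.
apply/negP => /allpairsP[[a' b'] [_ _ /= [/eqP]]].
by rewrite (negbTE ij).
Qed.

Definition lform i (c : 'I_d -> bool -> R) (w : T) : R :=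
  \sum_(k <- gseq i) c k.1.2 k.2 * gcoord k w.

Definition lnorm (c : 'I_d -> bool -> R) : R :=
  \sum_(j < d) \sum_(b <- gparts) c j b ^+ 2.

Lemma lformE i c w :
  lform i c w = \sum_(j < d) \sum_(b <- gparts) c j b * g i j b w.
Proof. by rewrite /lform big_allpairs_dep big_enum. Qed.

Lemma lnormE i c : \sum_(k <- gseq i) c k.1.2 k.2 ^+ 2 = lnorm c.
Proof. by rewrite big_allpairs_dep big_enum. Qed.

Lemma lform_block i c : block_measurable gcoord (gblock i) (lform i c).
Proof.
have [] := @normal_linear_form _ _ _ P _ gindex gcoord gcoord_meas gcoord_indep
  (gseq i) (fun k => c k.1.2 k.2) gsigma (gseq_uniq i) (@gseq_sub i) gsigma_gt0 gcoord_law.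
by [].
Qed.

Lemma lform_law i c : (lnorm c = 0 /\ lform i c = cst 0) \/
  (0 < lnorm c /\ has_normal_law P (lform i c) 0 (gsigma * Num.sqrt (lnorm c))).
Proof.
have [_] := @normal_linear_form _ _ _ P _ gindex gcoord gcoord_meas gcoord_indep
  (gseq i) (fun k => c k.1.2 k.2) gsigma (gseq_uniq i) (@gseq_sub i) gsigma_gt0 gcoord_law.
by rewrite lnormE.
Qed.

Lemma lform_moment4 i c :
  Ex_is P (fun w => lform i c w ^+ 4) (3 * gsigma ^+ 4 * lnorm c ^+ 2).
Proof.
case: (lform_law i c) => [[-> L0]|[n0 lL]].
  rewrite expr0n mulr0; have := Ex_is_cst P (lexx (0 : R)).
  by congr (Ex_is P _ _); apply/funext => w; rewrite (congr1 (@^~ w) L0) /= expr0n.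
rewrite (_ : _ * _ = 3 * (gsigma * Num.sqrt (lnorm c)) ^+ 4).
  by apply: normal_moment4 => //; rewrite mulr_gt0 ?gsigma_gt0 ?sqrtr_gt0.
have -> : (gsigma * Num.sqrt (lnorm c)) ^+ 4 =
    gsigma ^+ 4 * (Num.sqrt (lnorm c) ^+ 2) ^+ 2 by ring.
by rewrite sqr_sqrtr ?mulrA // ltW.
Qed.

(** The exponent is the one of [normal_Ex_expsqr] for [r = 1/2], namely (3/4) / (2 sigma^2), whose
    value is 2. A smaller norm of [c] only decreases the integrand's exponent. *)
Lemma lform_expsqr i c : lnorm c <= 1 ->
  Ex_le P (fun w => expR (3 / 8 / gsigma ^+ 2 * lform i c w ^+ 2)) 2.
Proof.
move=> n1; case: (lform_law i c) => [[_ L0]|[n0 lL]].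
  have : Ex_le P (fun=> 1) 2 by exists 1; [exact: Ex_is_cst|lra].
  by congr (Ex_le P _ _); apply/funext => w; rewrite (congr1 (@^~ w) L0) /= expr0n mulr0 expR0.
have s0 : 0 < gsigma * Num.sqrt (lnorm c) by rewrite mulr_gt0 ?gsigma_gt0 ?sqrtr_gt0.
have h2 : (0 : R) < 1 / 2 by lra.
have mL : measurable_fun setT (lform i c) by case: lL.
have <- : (1 / 2)^-1 = 2 :> R by rewrite mul1r invrK.
apply: Ex_is_dom (normal_Ex_expsqr s0 lL h2).
- apply: measurableT_comp => //; apply: measurable_funM => //.
  exact: measurable_funX.
- by move=> w; rewrite expR_ge0.
move=> w; rewrite ler_expR ler_wpM2r ?sqr_ge0//.
rewrite (_ : (gsigma * Num.sqrt (lnorm c)) ^+ 2 = gsigma ^+ 2 * lnorm c); last first.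
  by rewrite exprMn sqr_sqrtr ?(ltW n0).
have sg := gsigma_gt0.
rewrite (_ : 1 - (1 / 2) ^+ 2 = 3 / 4); last by field.
rewrite (_ : 3 / 4 / _ = 3 / 8 / gsigma ^+ 2 * (lnorm c)^-1); last first.
  by field; rewrite !gt_eqF.
rewrite ler_peMr//; first by rewrite divr_ge0 ?sqr_ge0//; lra.
by rewrite invf_ge1.
Qed.

(** [cre u] and [cim u] are the coefficients of the real and imaginary parts of a* u as linear forms
    in the coordinates of [a]. *)
Definition cre (u : 'cV[C]_d) j (b : bool) := if b then Im (u j 0) else Re (u j 0).
Definition cim (u : 'cV[C]_d) j (b : bool) := if b then - Re (u j 0) else Im (u j 0).

Lemma reip_gauss i u w : reip (gauss_vec gc g i w) u = lform i (cre u) w.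
Proof.
rewrite lformE; apply: eq_bigr => j _; rewrite mxE /gparts /cre.
case: (gc); rewrite !big_cons big_nil ?addr0 /=; first by rewrite ![g _ _ _ _ * _]mulrC.
by rewrite mul0r addr0 mulrC.
Qed.

Lemma imip_gauss i u w : imip (gauss_vec gc g i w) u = lform i (cim u) w.
Proof.
rewrite lformE; apply: eq_bigr => j _; rewrite mxE /gparts /cim.
case: (gc); rewrite !big_cons big_nil ?addr0 /=; first by rewrite ![g _ _ _ _ * _]mulrC mulNr.
by rewrite mul0r subr0 mulrC.
Qed.

Lemma sqampE i u w : sqamp (gauss_vec gc g i w) u =
  lform i (cre u) w ^+ 2 + lform i (cim u) w ^+ 2.
Proof. by rewrite /sqamp reip_gauss imip_gauss. Qed.

Lemma sqamp_block i u :
  block_measurable gcoord (gblock i) (fun w => sqamp (gauss_vec gc g i w) u).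
Proof.
have -> : (fun w => sqamp (gauss_vec gc g i w) u) =
    fun w => lform i (cre u) w ^+ 2 + lform i (cim u) w ^+ 2.
  by apply/funext => w; rewrite sqampE.
by apply: measurable_funD; apply: measurable_funX; exact: lform_block.
Qed.

Lemma sqamp_meas i u :
  measurable_fun setT (fun w => sqamp (gauss_vec gc g i w) u).
Proof. by apply: (block_measurableW gcoord_meas (gblock_sub i)); exact: sqamp_block. Qed.

Lemma sqamp_real i u w : gc = false -> Fvec gc u ->
  sqamp (gauss_vec gc g i w) u = lform i (cre u) w ^+ 2.
Proof.
move=> gcF Fu; rewrite sqampE; suff -> : lform i (cim u) w = 0 by rewrite expr0n addr0.
rewrite lformE big1// => j _; rewrite /gparts gcF big_cons big_nil /cim addr0.
by move: (Fu j); rewrite /inF gcF/= => /eqP ->; rewrite mul0r.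
Qed.

Lemma lnorm_cre u : Fvec gc u -> lnorm (cre u) = sqnormv u.
Proof.
move=> Fu; apply: eq_bigr => j _; rewrite /gparts /cre.
have /orP[gcE|gcE] := orbN gc; rewrite ?(negbTE gcE) ?gcE !big_cons big_nil ?addr0//.
by move: (Fu j); rewrite /inF (negbTE gcE)/= => /eqP ->; rewrite expr0n addr0.
Qed.

Lemma lnorm_cim u : gc -> lnorm (cim u) = sqnormv u.
Proof.
move=> gcT; apply: eq_bigr => j _; rewrite /gparts /cim gcT.
by rewrite !big_cons big_nil addr0 sqrrN addrC.
Qed.

Let gsigma2 : gc -> gsigma ^+ 2 = 1 / 2.
Proof. by rewrite /gsigma => ->; rewrite sqr_sqrtr ?invr_ge0// mul1r. Qed.

(** In the complex case the joint law of the two parts p, q of a* u is avoided: p + q and p - q are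
    linear forms as well, and (p^2+q^2)^2 = ((p+q)^4 + (p-q)^4) / 6 + 2 (p^4+q^4) / 3. *)
Lemma sqamp_moment2 i u : Fvec gc u ->
  Ex_is P (fun w => sqamp (gauss_vec gc g i w) u ^+ 2)
    ((1 + m4 R gc) * sqnormv u ^+ 2).
Proof.
move=> Fu; have /orP[gcE|gcE] := orbN gc; last first.
  have /negbTE gcF := gcE; have -> : m4 R gc = 2 by rewrite /m4 gcF.
  have sE : gsigma = 1 by rewrite /gsigma gcF.
  have := lform_moment4 i (cre u).
  rewrite lnorm_cre// sE expr1n mulr1 (_ : 3 = 1 + 2); last by lra.
  by congr (Ex_is P _ _); apply/funext => w; rewrite sqamp_real// -exprM.
have s4 : gsigma ^+ 4 = 1 / 4.
  by rewrite -[4%N]/(2 * 2)%N exprM gsigma2//; field.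
pose p w := lform i (cre u) w; pose q w := lform i (cim u) w.
pose N := sqnormv u.
have Ep : Ex_is P (fun w => p w ^+ 4) (3 / 4 * N ^+ 2).
  by have := lform_moment4 i (cre u); rewrite lnorm_cre// s4 mul1r.
have Eq : Ex_is P (fun w => q w ^+ 4) (3 / 4 * N ^+ 2).
  by have := lform_moment4 i (cim u); rewrite lnorm_cim// s4 mul1r.
have Epq : Ex_is P (fun w => (p w + q w) ^+ 4) (3 * N ^+ 2).
  have := lform_moment4 i (fun j b => cre u j b + cim u j b).
  rewrite (_ : lnorm _ = 2 * N).
    rewrite s4 (_ : _ * _ * _ = 3 * N ^+ 2); last by field.
    congr (Ex_is P _ _); apply/funext => w; congr (_ ^+ _).
    by rewrite /p /q /lform -big_split; apply: eq_bigr => k _; rewrite /= mulrDl.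
  rewrite /lnorm /N /sqnormv mulr_sumr; apply: eq_bigr => j _.
  by rewrite /gparts gcE !big_cons big_nil /cre /cim; ring.
have Emq : Ex_is P (fun w => (p w - q w) ^+ 4) (3 * N ^+ 2).
  have := lform_moment4 i (fun j b => cre u j b - cim u j b).
  rewrite (_ : lnorm _ = 2 * N).
    rewrite s4 (_ : _ * _ * _ = 3 * N ^+ 2); last by field.
    congr (Ex_is P _ _); apply/funext => w; congr (_ ^+ _).
    by rewrite /p /q /lform -sumrB; apply: eq_bigr => k _; rewrite /= mulrBl.
  rewrite /lnorm /N /sqnormv mulr_sumr; apply: eq_bigr => j _.
  by rewrite /gparts gcE !big_cons big_nil /cre /cim; ring.
have e6 : (0 : R) <= 1 / 6 by lra.
have e23 : (0 : R) <= 2 / 3 by lra.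
have := Ex_isD (Ex_isZ e6 (Ex_isD Epq Emq)) (Ex_isZ e23 (Ex_isD Ep Eq)).
have -> : m4 R gc = 1 by rewrite /m4 gcE.
rewrite (_ : 1 / 6 * (3 * N ^+ 2 + 3 * N ^+ 2) +
  2 / 3 * (3 / 4 * N ^+ 2 + 3 / 4 * N ^+ 2) = (1 + 1) * N ^+ 2); last by field.
congr (Ex_is P _ _); apply/funext => w; rewrite sqampE -/(p w) -/(q w).
by field.
Qed.

(** In the complex case sigma^2 = 1/2, so each part separately allows the exponent 3/4; the
    arithmetic-geometric mean inequality combines them at exponent 3/8, without using independence
    of the two parts. *)
Lemma sqamp_exp i u : Fvec gc u -> sqnormv u <= 1 ->
  Ex_le P (fun w => expR (3 / 8 * sqamp (gauss_vec gc g i w) u)) 2.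
Proof.
move=> Fu u1; have /orP[gcE|gcE] := orbN gc; last first.
  have /negbTE gcF := gcE.
  have := @lform_expsqr i (cre u); rewrite lnorm_cre// => /(_ u1).
  rewrite (_ : gsigma = 1) ?expr1n ?invr1 ?mulr1; last by rewrite /gsigma gcF.
  by congr (Ex_le P _ _); apply/funext => w; rewrite sqamp_real.
have := @lform_expsqr i (cre u); rewrite lnorm_cre// => /(_ u1).
have := @lform_expsqr i (cim u); rewrite lnorm_cim// => /(_ u1).
rewrite gsigma2// (_ : 3 / 8 / (1 / 2) = 3 / 4); last by field.
move=> h1 h2; have h12 : (0 : R) <= 1 / 2 by lra.
have := Ex_leZ h12 (Ex_leD h1 h2); rewrite (_ : 1 / 2 * _ = 2); last by field.
apply: Ex_le_dom.
- by apply: measurableT_comp => //; apply: measurable_funM => //; exact: sqamp_meas.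
- by move=> w; rewrite expR_ge0.
move=> w; rewrite sqampE; set p := lform _ _ _; set q := lform _ _ _.
have -> : 3 / 8 * (p ^+ 2 + q ^+ 2) = 3 / 8 * p ^+ 2 + 3 / 8 * q ^+ 2 by ring.
have -> : 3 / 4 * q ^+ 2 = 3 / 8 * q ^+ 2 + 3 / 8 * q ^+ 2 by field.
have -> : 3 / 4 * p ^+ 2 = 3 / 8 * p ^+ 2 + 3 / 8 * p ^+ 2 by field.
rewrite !expRD; set x := expR _; set y := expR _.
by have := sqr_ge0 (x - y); lra.
Qed.

End GaussianAmplitude.

(** * Tail bounds *)

Section AmplitudeAlgebra.
Context {R : realType}.
Local Notation C := R[i].
Local Notation Re := complex.Re.
Local Notation Im := complex.Im.
Variable d : nat.
Implicit Types (a x y u : 'cV[C]_d) (s t : R).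

Lemma reipD a x y : reip a (x + y) = reip a x + reip a y.
Proof.
rewrite /reip -big_split; apply: eq_bigr => j _ /=; rewrite mxE.
by case: (x j 0) (y j 0) => [p q] [p' q'] /=; ring.
Qed.

Lemma imipD a x y : imip a (x + y) = imip a x + imip a y.
Proof.
rewrite /imip -big_split; apply: eq_bigr => j _ /=; rewrite mxE.
by case: (x j 0) (y j 0) => [p q] [p' q'] /=; ring.
Qed.

Lemma reipZ a (c : C) x : reip a (c *: x) = Re c * reip a x - Im c * imip a x.
Proof.
rewrite /reip /imip !mulr_sumr -sumrB; apply: eq_bigr => j _ /=; rewrite mxE.
by case: c (x j 0) => [p q] [p' q'] /=; ring.
Qed.

Lemma imipZ a (c : C) x : imip a (c *: x) = Re c * imip a x + Im c * reip a x.
Proof.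
rewrite /reip /imip !mulr_sumr -big_split; apply: eq_bigr => j _ /=; rewrite mxE.
by case: c (x j 0) => [p q] [p' q'] /=; ring.
Qed.

Lemma reipC x y : reip x y = reip y x.
Proof. by apply: eq_bigr => j _; ring. Qed.

Lemma imipC x y : imip x y = - imip y x.
Proof. by rewrite /imip -sumrN; apply: eq_bigr => j _; ring. Qed.

Lemma reip_xx x : reip x x = sqnormv x.
Proof. by apply: eq_bigr => j _; ring. Qed.

Lemma imip_xx x : imip x x = 0.
Proof. by rewrite /imip big1// => j _; ring. Qed.

Lemma sqnormv_ge0 x : 0 <= sqnormv x.
Proof. by apply: sumr_ge0 => j _; rewrite addr_ge0 ?sqr_ge0. Qed.

Lemma sqnormvD x y : sqnormv (x + y) = sqnormv x + sqnormv y + 2 * reip x y.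
Proof.
rewrite -!reip_xx reipD !(reipC (x + y)) !reipD (reipC y x); ring.
Qed.

Lemma sqnormvZ (c : C) x : sqnormv (c *: x) = (Re c ^+ 2 + Im c ^+ 2) * sqnormv x.
Proof.
rewrite -!reip_xx reipZ (imipC (c *: x)) (reipC (c *: x)) reipZ imipZ imip_xx.
by ring.
Qed.

Lemma imip_real x y : Fvec false x -> Fvec false y -> imip x y = 0.
Proof.
move=> Fx Fy; rewrite /imip big1// => j _.
have /eqP -> := Fx j; have /eqP -> := Fy j; ring.
Qed.

Lemma FvecD (b : bool) x y : Fvec b x -> Fvec b y -> Fvec b (x + y).
Proof.
move=> Fx Fy j; move: (Fx j) (Fy j); rewrite /inF mxE; case: b {Fx Fy} => //=.
by case: (x j 0) (y j 0) => [p q] [p' q'] /= /eqP -> /eqP ->; rewrite addr0.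
Qed.

Lemma FvecZ (b : bool) (c : C) x : inF b c -> Fvec b x -> Fvec b (c *: x).
Proof.
move=> Fc Fx j; move: (Fx j) Fc; rewrite /inF mxE; case: b {Fx} => //=.
by case: c (x j 0) => [p q] [p' q'] /= /eqP -> /eqP ->; rewrite mulr0 mul0r addr0.
Qed.

Lemma FvecZr (b : bool) t x : Fvec b x -> Fvec b (t%:C *: x).
Proof. by apply: FvecZ; rewrite /inF /= eqxx orbT. Qed.

Lemma FvecN (b : bool) x : Fvec b x -> Fvec b (- x).
Proof.
by move=> Fx; rewrite -scaleN1r; apply: FvecZ => //; rewrite /inF /= oppr0 eqxx orbT.
Qed.

Lemma FvecB (b : bool) x y : Fvec b x -> Fvec b y -> Fvec b (x - y).
Proof. by move=> Fx Fy; apply: FvecD => //; exact: FvecN. Qed.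

Lemma reipZr a t x : reip a (t%:C *: x) = t * reip a x.
Proof. by rewrite reipZ/= mul0r subr0. Qed.

Lemma imipZr a t x : imip a (t%:C *: x) = t * imip a x.
Proof. by rewrite imipZ/= mul0r addr0. Qed.

Lemma reipN a x : reip a (- x) = - reip a x.
Proof. by rewrite -scaleN1r reipZ /= oppr0 mul0r subr0 mulN1r. Qed.

Lemma imipN a x : imip a (- x) = - imip a x.
Proof. by rewrite -scaleN1r imipZ /= oppr0 mul0r addr0 mulN1r. Qed.

Lemma sqnormvN x : sqnormv (- x) = sqnormv x.
Proof. by rewrite -!reip_xx reipN reipC reipN opprK. Qed.

Lemma sqnormvB x y : sqnormv (x - y) = sqnormv x + sqnormv y - 2 * reip x y.
Proof. by rewrite sqnormvD sqnormvN reipN mulrN. Qed.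

(* The expectation of [(|a* x|^2 - |a* y|^2)^2] for Gaussian [a]. *)
Definition Dform (m : R) x y : R :=
  m * (sqnormv x ^+ 2 + sqnormv y ^+ 2 - 2 * sqamp x y) +
  (sqnormv x - sqnormv y) ^+ 2.

End AmplitudeAlgebra.

Section Tails.
Context {R : realType} dsp (T : measurableType dsp) (P : probability T R).
Variables (gc : bool) (n d : nat) (g : 'I_n -> 'I_d -> bool -> T -> R).
Hypothesis iid : iid_std_gaussian P gc g.
Local Notation C := R[i].
Local Notation sq i u w := (sqamp (gauss_vec gc g i w) u).
Local Notation m := (m4 R gc).

(** Each [U i] depends only on the coordinates of the i-th Gaussian vector, so the exponential
    moments multiply; Markov's inequality for the product does the rest. *)
Lemma chernoff_block (U : 'I_n -> T -> R) (kappa s : R) :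
  (forall i, block_measurable (gcoord g) (@gblock gc n d i) (U i)) ->
  (forall i, Ex_le P (fun w => expR (U i w)) (expR kappa)) ->
  (P [set w | (s <= \sum_(i < n) U i w)%R] <= (expR (n%:R * kappa - s))%:E)%E.
Proof.
move=> mU EU.
have /choice[v Hv] i : exists v, Ex_is P (fun w => expR (U i w)) v /\ v <= expR kappa.
  by have [v Ev vk] := EU i; exists v.
have [_] := @Ex_is_prod_block _ _ _ P _ (gindex gc n d) (gcoord g)
  (gcoord_meas iid) (gcoord_indep iid) _ (index_enum 'I_n) (@gblock gc n d)
  (fun i w => expR (U i w)) v (index_enum_uniq _) (@gblock_disj _ _ _)
  (@gblock_sub _ _ _)
  (fun i => measurableT_comp (@measurable_expR R) (mU i)) (fun i => (Hv i).1).
move=> Ep.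
have Epl : Ex_le P (fun w => \prod_(i < n) expR (U i w)) (expR (n%:R * kappa)).
  exists (\prod_(i < n) v i) => //.
  have -> : expR (n%:R * kappa) = \prod_(i < n) expR kappa.
    by rewrite prodr_const card_ord -expRM_natl mulr_natl.
  apply: ler_prod => i _; have [Ei ->] := Hv i.
  by rewrite (Ex_is_ge0 Ei).
have := Ex_le_markov (expR_gt0 s) Epl; rewrite expRB.
congr (P _ <= _)%E; apply/seteqP; split => w /=.
  by rewrite -expR_sum ler_expR.
by rewrite -expR_sum ler_expR.
Qed.

Lemma sqamp_tail i u t : Fvec gc u -> sqnormv u <= 1 ->
  (P [set w | (t <= sq i u w)%R] <= (2 * expR (- (3 / 8 * t)))%:E)%E.
Proof.
move=> Fu u1; have h38 : (0 : R) < 3 / 8 by lra.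
have := Ex_le_markov (expR_gt0 (3 / 8 * t)) (sqamp_exp iid i Fu u1).
rewrite -expRN; congr (P _ <= _)%E; apply/seteqP; split => w /=;
  by rewrite ler_expR ler_pM2l.
Qed.

(* Large enough for [B^4 <= Kamp e^(3B/8)] and [q^4 e^(q/8) <= Kamp e^(3q/8)]. *)
Definition Kamp : R := 80 ^+ 2.

Lemma Kamp_gt0 : 0 < Kamp. Proof. by rewrite exprn_gt0. Qed.

Lemma quartic_le_expR (y : R) : 0 <= y -> y ^+ 4 <= 24 * expR y.
Proof.
move=> y0; have := @expR_ge1Dxn R y 3 y0.
by rewrite (_ : 4`! = 24)%N// => h; lra.
Qed.

(** From exp(z) (1 - z) <= 1, multiplied by 1 + z. *)
Lemma expR_le_quad (z : R) : 0 <= z -> expR z <= 1 + z + z ^+ 2 * expR z.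
Proof.
move=> z0; have h := expR_ge1Dx (- z).
have e0 := expR_gt0 z.
have : expR z * (1 + - z) * (1 + z) <= 1 * (1 + z).
  rewrite ler_wpM2r ?addr_ge0//.
  by rewrite -[leRHS](expRxMexpNx_1 z) ler_pM2l.
move=> ?; lra.
Qed.

Lemma quartic_amp_le (B : R) : 0 <= B -> B ^+ 4 <= Kamp * expR (3 / 8 * B).
Proof.
move=> B0; have := @quartic_le_expR (3 / 8 * B); rewrite mulr_ge0// => /(_ isT).
by have := expR_gt0 (3 / 8 * B); rewrite /Kamp exprMn => ? ?; lra.
Qed.

Lemma quartic_amp_exp_le (q : R) : 0 <= q ->
  q ^+ 4 * expR (q / 8) <= Kamp * expR (3 / 8 * q).
Proof.
move=> q0; have q4 : 0 <= q / 4 by rewrite divr_ge0.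
(* The quartic bound at [q / 4] costs the factor 24 * 4^4 = 6144, which [Kamp = 6400] covers. *)
have h := quartic_le_expR q4.
have -> : 3 / 8 * q = q / 4 + q / 8 by field.
rewrite expRD mulrA ler_wpM2r ?expR_ge0//.
by move: h; have := expR_gt0 (q / 4); rewrite /Kamp exprMn => ? h; lra.
Qed.

(** Large weights are replaced by 0; on the event where no weight exceeds [L] the truncation changes
    nothing. *)
Definition trunc_amp (L : R) i x (w : T) : R :=
  if sq i x w <= L then sq i x w else 0.

Lemma trunc_amp_block (L : R) i x u lambda :
  block_measurable (gcoord g) (@gblock gc n d i)
    (fun w => lambda * (trunc_amp L i x w * sq i u w)).
Proof.
apply: measurable_funM; first exact: measurable_cst.
apply: measurable_funM; last exact: (sqamp_block iid).
apply: measurable_fun_ifT.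
- by apply: measurable_fun_ler; [exact: (sqamp_block iid)|exact: measurable_cst].
- exact: (sqamp_block iid).
- exact: measurable_cst.
Qed.

(** Write B, q for the two amplitudes. The exponent z is at most q/16, since the weight is at most
    [L]; hence exp(z) <= 1 + z + z^2 exp(q/16), and the remainder is bounded by lambda^2/2 (B^4 +
    q^4 exp(q/8)), which is integrable. The linear term keeps the right mean 1 + m, because B q <=
    (B^2 + q^2) / 2. *)
Lemma upper_mgf (L : R) i x u : 0 < L ->
  Fvec gc x -> Fvec gc u -> sqnormv x <= 1 -> sqnormv u <= 1 ->
  let lambda := (16 * L)^-1 in
  Ex_le P (fun w => expR (lambda * (trunc_amp L i x w * sq i u w)))
    (expR (lambda * (1 + m) + 2 * Kamp * lambda ^+ 2)).
Proof.
move=> L0 Fx Fu x1 u1 lambda.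
have l0 : 0 < lambda by rewrite invr_gt0 mulr_gt0.
pose B w := sq i x w; pose q w := sq i u w.
have mom v : Fvec gc v -> sqnormv v <= 1 ->
    Ex_le P (fun w => sq i v w ^+ 2) (1 + m).
  move=> Fv v1; exists ((1 + m) * sqnormv v ^+ 2); first exact: sqamp_moment2.
  have m0 : 0 <= 1 + m by rewrite /m4; case: ifP => _; lra.
  by rewrite ler_piMr// expr_le1// sqnormv_ge0.
have h12 : (0 : R) <= lambda / 2 by rewrite divr_ge0// ltW.
have c1 : 0 <= lambda ^+ 2 / 2 * Kamp.
  by rewrite mulr_ge0 ?(ltW Kamp_gt0)// divr_ge0// sqr_ge0.
have E1 : Ex_le P (fun=> 1) 1 by exists 1 => //; exact: Ex_is_cst.
have := Ex_leD (Ex_leD E1 (Ex_leZ h12 (Ex_leD (mom x Fx x1) (mom u Fu u1))))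
  (Ex_leD (Ex_leZ c1 (sqamp_exp iid i Fx x1)) (Ex_leZ c1 (sqamp_exp iid i Fu u1))).
move=> H; apply: Ex_le_trans (Ex_le_dom _ _ _ H).
- apply: le_trans (expR_ge1Dx _).
  by have := sqr_ge0 lambda; lra.
- apply: measurableT_comp => //.
  by apply: (block_measurableW (gcoord_meas iid) (@gblock_sub gc n d i)); exact: trunc_amp_block.
- by move=> w; rewrite expR_ge0.
move=> w; rewrite -/(B w) -/(q w).
have B0 : 0 <= B w by exact: sqamp_ge0.
have q0 : 0 <= q w by exact: sqamp_ge0.
rewrite /trunc_amp -/(B w); set W := if _ then _ else _.
have W0 : 0 <= W by rewrite /W; case: ifP.
have WB : W <= B w by rewrite /W; case: ifP.
have WL : W <= L by rewrite /W; case: ifP => // _; exact: ltW.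
clearbody W; set z := lambda * _.
have z0 : 0 <= z by rewrite /z !mulr_ge0// ltW.
have zq : z <= q w / 16.
  rewrite /z /lambda invfM -mulrA [leRHS]mulrC ler_wpM2l//.
  by rewrite mulrA mulrC ler_piMr// ler_pdivrMl// mulr1.
have zB : z <= lambda * (B w * q w) by rewrite /z ler_wpM2l ?(ltW l0)// ler_wpM2r.
clearbody z; apply: le_trans (expR_le_quad z0) _.
have z2 : z ^+ 2 * expR z <= lambda ^+ 2 / 2 * (B w ^+ 4 + q w ^+ 4 * expR (q w / 8)).
  have e1 : expR z <= expR (q w / 16) by rewrite ler_expR.
  have e2 : expR (q w / 8) = expR (q w / 16) ^+ 2.
    by rewrite -expRM_natl; congr expR; lra.
  rewrite e2.
  apply: (@le_trans _ _ ((lambda * (B w * q w)) ^+ 2 * expR (q w / 16))).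
    apply: ler_pM e1; [exact: sqr_ge0|exact: expR_ge0|].
    by rewrite lerXn2r// nnegrE mulr_ge0 ?mulr_ge0// ltW.
  have := sqr_ge0 (B w ^+ 2 - q w ^+ 2 * expR (q w / 16)).
  have l2 : 0 <= lambda ^+ 2 / 2 by rewrite divr_ge0 ?sqr_ge0.
  set b := B w; set k := q w; set e := expR _ => h.
  rewrite (_ : _ * e = lambda ^+ 2 / 2 * (2 * (b ^+ 2 * k ^+ 2 * e))); last by field.
  by rewrite ler_wpM2l//; lra.
have h1 := quartic_amp_le B0; have h2 := quartic_amp_exp_le q0.
have l2 : 0 <= lambda ^+ 2 / 2 by rewrite divr_ge0 ?sqr_ge0.
have h3 : lambda ^+ 2 / 2 * (B w ^+ 4 + q w ^+ 4 * expR (q w / 8)) <=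
  lambda ^+ 2 / 2 * (Kamp * expR (3 / 8 * B w) + Kamp * expR (3 / 8 * q w)).
  by rewrite ler_wpM2l// lerD.
have h4 : lambda * (B w * q w) <= lambda / 2 * (B w ^+ 2 + q w ^+ 2).
  rewrite -mulrA ler_wpM2l ?(ltW l0)//.
  by have := sqr_ge0 (B w - q w); lra.
lra.
Qed.

Lemma upper_tail (L t : R) x u : 0 < L ->
  Fvec gc x -> Fvec gc u -> sqnormv x <= 1 -> sqnormv u <= 1 ->
  (P [set w | (n%:R * (1 + m + t) <= \sum_(i < n) trunc_amp L i x w * sq i u w)%R]
   <= (expR (- (n%:R / (16 * L) * (t - Kamp / (8 * L)))))%:E)%E.
Proof.
move=> L0 Fx Fu x1 u1; set lambda := (16 * L)^-1.
have l0 : 0 < lambda by rewrite invr_gt0 mulr_gt0.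
have := chernoff_block (lambda * (n%:R * (1 + m + t)))
  (fun i => @trunc_amp_block L i x u lambda) (fun i => @upper_mgf L i x u L0 Fx Fu x1 u1).
rewrite (_ : expR _ = expR (- (n%:R / (16 * L) * (t - Kamp / (8 * L))))); last first.
  by congr expR; rewrite -/lambda /lambda; field; rewrite gt_eqF.
congr (P _ <= _)%E; apply/seteqP; split => w /=;
  by rewrite -mulr_sumr ler_pM2l.
Qed.

End Tails.

(** * Lower tail of sums of squared differences *)

Section LowerTail.
Context {R : realType} dsp (T : measurableType dsp) (P : probability T R).
Variables (gc : bool) (n d : nat) (g : 'I_n -> 'I_d -> bool -> T -> R).
Hypothesis iid : iid_std_gaussian P gc g.
Local Notation C := R[i].
Local Notation sq i u w := (sqamp (gauss_vec gc g i w) u).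
Local Notation m := (m4 R gc).
Local Notation K := (@Kamp R).

(** Polarization: the product is a combination of fourth powers of |a* .| at [x + y] and [x - y],
    together with x + iy and x - iy in the complex case, minus fourth powers at [x] and [y]. The
    subtraction goes through [Ex_is_cancel]. *)
Lemma sqamp_cross i x y : Fvec gc x -> Fvec gc y ->
  Ex_is P (fun w => sq i x w * sq i y w)
    (sqnormv x * sqnormv y + m * sqamp x y).
Proof.
move=> Fx Fy.
have M2 u : Fvec gc u -> Ex_is P (fun w => sq i u w ^+ 2) ((1 + m) * sqnormv u ^+ 2).
  by move=> Fu; exact: sqamp_moment2.
have mm : measurable_fun setT (fun w => sq i x w * sq i y w).
  by apply: measurable_funM; exact: (sqamp_meas iid).
have m0 w : 0 <= sq i x w * sq i y w by rewrite mulr_ge0 ?sqamp_ge0.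
have [Mx My] := (M2 x Fx, M2 y Fy).
have Fp := FvecD Fx Fy; have Fm := FvecB Fx Fy.
set X := sqnormv x in Mx *; set Y := sqnormv y in My *.
have /orP[gcE|gcE] := orbN gc.
  have Fiy : Fvec gc ('i *: y) by apply: FvecZ Fy; rewrite /inF gcE.
  have c4 : (0 : R) <= 1 / 4 by lra.
  have c16 : (0 : R) <= 1 / 16 by lra.
  have Sum := Ex_isZ c16 (Ex_isD (Ex_isD (M2 _ Fp) (M2 _ Fm))
    (Ex_isD (M2 _ (FvecD Fx Fiy)) (M2 _ (FvecB Fx Fiy)))).
  have Sub := Ex_isD (Ex_isZ c4 Mx) (Ex_isZ c4 My).
  have mE : m = 1 by rewrite /m4 gcE.
  rewrite mE in Sum Sub *.
  set v1 := (X in Ex_is P _ X) in Sum; set v2 := (X in Ex_is P _ X) in Sub.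
  rewrite (_ : X * Y + _ = v1 - v2); last first.
    rewrite /v1 /v2 !sqnormvB !sqnormvD !sqnormvZ /= !reipZ /= /sqamp -/X -/Y.
    by field.
  apply: (Ex_is_cancel mm m0 Sub); move: Sum; congr (Ex_is P _ _).
  apply/funext => w; rewrite /sqamp !(reipD, imipD, reipN, imipN, reipZ, imipZ) /=.
  by field.
have gcF : gc = false by apply/negbTE.
have mE : m = 2 by rewrite /m4 gcF.
have c6 : (0 : R) <= 1 / 6 by lra.
have c12 : (0 : R) <= 1 / 12 by lra.
have Sum := Ex_isZ c12 (Ex_isD (M2 _ Fp) (M2 _ Fm)).
have Sub := Ex_isD (Ex_isZ c6 Mx) (Ex_isZ c6 My).
rewrite mE in Sum Sub *.
set v1 := (X in Ex_is P _ X) in Sum; set v2 := (X in Ex_is P _ X) in Sub.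
have im0 : imip x y = 0.
  by apply: imip_real; move: Fx Fy; rewrite gcF.
rewrite (_ : X * Y + _ = v1 - v2); last first.
  rewrite /v1 /v2 !sqnormvB !sqnormvD /= /sqamp im0 -/X -/Y.
  by field.
apply: (Ex_is_cancel mm m0 Sub); move: Sum; congr (Ex_is P _ _).
apply/funext => w.
have im1 u : Fvec gc u -> imip (gauss_vec gc g i w) u = 0.
  rewrite gcF => Fu; apply: imip_real => // j.
  by rewrite /inF mxE /= eqxx.
rewrite /sqamp !(reipD, imipD, reipN, imipN, im1)//.
by field.
Qed.

Definition diff2 i x y (w : T) : R := (sq i x w - sq i y w) ^+ 2.

Lemma diff2_mean i x y : Fvec gc x -> Fvec gc y ->
  Ex_is P (diff2 i x y) (Dform m x y).
Proof.
move=> Fx Fy.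
have h2 : (0 : R) <= 2 by lra.
have C2 := Ex_isZ h2 (sqamp_cross i Fx Fy).
have S2 := Ex_isD (sqamp_moment2 iid i Fx) (sqamp_moment2 iid i Fy).
have mD : measurable_fun setT (diff2 i x y).
  by apply: measurable_funX; apply: measurable_funB; exact: (sqamp_meas iid).
set v1 := (X in Ex_is P _ X) in C2; set v2 := (X in Ex_is P _ X) in S2.
rewrite (_ : Dform m x y = v2 - v1); last by rewrite /Dform /v1 /v2; ring.
apply: (Ex_is_cancel mD _ C2); first by move=> w; exact: sqr_ge0.
move: S2; congr (Ex_is P _ _); apply/funext => w; rewrite /diff2; ring.
Qed.

Lemma diff2_block i x y : block_measurable (gcoord g) (@gblock gc n d i) (diff2 i x y).
Proof.
by apply: measurable_funX; apply: measurable_funB; exact: (sqamp_block iid).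
Qed.

(** For z >= 0, exp(-z) <= 1 - z + z^2/2 holds without restriction, so a second moment of [diff2]
    suffices; it is controlled by (p - q)^4 <= p^4 + q^4 for p, q >= 0. *)
Lemma lower_mgf i x y lambda : 0 < lambda -> Fvec gc x -> Fvec gc y ->
  sqnormv x <= 1 -> sqnormv y <= 1 ->
  Ex_le P (fun w => expR (- lambda * diff2 i x y w))
    (expR (- lambda * Dform m x y + 2 * K * lambda ^+ 2)).
Proof.
move=> l0 Fx Fy x1 y1; have K0 := @Kamp_gt0 R.
have mD : measurable_fun setT (diff2 i x y).
  by apply: measurable_funX; apply: measurable_funB; exact: (sqamp_meas iid).
have D0 w : 0 <= diff2 i x y w by exact: sqr_ge0.
have ZE := diff2_mean i Fx Fy.
have c1 : 0 <= lambda ^+ 2 / 2 * K.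
  by rewrite mulr_ge0 ?(ltW K0)// divr_ge0// sqr_ge0.
have E1 : Ex_le P (fun=> 1) 1 by exists 1 => //; exact: Ex_is_cst.
have H := Ex_leD E1 (Ex_leD (Ex_leZ c1 (sqamp_exp iid i Fx x1))
  (Ex_leZ c1 (sqamp_exp iid i Fy y1))).
pose f w := expR (- lambda * diff2 i x y w).
have mf : measurable_fun setT f.
  by apply: measurableT_comp => //; exact: measurable_funM.
have f0 w : 0 <= f w by exact: expR_ge0.
have mh : measurable_fun setT (fun w => f w + lambda * diff2 i x y w).
  by apply: measurable_funD => //; exact: measurable_funM.
have h0 w : 0 <= f w + lambda * diff2 i x y w.
  by rewrite addr_ge0// mulr_ge0// ltW.
have [v hv vle] : Ex_le P (fun w => f w + lambda * diff2 i x y w)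
    (1 + (lambda ^+ 2 / 2 * K * 2 + lambda ^+ 2 / 2 * K * 2)).
  apply: Ex_le_dom mh h0 _ H => w.
  have z0 : 0 <= lambda * diff2 i x y w by rewrite mulr_ge0// ltW.
  have := expRN_le_quad z0; rewrite -mulNr -/(f w) => h.
  have : diff2 i x y w ^+ 2 <= sq i x w ^+ 4 + sq i y w ^+ 4.
    rewrite /diff2.
    have := sqamp_ge0 (gauss_vec gc g i w) x; have := sqamp_ge0 (gauss_vec gc g i w) y.
    set p := sqamp _ x; set q := sqamp _ y => q0 p0.
    rewrite -exprM /=.
    have [pq|qp] := leP p q.
      have : (q - p) ^+ 4 <= q ^+ 4.
        by rewrite lerXn2r// ?nnegrE ?subr_ge0// gerBl.
      have := exprn_ge0 4 p0.
      have -> : (p - q) ^+ (2 * 2) = (q - p) ^+ 4 by ring.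
      lra.
    have : (p - q) ^+ 4 <= p ^+ 4.
      by rewrite lerXn2r// ?nnegrE ?subr_ge0 ?(ltW qp)// gerBl.
    have := exprn_ge0 4 q0.
    rewrite -[(2 * 2)%N]/4%N; lra.
  have h1 := quartic_amp_le (sqamp_ge0 (gauss_vec gc g i w) x).
  have h2 := quartic_amp_le (sqamp_ge0 (gauss_vec gc g i w) y).
  move=> h3; have h4 : diff2 i x y w ^+ 2 <=
    K * expR (3 / 8 * sq i x w) + K * expR (3 / 8 * sq i y w) by lra.
  have l2 : 0 <= lambda ^+ 2 / 2 by rewrite divr_ge0 ?sqr_ge0.
  have := ler_wpM2l l2 h4.
  move: h; rewrite exprMn; lra.
have := Ex_is_cancel mf f0 (Ex_isZ (ltW l0) ZE) hv => fv.
exists (v - lambda * Dform m x y) => //.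
apply: le_trans (expR_ge1Dx _); have := sqr_ge0 lambda; lra.
Qed.

Lemma lower_tail (delta : R) x y : 0 < delta -> Fvec gc x -> Fvec gc y ->
  sqnormv x <= 1 -> sqnormv y <= 1 ->
  (P [set w | (\sum_(i < n) diff2 i x y w <= n%:R * (Dform m x y - delta))%R]
   <= (expR (- (n%:R * delta ^+ 2 / (8 * K))))%:E)%E.
Proof.
(* This value minimizes - lambda delta + 2 K lambda^2; the minimum is - delta^2 / (8 K). *)
move=> d0 Fx Fy x1 y1; set lambda := delta / (4 * K).
have K0 := @Kamp_gt0 R.
have l0 : 0 < lambda by rewrite divr_gt0// mulr_gt0.
have mU i : block_measurable (gcoord g) (@gblock gc n d i)
    (fun w => - lambda * diff2 i x y w).
  by apply: measurable_funM; [exact: measurable_cst|exact: diff2_block].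
have := chernoff_block iid (- lambda * (n%:R * (Dform m x y - delta))) mU
  (fun i => lower_mgf i l0 Fx Fy x1 y1).
rewrite (_ : expR _ = expR (- (n%:R * delta ^+ 2 / (8 * K)))); last first.
  by congr expR; rewrite /lambda; field; rewrite gt_eqF.
congr (P _ <= _)%E; apply/seteqP; split => w /=;
  by rewrite -mulr_sumr ler_nM2l// oppr_lt0.
Qed.

End LowerTail.

(** * Grids *)

Section Grid.
Context {R : realType}.
Local Notation C := R[i].
Local Notation Re := complex.Re.
Local Notation Im := complex.Im.
Variables (cplx : bool) (d N : nat).
Hypothesis N0 : (0 < N)%N.

(** Integer indices centred at [N], two per coordinate of the vector; [gridvec] reads the second one
    only over the complex field. *)
Definition grid := {ffun 'I_d * bool -> 'I_(N.*2.+1)}.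

Definition gridval (k : 'I_(N.*2.+1)) : R := (k%:R - N%:R) / N%:R.

(** The distance from [k] to the centre: of the two truncated differences at least one is 0. *)
Definition griddist (k : nat) : nat := ((k - N) + (N - k))%N.

Definition gridvec (z : grid) : 'cV[C]_d :=
  \col_j ((gridval (z (j, false))) +i* (if cplx then gridval (z (j, true)) else 0)).

Lemma gridvec_Fvec z : Fvec cplx (gridvec z).
Proof. by move=> j; rewrite /inF mxE /=; case: (cplx) => //=; rewrite eqxx. Qed.

Let N0R : 0 < N%:R :> R. Proof. by rewrite ltr0n. Qed.

Lemma gridval_sqr k : gridval k ^+ 2 = (griddist k)%:R ^+ 2 / N%:R ^+ 2.
Proof.
rewrite /gridval /griddist expr_div_n; congr (_ / _).
have [Nk|kN] := leqP N k.
  by rewrite (eqP (Nk : N - k == 0)%N) addn0 natrB.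
by rewrite (eqP (ltnW kN : k - N == 0)%N) add0n natrB 1?ltnW// -sqrrN opprB.
Qed.

(** Rounding goes towards 0, so that it never increases the norm and the grid point stays in the
    unit ball. *)
Lemma gridval_trunc (t : R) : `|t| <= 1 -> exists k : 'I_(N.*2.+1),
  gridval k ^+ 2 <= t ^+ 2 /\ (t - gridval k) ^+ 2 <= (N%:R ^+ 2)^-1.
Proof.
move=> t1; pose f := Num.trunc (N%:R * `|t|).
have p0 : 0 <= N%:R * `|t| by rewrite mulr_ge0.
have /andP[f1 f2] : f%:R <= N%:R * `|t| < f.+1%:R by exact: truncn_itv.
have fN : (f <= N)%N.
  rewrite -(ler_nat R); apply: le_trans f1 _.
  by rewrite ler_piMr.
have g1 : f%:R / N%:R <= `|t| by rewrite ler_pdivrMr// mulrC.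
have g2 : `|t| - f%:R / N%:R <= N%:R^-1.
  rewrite lerBlDr -[X in X + _]mul1r -mulrDl ler_pdivlMr// mulrC addrC.
  by rewrite natr1 ltW.
have g0 : 0 <= f%:R / N%:R :> R by rewrite divr_ge0.
have sq1 : (f%:R / N%:R) ^+ 2 <= t ^+ 2 :> R.
  by rewrite -[t ^+ 2]real_normK ?num_real// lerXn2r// nnegrE.
have sq2 : (`|t| - f%:R / N%:R) ^+ 2 <= (N%:R ^+ 2)^-1.
  by rewrite -exprVn lerXn2r// nnegrE ?subr_ge0// invr_ge0.
have [t0|t0] := leP 0 t.
  have kl : (N + f < N.*2.+1)%N by rewrite ltnS -addnn leq_add2l.
  exists (Ordinal kl).
  have -> : gridval (Ordinal kl) = f%:R / N%:R.
    by rewrite /gridval /= natrD addrC addKr.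
  by move: sq2; rewrite ger0_norm.
have kl : (N - f < N.*2.+1)%N.
  by rewrite ltnS -addnn (leq_trans (leq_subr _ _))// leq_addr.
exists (Ordinal kl).
have -> : gridval (Ordinal kl) = - (f%:R / N%:R).
  by rewrite /gridval /= natrB// addrC addKr mulNr.
rewrite sqrrN; split => //; move: sq2; rewrite ltr0_norm//.
by rewrite -opprD sqrrN opprK.
Qed.

(** The last bound is the one that makes counting possible: for integers |k| <= k^2, and the squares
    sum to at most N^2 because the grid point lies in the unit ball. *)
Lemma grid_approx (u : 'cV[C]_d) : Fvec cplx u -> sqnormv u <= 1 ->
  exists z : grid, [/\ sqnormv (gridvec z) <= 1,
    sqnormv (u - gridvec z) <= (2 * d)%:R / N%:R ^+ 2 &
    (\sum_(p : 'I_d * bool) griddist (z p) <= N ^ 2)%N].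
Proof.
move=> Fu u1.
pose c (p : 'I_d * bool) : R := if p.2 then Im (u p.1 0) else Re (u p.1 0).
have sumc (F : 'I_d * bool -> R) :
    \sum_p F p = \sum_(j < d) (F (j, false) + F (j, true)).
  transitivity (\sum_(j < d) \sum_(b : bool) F (j, b)).
    by rewrite pair_bigA; apply: eq_bigr => -[].
  by apply: eq_bigr => j _; rewrite big_bool addrC.
have cu : \sum_p c p ^+ 2 = sqnormv u by rewrite sumc.
have c1 p : `|c p| <= 1.
  rewrite -(@expr_le1 _ 2)// real_normK ?num_real//.
  apply: le_trans u1; rewrite -cu (bigD1 p)//= lerDl.
  by apply: sumr_ge0 => q _; exact: sqr_ge0.
have /choice[z Hz] p : exists k, gridval k ^+ 2 <= c p ^+ 2 /\
    (c p - gridval k) ^+ 2 <= (N%:R ^+ 2)^-1 by exact: gridval_trunc.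
pose zf : grid := [ffun p => z p].
have zv : \sum_p gridval (zf p) ^+ 2 <= sqnormv u.
  by rewrite -cu; apply: ler_sum => p _; rewrite ffunE; case: (Hz p).
exists zf; split.
- apply: le_trans u1; apply: le_trans zv; rewrite sumc; apply: ler_sum => j _.
  rewrite !mxE /= lerD2l; case: ifP => // _.
  by rewrite expr0n sqr_ge0.
- apply: (@le_trans _ _ (\sum_p (c p - gridval (zf p)) ^+ 2)).
    rewrite sumc; apply: ler_sum => j _; rewrite !mxE /=.
    rewrite /c /=; case: (u j 0) (Fu j) => [p q] /=; rewrite /inF /=.
    case: (cplx) => //= /eqP ->; rewrite lerD2l subr0 expr0n; exact: sqr_ge0.
  apply: (@le_trans _ _ (\sum_(p : 'I_d * bool) (N%:R ^+ 2)^-1)).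
    by apply: ler_sum => p _; rewrite ffunE; case: (Hz p).
  rewrite sumr_const card_prod card_ord card_bool -[leLHS]mulr_natl.
  by rewrite mulnC.
- have H : (\sum_p (griddist (zf p))%:R ^+ 2 <= N%:R ^+ 2 :> R).
    have : \sum_p gridval (zf p) ^+ 2 <= 1 by exact: le_trans zv u1.
    under eq_bigr do rewrite gridval_sqr.
    by rewrite -mulr_suml ler_pdivrMr ?exprn_gt0// mul1r.
  rewrite -(ler_nat R) natrX; apply: le_trans H.
  rewrite natr_sum; apply: ler_sum => p _.
  by rewrite -natrX ler_nat; case: (griddist _) => // k; rewrite leq_pmulr.
Qed.

Lemma griddist_sum :
  \sum_(k < N.*2.+1) (2^-1 : R) ^+ griddist k <= 3.
Proof.
suff -> : \sum_(k < N.*2.+1) (2^-1 : R) ^+ griddist k = 3 - 2 * 2^-1 ^+ N.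
  by rewrite gerBl mulr_ge0// exprn_ge0.
rewrite /griddist; elim: (N) => [|M IH].
  by rewrite big_ord_recl big_ord0 /= expr0; lra.
(* Removing both end terms leaves the sum for [M], shifted by one. *)
rewrite doubleS big_ord_recr big_ord_recl /=.
under eq_bigr => i _.
  rewrite /bump /= add1n !subSS.
  over.
rewrite IH sub0n subn0 add0n.
have -> : (M.*2.+2 - M.+1 = M.+1)%N by rewrite subSS -addnn -addSn addnK.
have -> : (M.+1 - M.*2.+2 = 0)%N by apply/eqP; rewrite subn_eq0 ltnS -addnn; lia.
rewrite addn0 exprS; set e := _ ^+ M; lra.
Qed.

(** A generating-function bound: every counted point has weight 2^(S - sum) >= 1, and the sum of the
    weights over the whole grid factors into 2d two-sided geometric sums, each at most 3. *)
Lemma grid_count (S : nat) :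
  #|[set z : grid | (\sum_p griddist (z p) <= S)%N]|%SET%:R <=
  2 ^+ S * 9 ^+ d :> R.
Proof.
set A := [set z : grid | _]%SET.
rewrite -sumr_const.
apply: (@le_trans _ _ (\sum_(z in A) 2 ^+ S * \prod_p 2^-1 ^+ griddist (z p))).
  apply: ler_sum => z; rewrite finset.inE => zS.
  rewrite prodrXr exprVn ler_pdivlMr ?exprn_gt0// mul1r ler_weXn2l//; lra.
apply: (@le_trans _ _ (\sum_(z : grid) 2 ^+ S * \prod_p 2^-1 ^+ griddist (z p))).
  rewrite [leRHS](bigID (mem A))/= lerDl; apply: sumr_ge0 => z _.
  by rewrite mulr_ge0 ?exprn_ge0//; apply: prodr_ge0 => p _; rewrite exprn_ge0.
rewrite -mulr_sumr ler_pM2l ?exprn_gt0//.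
rewrite -(bigA_distr_bigA (fun (p : 'I_d * bool) (k : 'I_(N.*2.+1)) => 2^-1 ^+ griddist k))/=.
rewrite prodr_const card_prod card_ord card_bool.
rewrite (_ : 9 = 3 ^+ 2); last by lra.
rewrite -exprM mulnC lerXn2r ?nnegrE ?griddist_sum//.
by apply: sumr_ge0 => k _; rewrite exprn_ge0.
Qed.

End Grid.

(** * From grids to uniform bounds *)

Section Deterministic.
Context {R : realType}.
Local Notation C := R[i].
Local Notation Re := complex.Re.
Local Notation Im := complex.Im.
Variable d : nat.
Implicit Types (a x y u v e : 'cV[C]_d) (s t : R).

Lemma sqnormv_eq0 x : sqnormv x = 0 -> x = 0.
Proof.
move=> /eqP; rewrite psumr_eq0 => [/allP x0|j _]; last by rewrite addr_ge0 ?sqr_ge0.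
apply/matrixP => j k; rewrite (ord1 k) mxE.
have := x0 j (mem_index_enum _); case: (x j 0) => p q /=.
by rewrite paddr_eq0 ?sqr_ge0// !sqrf_eq0 => /andP[/eqP -> /eqP ->].
Qed.

Lemma sqnormvZr t u : sqnormv (t%:C *: u) = t ^+ 2 * sqnormv u.
Proof. by rewrite sqnormvZ /= expr0n addr0. Qed.

Lemma reip_sqr_le a u : reip a u ^+ 2 <= sqnormv a * sqnormv u.
Proof.
have [u0|u0] := eqVneq (sqnormv u) 0.
  rewrite (sqnormv_eq0 u0) /reip big1 ?expr0n ?mulr_ge0 ?sqnormv_ge0//.
  by move=> j _; rewrite mxE /= !mulr0 addr0.
have up : 0 < sqnormv u by rewrite lt_def u0 sqnormv_ge0.
have := sqnormv_ge0 ((sqnormv u)%:C *: a - (reip a u)%:C *: u).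
rewrite sqnormvB !sqnormvZr !reipZr (reipC (_ *: _) u) reipZr (reipC u a).
rewrite (_ : _ - _ = sqnormv u * (sqnormv u * sqnormv a - reip a u ^+ 2)); last by ring.
by rewrite pmulr_rge0// subr_ge0 mulrC.
Qed.

Lemma imip_sqr_le a u : imip a u ^+ 2 <= sqnormv a * sqnormv u.
Proof.
have -> : imip a u = - reip a ('i *: u) by rewrite reipZ /= mul0r mul1r sub0r opprK.
rewrite sqrrN; apply: le_trans (reip_sqr_le _ _) _.
by rewrite sqnormvZ /= expr0n expr1n add0r mul1r.
Qed.

Lemma sqamp_le a u : sqamp a u <= 2 * sqnormv a * sqnormv u.
Proof. by rewrite /sqamp; have := reip_sqr_le a u; have := imip_sqr_le a u; lra. Qed.

Lemma sqampZr a t u : sqamp a (t%:C *: u) = t ^+ 2 * sqamp a u.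
Proof. by rewrite /sqamp reipZr imipZr; ring. Qed.

Section Net.
Variables (cplx : bool) (n N : nat) (a : 'I_n -> 'cV[C]_d) (b : 'I_n -> R).
Hypothesis b0 : forall i, 0 <= b i.

Definition wquad u : R := \sum_(i < n) b i * sqamp (a i) u.

Lemma wquad_ge0 u : 0 <= wquad u.
Proof. by apply: sumr_ge0 => i _; rewrite mulr_ge0// sqamp_ge0. Qed.

Lemma wquad_homog s : (forall u, Fvec cplx u -> sqnormv u <= 1 -> wquad u <= s) ->
  forall u, Fvec cplx u -> wquad u <= s * sqnormv u.
Proof.
move=> H u Fu; have [u0|u0] := eqVneq (sqnormv u) 0.
  rewrite u0 mulr0 /wquad big1// => i _.
  suff -> : sqamp (a i) u = 0 by rewrite mulr0.
  apply/le_anti; rewrite sqamp_ge0 andbT.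
  by apply: le_trans (sqamp_le _ _) _; rewrite u0 mulr0.
have up : 0 < sqnormv u by rewrite lt_def u0 sqnormv_ge0.
pose t := Num.sqrt (sqnormv u).
have t2 : t ^+ 2 = sqnormv u by rewrite sqr_sqrtr// ltW.
have := H (t^-1%:C *: u) (FvecZr _ Fu); rewrite sqnormvZr exprVn t2 mulVf// => /(_ (lexx _)).
rewrite /wquad; under eq_bigr do rewrite sqampZr exprVn t2 mulrCA.
by rewrite -mulr_sumr ler_pdivrMl// mulrC.
Qed.

(** A self-improving bound: if [S] is the supremum over the unit ball, then approximating by the
    grid gives S <= 1.01 B + 101 S mesh^2 <= 1.01 B + 0.01 S, and the last term is absorbed on the
    left. *)
Lemma wquad_net B : (0 < N)%N ->
  101 * ((2 * d)%:R / N%:R ^+ 2) <= 1 / 100 :> R ->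
  (forall z : grid d N, (\sum_p griddist N (z p) <= N ^ 2)%N ->
     sqnormv (gridvec cplx z : 'cV[C]_d) <= 1 -> wquad (gridvec cplx z) <= B) ->
  forall u, Fvec cplx u -> wquad u <= 101 / 99 * B * sqnormv u.
Proof.
move=> N0 Nd HB; apply: wquad_homog.
pose A := [set r | exists2 u, Fvec cplx u /\ sqnormv u <= 1 & r = wquad u].
have F0 : Fvec cplx (0 : 'cV[C]_d) by move=> j; rewrite /inF mxE /= eqxx orbT.
have s0 : sqnormv (0 : 'cV[C]_d) = 0.
  by rewrite /sqnormv big1// => j _; rewrite mxE /= expr0n addr0.
(* Absorbing [sup A] is legitimate only once it is known to be finite, which a crude Cauchy-Schwarz
   bound provides. *)
have hs : has_sup A.
  split; first by exists (wquad 0), 0 => //; split => //; rewrite s0.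
  exists (\sum_(i < n) b i * (2 * sqnormv (a i))) => r [u [Fu u1] ->].
  apply: ler_sum => i _; rewrite ler_wpM2l//; apply: le_trans (sqamp_le _ _) _.
  by rewrite ler_piMr// mulr_ge0// sqnormv_ge0.
have ubA u : Fvec cplx u -> sqnormv u <= 1 -> wquad u <= sup A.
  by move=> Fu u1; apply: ub_le_sup; [case: hs|exists u].
have S0 : 0 <= sup A by apply: le_trans (wquad_ge0 0) (ubA 0 F0 _); rewrite s0.
have homA := wquad_homog ubA.
have SB : sup A <= 101 / 100 * B + 1 / 100 * sup A.
  apply: ge_sup; first by case: hs.
  move=> r [u [Fu u1] ->].
  have [z [z1 zu zc]] := grid_approx N0 Fu u1.
  have Fz : Fvec cplx (gridvec cplx z : 'cV[C]_d) by exact: gridvec_Fvec.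
  have Fe := FvecB Fu Fz.
  have h1 : wquad u <= 101 / 100 * wquad (gridvec cplx z) + 101 * wquad (u - gridvec cplx z).
    rewrite /wquad !mulr_sumr -big_split /=; apply: ler_sum => i _.
    rewrite !(mulrCA _ (b i)) -mulrDr ler_wpM2l//.
    rewrite /sqamp reipD imipD reipN imipN.
    set p := reip _ u; set q := imip _ u; set p' := reip _ _; set q' := imip _ _.
    by have := sqr_ge0 (p - p' - p' / 100); have := sqr_ge0 (q - q' - q' / 100); lra.
  have h2 := HB z zc z1.
  have h3 := homA _ Fe.
  have h4 : sup A * sqnormv (u - gridvec cplx z) <= sup A * ((2 * d)%:R / N%:R ^+ 2).
    by rewrite ler_wpM2l.
  have h5 : sup A * (101 * ((2 * d)%:R / N%:R ^+ 2)) <= sup A * (1 / 100).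
    by rewrite ler_wpM2l.
  lra.
move=> u Fu u1; have := ubA u Fu u1; lra.
Qed.

End Net.

Lemma sqamp_lip a (A rho : R) y e : 0 <= A -> 0 <= rho ->
  sqnormv a <= A ^+ 2 -> sqnormv e <= rho ^+ 2 ->
  sqnormv y <= 1 -> sqnormv (y - e) <= 1 ->
  `|sqamp a y - sqamp a (y - e)| <= 4 * A ^+ 2 * rho.
Proof.
move=> A0 r0 aA er y1 ye1.
have absle (p q s : R) : 0 <= s -> p ^+ 2 <= s ^+ 2 -> `|p| <= s.
  by move=> s0 h; rewrite -ler_sqr ?nnegrE// real_normK ?num_real.
have bnd (r : R) u : 0 <= r -> sqnormv u <= r ^+ 2 ->
    `|reip a u| <= A * r /\ `|imip a u| <= A * r.
  move=> rr ur; have le2 : sqnormv a * sqnormv u <= (A * r) ^+ 2.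
    by rewrite exprMn ler_pM ?sqnormv_ge0.
  split; apply: absle => //; rewrite ?mulr_ge0//; apply: le_trans le2.
    exact: reip_sqr_le.
  exact: imip_sqr_le.
have [pe qe] := bnd rho e r0 er.
have [] := bnd 1 y ler01 ltac:(by rewrite expr1n); rewrite !mulr1 => py qy.
have [] := bnd 1 (y - e) ler01 ltac:(by rewrite expr1n); rewrite !mulr1 => pye qye.
have -> : sqamp a y - sqamp a (y - e) =
    reip a e * (reip a y + reip a (y - e)) + imip a e * (imip a y + imip a (y - e)).
  by rewrite /sqamp !(reipD, imipD, reipN, imipN); ring.
have prod (p q r : R) : `|p| <= A * rho -> `|q| <= A -> `|r| <= A ->
    `|p * (q + r)| <= A * rho * (A + A).
  move=> hp hq hr; rewrite normrM ler_pM//.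
  by apply: le_trans (ler_normD _ _) _; exact: lerD.
apply: le_trans (ler_normD _ _) _.
have := prod _ _ _ pe py pye; have := prod _ _ _ qe qy qye; lra.
Qed.

Lemma sqnormv_lip (rho : R) y e : 0 <= rho -> sqnormv e <= rho ^+ 2 ->
  sqnormv y <= 1 -> sqnormv (y - e) <= 1 ->
  `|sqnormv y - sqnormv (y - e)| <= 2 * rho.
Proof.
move=> r0 er y1 ye1.
have -> : sqnormv y - sqnormv (y - e) = reip e y + reip e (y - e).
  by rewrite sqnormvB reipD reipN reip_xx (reipC y e); ring.
have absle u : sqnormv u <= 1 -> `|reip e u| <= rho.
  move=> u1; rewrite -ler_sqr ?nnegrE// real_normK ?num_real//.
  apply: le_trans (reip_sqr_le _ _) _; apply: le_trans er.
  by rewrite ler_piMr// sqnormv_ge0.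
apply: le_trans (ler_normD _ _) _.
by have := absle _ y1; have := absle _ ye1; lra.
Qed.

Lemma sqampC x y : sqamp x y = sqamp y x.
Proof. by rewrite /sqamp reipC imipC sqrrN. Qed.

Lemma sqr_diff_le (p q M e : R) : `|p| <= M -> `|q| <= M -> `|p - q| <= e ->
  `|p ^+ 2 - q ^+ 2| <= 2 * M * e.
Proof.
move=> pM qM pq; rewrite subr_sqr normrM mulrC ler_pM//.
by apply: le_trans (ler_normD _ _) _; lra.
Qed.

(** The squared norms contribute 4 rho each and the overlap 2 * 8 rho, all multiplied by m <= 2; the
    last square adds 8 rho. The total of 56 rho is rounded up. *)
Lemma Dform_lip (m rho : R) x y e f : 0 <= m -> m <= 2 -> 0 <= rho ->
  sqnormv e <= rho ^+ 2 -> sqnormv f <= rho ^+ 2 ->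
  sqnormv x <= 1 -> sqnormv (x - e) <= 1 -> sqnormv y <= 1 -> sqnormv (y - f) <= 1 ->
  `|Dform m x y - Dform m (x - e) (y - f)| <= 64 * rho.
Proof.
move=> m0 m2 r0 er fr x1 xe1 y1 ye1.
have X1 := sqnormv_lip r0 er x1 xe1; have Y1 := sqnormv_lip r0 fr y1 ye1.
have norm1 u : sqnormv u <= 1 -> `|sqnormv u| <= 1.
  by move=> u1; rewrite ger0_norm// sqnormv_ge0.
have X2 := sqr_diff_le (norm1 _ x1) (norm1 _ xe1) X1.
have Y2 := sqr_diff_le (norm1 _ y1) (norm1 _ ye1) Y1.
have XY1 : `|(sqnormv x - sqnormv y) - (sqnormv (x - e) - sqnormv (y - f))| <= 4 * rho.
  rewrite opprD addrACA -opprD.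
  by apply: le_trans (ler_normB _ _) _; lra.
have dif u v : sqnormv u <= 1 -> sqnormv v <= 1 -> `|sqnormv u - sqnormv v| <= 1.
  move=> u1 v1; have := sqnormv_ge0 u; have := sqnormv_ge0 v => v0 u0.
  by rewrite ler_norml; apply/andP; split; lra.
have XY2 := sqr_diff_le (dif _ _ x1 y1) (dif _ _ xe1 ye1) XY1.
have S1 : `|sqamp x y - sqamp x (y - f)| <= 4 * rho.
  have := @sqamp_lip x 1 rho y f ler01 r0 _ fr y1 ye1.
  by rewrite expr1n mulr1; apply.
have S2 : `|sqamp x (y - f) - sqamp (x - e) (y - f)| <= 4 * rho.
  have := @sqamp_lip (y - f) 1 rho x e ler01 r0 _ er x1 xe1.
  by rewrite expr1n mulr1 (sqampC x) (sqampC (x - e)); apply.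
have S : `|sqamp x y - sqamp (x - e) (y - f)| <= 8 * rho.
  rewrite -(subrKA (sqamp x (y - f))).
  by apply: le_trans (ler_normD _ _) _; lra.
rewrite /Dform.
set dX := _ ^+ 2 - _ ^+ 2 in X2; set dY := _ ^+ 2 - _ ^+ 2 in Y2.
set dZ := _ ^+ 2 - _ ^+ 2 in XY2; set dS := _ - _ in S.
rewrite (_ : _ - _ = m * (dX + dY - 2 * dS) + dZ); last first.
  by rewrite /dX /dY /dZ /dS; ring.
apply: le_trans (ler_normD _ _) _.
have h : `|dX + dY - 2 * dS| <= 24 * rho.
  apply: le_trans (ler_normB _ _) _; rewrite normrM ger0_norm//.
  have := ler_normD dX dY; lra.
rewrite normrM (ger0_norm m0).
have : m * `|dX + dY - 2 * dS| <= 2 * (24 * rho) by rewrite ler_pM.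
lra.
Qed.

End Deterministic.

(** * Matrix quantities in terms of amplitudes *)

Section MatrixLink.
Context {R : realType}.
Local Notation C := R[i].
Local Notation Re := complex.Re.
Local Notation Im := complex.Im.
Variable d : nat.
Implicit Types (a x y u v w : 'cV[C]_d) (A B M : 'M[C]_d).

Lemma Re_sum (I : Type) (r : seq I) (P : pred I) (F : I -> C) :
  Re (\sum_(i <- r | P i) F i) = \sum_(i <- r | P i) Re (F i).
Proof. exact: (raddf_sum (@complex.Re R)). Qed.

Lemma Im_sum (I : Type) (r : seq I) (P : pred I) (F : I -> C) :
  Im (\sum_(i <- r | P i) F i) = \sum_(i <- r | P i) Im (F i).
Proof. exact: (raddf_sum (@complex.Im R)). Qed.

Lemma hipE A B : hip A B =
  \sum_(i < d) \sum_(k < d) (Re (A k i) * Re (B k i) + Im (A k i) * Im (B k i)).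
Proof.
rewrite /hip /mxtrace Re_sum; apply: eq_bigr => i _.
rewrite mxE Re_sum; apply: eq_bigr => k _; rewrite !mxE.
by case: (A k i) (B k i) => [p q] [p' q'] /=; ring.
Qed.

Lemma hipBr A B M : hip A (B - M) = hip A B - hip A M.
Proof.
rewrite !hipE -sumrB; apply: eq_bigr => i _; rewrite -sumrB; apply: eq_bigr => k _.
by rewrite !mxE; case: (B k i) (M k i) => [p q] [p' q'] /=; ring.
Qed.

Lemma hipC A B : hip A B = hip B A.
Proof.
by rewrite !hipE; apply: eq_bigr => i _; apply: eq_bigr => k _; ring.
Qed.

Lemma outerE x k i : outer x k i = x k 0 * conjc (x i 0).
Proof. by rewrite mxE big_ord1 !mxE. Qed.

Lemma frob2E A : frob2 A = hip A A.
Proof.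
rewrite hipE exchange_big; apply: eq_bigr => i _; apply: eq_bigr => k _.
by rewrite !expr2.
Qed.

Lemma sqamp_double a u : sqamp a u = \sum_(i < d) \sum_(k < d)
  ((Re (a k 0) * Re (u k 0) + Im (a k 0) * Im (u k 0)) *
   (Re (a i 0) * Re (u i 0) + Im (a i 0) * Im (u i 0)) +
   (Re (a k 0) * Im (u k 0) - Im (a k 0) * Re (u k 0)) *
   (Re (a i 0) * Im (u i 0) - Im (a i 0) * Re (u i 0))).
Proof.
rewrite /sqamp !expr2 {2}/reip {2}/imip !mulr_sumr -big_split; apply: eq_bigr => i _.
by rewrite /reip /imip /= !mulr_suml -big_split.
Qed.

Lemma hip_outer x y : hip (outer x) (outer y) = sqamp x y.
Proof.
rewrite hipE sqamp_double; apply: eq_bigr => i _; apply: eq_bigr => k _.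
rewrite !outerE.
by case: (x k 0) (x i 0) (y k 0) (y i 0) => [p1 q1] [p2 q2] [p3 q3] [p4 q4] /=; ring.
Qed.

Lemma sqamp_xx x : sqamp x x = sqnormv x ^+ 2.
Proof. by rewrite /sqamp reip_xx imip_xx expr0n addr0. Qed.

Lemma frob2_outerB x y : frob2 (outer x - outer y) =
  sqnormv x ^+ 2 + sqnormv y ^+ 2 - 2 * sqamp x y.
Proof.
rewrite frob2E hipBr ![hip (_ - _) _]hipC !hipBr !hip_outer !sqamp_xx (sqampC y x).
ring.
Qed.

Lemma DformE (m : R) x y : Dform m x y =
  m * frob2 (outer x - outer y) + (sqnormv x - sqnormv y) ^+ 2.
Proof. by rewrite frob2_outerB. Qed.

(** In the real case [outer u] has real entries, so the inner product does not see the imaginary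
    parts that the sensing matrix drops. *)
Lemma hip_sensing (cplx : bool) a u : Fvec cplx u ->
  hip (sensing_mx cplx a) (outer u) = sqamp a u.
Proof.
move=> Fu; rewrite /sensing_mx; case: cplx Fu => Fu; first exact: hip_outer.
rewrite hipE sqamp_double; apply: eq_bigr => i _; apply: eq_bigr => k _.
rewrite mxE !outerE; have /eqP := Fu i; have /eqP := Fu k.
by case: (a k 0) (a i 0) (u k 0) (u i 0) => [p1 q1] [p2 q2] [p3 q3] [p4 q4] /= -> ->; ring.
Qed.

Lemma reip_mulmx w M v : reip w (M *m v) = \sum_(i < d) \sum_(k < d)
  Re (conjc (w k 0) * M k i * v i 0).
Proof.
rewrite exchange_big; apply: eq_bigr => k _; rewrite mxE Re_sum Im_sum.
rewrite !mulr_sumr -big_split; apply: eq_bigr => i _.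
by case: (w k 0) (M k i) (v i 0) => [p1 q1] [p2 q2] [p3 q3] /=; ring.
Qed.

Lemma reip_sensing (cplx : bool) a w v : Fvec cplx w -> Fvec cplx v ->
  reip w (sensing_mx cplx a *m v) = reip a w * reip a v + imip a w * imip a v.
Proof.
move=> Fw Fv; rewrite reip_mulmx.
rewrite {2}/reip {2}/imip !mulr_sumr -big_split; apply: eq_bigr => i _.
rewrite /reip /imip /= !mulr_suml -big_split; apply: eq_bigr => k _ /=.
rewrite /sensing_mx; case: cplx Fw Fv => Fw Fv.
  rewrite !outerE.
  by case: (a k 0) (a i 0) (w k 0) (v i 0) => [p1 q1] [p2 q2] [p3 q3] [p4 q4] /=; ring.
rewrite mxE !outerE; have /eqP := Fw k; have /eqP := Fv i.
by case: (a k 0) (a i 0) (w k 0) (v i 0) => [p1 q1] [p2 q2] [p3 q3] [p4 q4] /= -> ->; ring.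
Qed.

Lemma Fmx_sensing (cplx : bool) a : Fmx cplx (sensing_mx cplx a).
Proof. by move=> k i; rewrite /inF /sensing_mx; case: cplx => //=; rewrite mxE /= eqxx. Qed.

Lemma Fvec_mulmx (cplx : bool) M v : Fmx cplx M -> Fvec cplx v -> Fvec cplx (M *m v).
Proof.
case: cplx => // FM Fv k; rewrite /inF /= mxE Im_sum; apply/eqP/big1 => i _.
have /eqP := FM k i; have /eqP := Fv i.
by case: (M k i) (v i 0) => [p q] [p' q'] /= -> ->; rewrite mulr0 mul0r addr0.
Qed.

Lemma Fmx_opAadj (cplx : bool) n (As : 'I_n -> 'M[C]_d) (z : 'I_n -> R) :
  (forall i, Fmx cplx (As i)) -> Fmx cplx (opAadj As z).
Proof.
case: cplx => // FA k i; rewrite /inF /= /opAadj summxE Im_sum; apply/eqP/big1 => j _.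
have /eqP := FA j k i; rewrite mxE.
by case: (As j k i) => [p q] /= ->; rewrite mulr0 mul0r addr0.
Qed.

Lemma reip_sumr n w (f : 'I_n -> 'cV[C]_d) :
  reip w (\sum_(i < n) f i) = \sum_(i < n) reip w (f i).
Proof.
elim/big_rec2: _ => [|i y1 y2 _ <-]; last by rewrite reipD.
by rewrite /reip big1// => j _; rewrite mxE /= !mulr0 addr0.
Qed.

Lemma opAadj_mulmx n (As : 'I_n -> 'M[C]_d) (z : 'I_n -> R) v :
  opAadj As z *m v = \sum_(i < n) (z i)%:C *: (As i *m v).
Proof. by rewrite /opAadj mulmx_suml; apply: eq_bigr => i _; rewrite scalemxAl. Qed.

(** |Mv|^2 is the bilinear form at [Mv] and [v]. With om = |Mv|, the weighted inequality 2 p q <=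
    p^2/om + om q^2 reduces it to the quadratic form at each vector and yields 2 om^2 <= 2 om B. *)
Lemma upper_of_wquad (cplx : bool) n (a : 'I_n -> 'cV[C]_d) xs (B : R) :
  Fvec cplx xs -> 0 <= B ->
  (forall u, Fvec cplx u ->
     \sum_(i < n) sqamp (a i) xs * sqamp (a i) u <= B * sqnormv u) ->
  opnorm cplx (opAadj (fun i => sensing_mx cplx (a i))
    (opA (fun i => sensing_mx cplx (a i)) (outer xs))) <= B.
Proof.
move=> Fxs B0 HB; apply: ge_sup.
  exists (Num.sqrt (sqnormv (opAadj (fun i => sensing_mx cplx (a i))
    (opA (fun i => sensing_mx cplx (a i)) (outer xs)) *m 0))); exists 0 => //.
  split; first by move=> j; rewrite /inF mxE /= eqxx orbT.
  by rewrite /sqnormv big1// => j _; rewrite mxE /= expr0n addr0.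
move=> _ [v [Fv v1] <-].
set Mv := _ *m v; have FM : Fvec cplx Mv.
  by apply: Fvec_mulmx => //; apply: Fmx_opAadj => i; exact: Fmx_sensing.
have b0 i : 0 <= sqamp (a i) xs by exact: sqamp_ge0.
have E : sqnormv Mv = \sum_(i < n) sqamp (a i) xs *
    (reip (a i) Mv * reip (a i) v + imip (a i) Mv * imip (a i) v).
  rewrite -{1}reip_xx {2}/Mv opAadj_mulmx reip_sumr; apply: eq_bigr => i _.
  by rewrite reipZr /opA hip_sensing// (reip_sensing _ FM Fv).
set om := Num.sqrt _; have [om0|om0] := leP om 0; first exact: le_trans B0.
have om2 : om ^+ 2 = sqnormv Mv by rewrite sqr_sqrtr// sqnormv_ge0.
have AM i : 2 * (reip (a i) Mv * reip (a i) v + imip (a i) Mv * imip (a i) v) <=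
    om^-1 * sqamp (a i) Mv + om * sqamp (a i) v.
  rewrite /sqamp.
  have f (p q : R) : 2 * (p * q) <= om^-1 * p ^+ 2 + om * q ^+ 2.
    have : 0 <= om^-1 * (p - om * q) ^+ 2 by rewrite mulr_ge0 ?sqr_ge0// invr_ge0 ltW.
    rewrite (_ : om^-1 * _ = om^-1 * p ^+ 2 + om * q ^+ 2 - 2 * (p * q)).
      by rewrite subr_ge0.
    by field; rewrite gt_eqF.
  have := f (reip (a i) Mv) (reip (a i) v); have := f (imip (a i) Mv) (imip (a i) v).
  lra.
have H : 2 * om ^+ 2 <= om^-1 * (B * om ^+ 2) + om * (B * sqnormv v).
  rewrite {1}om2 E mulr_sumr.
  apply: (@le_trans _ _ (\sum_(i < n) (om^-1 * (sqamp (a i) xs * sqamp (a i) Mv) +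
      om * (sqamp (a i) xs * sqamp (a i) v)))).
    apply: ler_sum => i _; rewrite mulrCA !(mulrCA _ (sqamp (a i) xs)) -mulrDr.
    by rewrite ler_wpM2l.
  rewrite big_split /= -!mulr_sumr; apply: lerD.
    by rewrite ler_pM2l ?invr_gt0// om2; exact: HB.
  by rewrite ler_pM2l//; exact: HB.
have H2 : om * (B * sqnormv v) <= om * B by rewrite ler_pM2l// ler_piMr.
have H3 : om^-1 * (B * om ^+ 2) = om * B by field; rewrite gt_eqF.
have : om * om <= om * B by rewrite -expr2; lra.
by rewrite ler_pM2l.
Qed.

Lemma sqamp_phase a (c : C) u : Re c ^+ 2 + Im c ^+ 2 = 1 -> sqamp a (c *: u) = sqamp a u.
Proof.
move=> c1; rewrite /sqamp reipZ imipZ -[RHS]mul1r -c1; ring.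
Qed.

(** The phase is that of x* xs; it makes the inner product real and leaves every amplitude of [x]
    unchanged. *)
Lemma phase_align (cplx : bool) x xs : Fvec cplx x -> Fvec cplx xs ->
  exists c : C, [/\ inF cplx c, Re c ^+ 2 + Im c ^+ 2 = 1 & imip (c *: x) xs = 0].
Proof.
case: cplx => Fx Fxs; last first.
  exists 1; split => /=; first by rewrite /inF /= eqxx.
    by rewrite expr0n expr1n addr0.
  by rewrite scale1r imip_real.
have [s0|s0] := eqVneq (sqamp x xs) 0.
  exists 1; split => //=; first by rewrite expr0n expr1n addr0.
  move/eqP: s0; rewrite /sqamp paddr_eq0 ?sqr_ge0// !sqrf_eq0 => /andP[_ /eqP].
  by rewrite scale1r.
have sp : 0 < sqamp x xs by rewrite lt_def s0 sqamp_ge0.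
pose r := Num.sqrt (sqamp x xs); have r2 : r ^+ 2 = sqamp x xs by rewrite sqr_sqrtr// ltW.
have r0 : r != 0 by rewrite -sqrf_eq0 r2.
exists ((reip x xs / r) +i* (imip x xs / r)); split => //=.
  by rewrite !expr_div_n r2 -mulrDl /sqamp divff// -/(sqamp x xs).
rewrite imipC imipZ /= (imipC xs x) (reipC xs x); ring.
Qed.

Lemma Dform_polar (m : R) u v :
  Dform m ((2^-1)%:C *: (u + v)) ((2^-1)%:C *: (v - u)) =
  m * (sqnormv u * sqnormv v + reip u v ^+ 2 - imip u v ^+ 2) / 2 + reip u v ^+ 2.
Proof.
rewrite /Dform !sqnormvZr sqnormvD sqnormvB (reipC v u) sqampZr sqampC sqampZr.
rewrite /sqamp reipD imipD (reipC (v - u) u) (imipC (v - u) u) (reipC (v - u) v) (imipC (v - u) v).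
rewrite !(reipD, imipD, reipN, imipN) !reip_xx !imip_xx (reipC v u) (imipC v u).
by field.
Qed.

Lemma sqamp_polar a u v :
  sqamp a ((2^-1)%:C *: (u + v)) - sqamp a ((2^-1)%:C *: (v - u)) =
  reip a u * reip a v + imip a u * imip a v.
Proof.
by rewrite !sqampZr /sqamp !(reipD, imipD, reipN, imipN); field.
Qed.

(** After aligning phases, put u = x - xs and v = x + xs. Both sides scale with |u|^2 |v|^2, so [u]
    and [v] may be taken of norm 1. There the form equals m (1 + r^2)/2 + r^2 >= m/2 with r = Re u*
    v, and the additive error [eps <= dL * (m / 2)] becomes the relative loss [dL]. *)
Lemma lower_of_uniform (cplx : bool) n (a : 'I_n -> 'cV[C]_d) (m eps dL : R) xs :
  0 <= m -> 0 <= dL -> eps <= dL * (m / 2) ->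
  (forall y y', Fvec cplx y -> Fvec cplx y' -> sqnormv y <= 1 -> sqnormv y' <= 1 ->
     n%:R^-1 * \sum_(i < n) (sqamp (a i) y - sqamp (a i) y') ^+ 2 >=
       Dform m y y' - eps) ->
  Fvec cplx xs ->
  lower_cond cplx (fun i => sensing_mx cplx (a i)) xs m dL.
Proof.
have q1 (r : R) : r <= 1 -> 2^-1 ^+ 2 * (1 + 1 + 2 * r) <= 1 by move=> ?; lra.
have q2 (r : R) : - 1 <= r -> 2^-1 ^+ 2 * (1 + 1 - 2 * r) <= 1 by move=> ?; lra.
move=> m0 dL0 epsD.
have q3 (r : R) : 0 <= r ->
    (1 - dL) * (m * (1 + r) / 2 + r) <= m * (1 + r) / 2 + r - eps.
  move=> r0.
  have h : 0 <= dL * (m * r / 2 + r) by rewrite mulr_ge0// addr_ge0// divr_ge0// mulr_ge0.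
  lra.
have q4 (U V p q p' q' : R) : (U * p * (V * q) + U * p' * (V * q')) ^+ 2 =
    (U * V) ^+ 2 * (p * q + p' * q') ^+ 2 by ring.
move=> Hu Fxs x0 Fx0.
rewrite /sqnormR /opA.
under eq_bigr do rewrite hipBr !hip_sensing//.
rewrite -DformE.
have [c [Fc c1 cx]] := phase_align Fx0 Fxs.
have [x xE0] : exists x, x = c *: x0 by exists (c *: x0).
have Fx : Fvec cplx x by rewrite xE0; exact: FvecZ.
rewrite -xE0 in cx.
have -> : Dform m x0 xs = Dform m x xs.
  by rewrite /Dform xE0 sqnormvZ c1 mul1r sqampC -(sqamp_phase _ _ c1) sqampC.
under eq_bigr do rewrite -(sqamp_phase _ x0 c1) -xE0.
pose u := x - xs; pose v := x + xs.
have xE : x = (2^-1)%:C *: (u + v).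
  apply/matrixP => j k; rewrite /u /v !mxE; apply/eqP; rewrite eq_complex.
  by case: (x j k) (xs j k) => [p q] [p' q'] /=; apply/andP; split; apply/eqP; field.
have xsE : xs = (2^-1)%:C *: (v - u).
  apply/matrixP => j k; rewrite /u /v !mxE; apply/eqP; rewrite eq_complex.
  by case: (x j k) (xs j k) => [p q] [p' q'] /=; apply/andP; split; apply/eqP; field.
have iuv : imip u v = 0.
  have -> : imip u v = imip x xs + imip x xs.
    rewrite /u /v imipD (imipC (x - xs) x) (imipC (x - xs) xs) !(imipD, imipN) !imip_xx (imipC xs x).
    by ring.
  by rewrite cx addr0.
rewrite {1}xE {1}xsE Dform_polar iuv.
under eq_bigr do rewrite {1}xE {1}xsE sqamp_polar.
have sum0 (f : 'I_n -> R) : 0 <= n%:R^-1 * \sum_(i < n) f i ^+ 2.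
  by rewrite mulr_ge0 ?invr_ge0// sumr_ge0// => i _; exact: sqr_ge0.
have reip0 w : reip 0 w = 0 by rewrite /reip big1// => j _; rewrite mxE /= !mul0r addr0.
have reipr0 w : reip w 0 = 0 by rewrite reipC reip0.
(* If [u] or [v] vanishes, [x] equals [xs] up to sign: normalization is impossible, but the form to
   be bounded is 0. *)
have [u0|u0] := eqVneq (sqnormv u) 0.
  rewrite u0 (sqnormv_eq0 u0) reip0 !(expr0n, mul0r, subr0, addr0, mulr0).
  exact: sum0.
have [v0|v0] := eqVneq (sqnormv v) 0.
  rewrite v0 (sqnormv_eq0 v0) reipr0 !(expr0n, mul0r, subr0, addr0, mulr0).
  exact: sum0.
have up : 0 < sqnormv u by rewrite lt_def u0 sqnormv_ge0.
have vp : 0 < sqnormv v by rewrite lt_def v0 sqnormv_ge0.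
pose U := Num.sqrt (sqnormv u); pose V := Num.sqrt (sqnormv v).
have U0 : 0 < U by rewrite sqrtr_gt0.
have V0 : 0 < V by rewrite sqrtr_gt0.
have U2 : sqnormv u = U ^+ 2 by rewrite sqr_sqrtr// ltW.
have V2 : sqnormv v = V ^+ 2 by rewrite sqr_sqrtr// ltW.
pose uh := U^-1%:C *: u; pose vh := V^-1%:C *: v.
have uE : u = U%:C *: uh.
  by rewrite /uh scalerA -rmorphM /= divff ?gt_eqF// scale1r.
have vE : v = V%:C *: vh.
  by rewrite /vh scalerA -rmorphM /= divff ?gt_eqF// scale1r.
have uh1 : sqnormv uh = 1 by rewrite sqnormvZr U2 exprVn mulVf// gt_eqF ?exprn_gt0.
have vh1 : sqnormv vh = 1 by rewrite sqnormvZr V2 exprVn mulVf// gt_eqF ?exprn_gt0.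
have Fu : Fvec cplx uh by apply: FvecZr; exact: FvecB.
have Fv : Fvec cplx vh by apply: FvecZr; exact: FvecD.
have r1 := reip_sqr_le uh vh; rewrite uh1 vh1 mulr1 in r1.
have /andP[r1b r1a] : - 1 <= reip uh vh <= 1.
  by rewrite -ler_norml -ler_sqr ?nnegrE// real_normK ?num_real// expr1n.
have ih : imip uh vh = 0.
  rewrite /vh imipZr (imipC uh) /uh imipZr (imipC v u) iuv; ring.
clearbody uh vh U V u v.
have Hp := Hu _ _ (FvecZr 2^-1 (FvecD Fu Fv)) (FvecZr 2^-1 (FvecB Fv Fu)).
rewrite Dform_polar ih uh1 vh1 in Hp.
have {Hp} := Hp _ _.
rewrite !sqnormvZr sqnormvD sqnormvB uh1 vh1 (reipC vh uh).
move=> /(_ (q1 _ r1a) (q2 _ r1b)) Hp.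
have polE i : sqamp (a i) ((2^-1)%:C *: (uh + vh)) - sqamp (a i) ((2^-1)%:C *: (vh - uh)) =
    reip (a i) uh * reip (a i) vh + imip (a i) uh * imip (a i) vh.
  exact: sqamp_polar.
rewrite (eq_bigr _ (fun i _ => congr1 (fun z => z ^+ 2) (polE i))) in Hp.
have ruv : reip u v = U * V * reip uh vh.
  by rewrite {1}uE {1}vE reipZr reipC reipZr (reipC vh); ring.
have -> : \sum_(i < n) (reip (a i) u * reip (a i) v + imip (a i) u * imip (a i) v) ^+ 2 =
   (U * V) ^+ 2 * \sum_(i < n) (reip (a i) uh * reip (a i) vh + imip (a i) uh * imip (a i) vh) ^+ 2.
  rewrite mulr_sumr; apply: eq_bigr => i _.
  have ru : reip (a i) u = U * reip (a i) uh by rewrite {1}uE reipZr.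
  have rv : reip (a i) v = V * reip (a i) vh by rewrite {1}vE reipZr.
  have iu : imip (a i) u = U * imip (a i) uh by rewrite {1}uE imipZr.
  have iv : imip (a i) v = V * imip (a i) vh by rewrite {1}vE imipZr.
  by rewrite ru rv iu iv q4.
rewrite ruv U2 V2 [leRHS]mulrCA.
set S := n%:R^-1 * _ in Hp *; set r := reip uh vh in Hp r1 *.
rewrite (_ : (1 - dL) * _ = (U * V) ^+ 2 * ((1 - dL) * (m * (1 + r ^+ 2) / 2 + r ^+ 2))); last first.
  by rewrite expr0n /=; field.
rewrite ler_pM2l ?exprn_gt0 ?mulr_gt0//.
apply: le_trans Hp; rewrite expr0n /= subr0 mulr1.
exact: q3 (sqr_ge0 r).
Qed.

End MatrixLink.

Section FineGrid.
Context {R : realType}.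
Local Notation C := R[i].
Variable d : nat.

(** As |a_i| <= n, an amplitude moves by at most 4 n^2 rho between a point and its grid neighbour,
    and differences of amplitudes are at most 2 n^2. Hence each square moves by at most 2 * (2 n^2)
    * (8 n^2 rho) = 32 n^4 rho. *)
Lemma lower_uniform_grid (cplx : bool) n N (a : 'I_n -> 'cV[C]_d) (m delta rho : R) :
  (0 < n)%N -> (0 < N)%N -> 0 <= m -> m <= 2 -> 0 <= rho ->
  (2 * d)%:R / N%:R ^+ 2 <= rho ^+ 2 ->
  (forall i, sqnormv (a i) <= n%:R ^+ 2) ->
  (forall z z' : grid d N, sqnormv (gridvec cplx z : 'cV[C]_d) <= 1 ->
     sqnormv (gridvec cplx z' : 'cV[C]_d) <= 1 ->
     n%:R * (Dform m (gridvec cplx z) (gridvec cplx z') - delta) <=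
     \sum_(i < n) (sqamp (a i) (gridvec cplx z) - sqamp (a i) (gridvec cplx z')) ^+ 2) ->
  forall y y', Fvec cplx y -> Fvec cplx y' -> sqnormv y <= 1 -> sqnormv y' <= 1 ->
  n%:R^-1 * \sum_(i < n) (sqamp (a i) y - sqamp (a i) y') ^+ 2 >=
    Dform m y y' - (delta + 64 * rho + 32 * n%:R ^+ 4 * rho).
Proof.
move=> n0 N0 m0 m2 r0 dN ha H y y' Fy Fy' y1 y1'.
have n0R : 0 < n%:R :> R by rewrite ltr0n.
have [z [z1 zr _]] := grid_approx N0 Fy y1.
have [z' [z1' zr' _]] := grid_approx N0 Fy' y1'.
have {}zr := le_trans zr dN; have {}zr' := le_trans zr' dN.
have {H} := H z z' z1 z1'.
have gE : gridvec cplx z = y - (y - gridvec cplx z) by rewrite opprB addrC subrK.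
have gE' : gridvec cplx z' = y' - (y' - gridvec cplx z') by rewrite opprB addrC subrK.
set e := y - gridvec cplx z in zr gE; set e' := y' - gridvec cplx z' in zr' gE'.
rewrite gE in z1; rewrite gE' in z1'; rewrite gE gE' => H.
have DL := Dform_lip m0 m2 r0 zr zr' y1 z1 y1' z1'.
have S i : (sqamp (a i) (y - e) - sqamp (a i) (y' - e')) ^+ 2 <=
    (sqamp (a i) y - sqamp (a i) y') ^+ 2 + 32 * n%:R ^+ 4 * rho.
  have s1 := sqamp_lip (ltW n0R) r0 (ha i) zr y1 z1.
  have s2 := sqamp_lip (ltW n0R) r0 (ha i) zr' y1' z1'.
  have dif u v : sqnormv u <= 1 -> sqnormv v <= 1 ->
      `|sqamp (a i) u - sqamp (a i) v| <= 2 * n%:R ^+ 2.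
    move=> u1 v1.
    have up w : sqnormv w <= 1 -> sqamp (a i) w <= 2 * n%:R ^+ 2.
      move=> w1; apply: le_trans (sqamp_le _ _) _.
      rewrite -mulrA ler_pM2l//; apply: le_trans (ha i).
      by rewrite ler_piMr// sqnormv_ge0.
    have := up _ u1; have := up _ v1.
    have := sqamp_ge0 (a i) u; have := sqamp_ge0 (a i) v.
    by move=> ? ? ? ?; rewrite ler_norml; apply/andP; split; lra.
  have := @sqr_diff_le _ _ _ _ (8 * n%:R ^+ 2 * rho) (dif _ _ y1 y1') (dif _ _ z1 z1').
  set p := sqamp _ y in s1 *; set q := sqamp _ (y - e) in s1 *.
  set p' := sqamp _ y' in s2 *; set q' := sqamp _ (y' - e') in s2 *.
  move=> HH.
  have h1 : `|p - p' - (q - q')| <= 8 * n%:R ^+ 2 * rho.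
    have -> : p - p' - (q - q') = (p - q) - (p' - q') by ring.
    by apply: le_trans (ler_normB _ _) _; lra.
  have := HH h1; rewrite ler_norml => /andP[+ _]; lra.
have S' : \sum_(i < n) (sqamp (a i) (y - e) - sqamp (a i) (y' - e')) ^+ 2 <=
    \sum_(i < n) (sqamp (a i) y - sqamp (a i) y') ^+ 2 + n%:R * (32 * n%:R ^+ 4 * rho).
  apply: le_trans (ler_sum _ (fun i _ => S i)) _.
  by rewrite big_split /= sumr_const card_ord -[_ *+ n]mulr_natl.
rewrite ler_pdivlMl//.
have {}DL : Dform m y y' - 64 * rho <= Dform m (y - e) (y' - e').
  by move: DL; rewrite ler_norml => /andP[_]; lra.
have := ler_wpM2l (ltW n0R) DL.
move: H S'; set s1 := \sum_(i < n) _; set s2 := \sum_(i < n) _.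
lra.
Qed.

End FineGrid.

(** * Consequences of the sample size condition *)

Section Asymptotics.
Context {R : realType}.

Lemma ln_le_sub (x : R) : 0 < x -> ln x <= x.
Proof. by move=> x0; rewrite -ler_expR lnK ?posrE//; have := expR_ge1Dx x; lra. Qed.

Lemma asymp_bounds (eps H : R) : 0 < eps -> exists N0 : R, 0 < N0 /\
  forall n d : nat, N0 <= n%:R -> 2 / eps * d%:R * ln d%:R <= n%:R ->
  [/\ (3 <= n)%N, 1 <= ln (n%:R : R), H <= ln (n%:R : R),
      d%:R * ln n%:R <= eps * n%:R & ln n%:R ^+ 2 <= eps * n%:R :> R].
Proof.
move=> e0; pose b : R := 16 / eps + 1.
have b1 : 1 < b by rewrite /b ltrDr divr_gt0.
exists (b ^+ 4 + expR (`|H| + 1) + 3).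
have b40 : 0 < b ^+ 4 by rewrite exprn_gt0//; lra.
have eH0 := expR_gt0 (`|H| + 1).
split; first lra.
move=> n d nN Hd.
have n3 : (3 <= n)%N by rewrite -(ler_nat R); lra.
have n0 : 0 < n%:R :> R by lra.
have lnH : `|H| + 1 <= ln n%:R by rewrite -ler_expR lnK ?posrE//; lra.
have ln1 : 1 <= ln (n%:R : R) by have := normr_ge0 H; lra.
pose q : R := Num.sqrt (Num.sqrt n%:R).
have q0 : 0 < q by rewrite !sqrtr_gt0.
have q2 : q ^+ 2 = Num.sqrt n%:R by rewrite sqr_sqrtr// sqrtr_ge0.
have q4 : q ^+ 4 = n%:R.
  have -> : q ^+ 4 = (q ^+ 2) ^+ 2 by ring.
  by rewrite q2 sqr_sqrtr// ltW.
have bq : b <= q.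
  have : b ^+ 4 <= q ^+ 4 by rewrite q4; lra.
  by rewrite ler_pXn2r// nnegrE; lra.
have qe : 16 <= eps * q.
  have : eps * (16 / eps + 1) <= eps * q by rewrite ler_pM2l.
  rewrite mulrDr mulrCA divff ?gt_eqF//; lra.
have q1 : 1 <= q by lra.
have lnq : ln n%:R <= 4 * q.
  by rewrite -q4 lnXn// mulr_natl lerMn2r ln_le_sub// orbT.
split => //.
- by have := ler_norm H; lra.
(* With q = n^(1/4) and ln n <= 4 q: if d <= sqrt n, then d ln n <= 4 q^3 is negligible against n;
   otherwise ln n <= 2 ln d and the sample size condition applies. *)
- have [dn|nd] := leP (d%:R : R) (q ^+ 2).
    apply: (@le_trans _ _ (q ^+ 2 * (4 * q))).
      by rewrite ler_pM//; lra.
    rewrite -q4 (_ : q ^+ 2 * (4 * q) = 4 * q ^+ 3); last by ring.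
    rewrite (_ : eps * q ^+ 4 = eps * q * q ^+ 3); last by ring.
    by rewrite ler_pM2r ?exprn_gt0//; lra.
  have d0 : 0 < d%:R :> R by apply: le_lt_trans nd; exact: sqr_ge0.
  have lnd : ln (n%:R : R) <= 2 * ln d%:R.
    have -> : 2 * ln d%:R = ln (d%:R ^+ 2) :> R by rewrite lnXn// mulr_natl.
    rewrite ler_ln ?posrE ?exprn_gt0// -q4 (_ : q ^+ 4 = (q ^+ 2) ^+ 2); last by ring.
    by rewrite ltW// ltr_pXn2r// nnegrE ?sqr_ge0// ltW.
  have : eps * (2 / eps * d%:R * ln d%:R) <= eps * n%:R by rewrite ler_pM2l.
  apply: le_trans.
  rewrite (_ : eps * _ = d%:R * (2 * ln d%:R)); last by field; rewrite gt_eqF.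
  by rewrite ler_pM2l.
- apply: (@le_trans _ _ ((4 * q) ^+ 2)).
    by rewrite lerXn2r// nnegrE; lra.
  rewrite -q4 (_ : (4 * q) ^+ 2 = 16 * q ^+ 2); last by ring.
  rewrite (_ : eps * q ^+ 4 = eps * q * q * q ^+ 2); last by ring.
  rewrite ler_pM2r ?exprn_gt0//; apply: le_trans qe _.
  by rewrite ler_peMr// mulr_ge0 // ltW.
Qed.

(** Keeps the squared number of grid steps linear in [d], which [grid_count] turns into exp(O(d))
    points. The bounds allow for [d = 0]. *)
Lemma isqrt_up (d : nat) : exists s : nat,
  [/\ (0 < s)%N, (d <= s ^ 2)%N & (s ^ 2 <= 4 * d + 1)%N].
Proof.
have ex : exists s, (0 < s)%N && (d <= s ^ 2)%N.
  by exists d.+1; rewrite ltn0Sn -mulnn; nia.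
case: (ex_minnP ex) => s /andP[s0 ds] smin.
exists s; split => //.
have [->|s1] := eqVneq s 1%N; first by rewrite exp1n addn1.
have [s' sE] : exists s', s = s'.+2 by case: s s0 s1 {ds smin} => [|[|s']] // _ _; exists s'.
have : (s'.+1 ^ 2 < d)%N.
  rewrite ltnNge; apply/negP => h.
  by have := smin s'.+1; rewrite h sE => /(_ isT); rewrite ltnn.
rewrite sE -!mulnn; nia.
Qed.

End Asymptotics.

Section UnionBound.
Context {R : realType} dsp (T : measurableType dsp) (P : probability T R).

Lemma union_bound (I : finType) (A : {set I}) (B : I -> set T) (p : R) :
  (forall i, measurable (B i)) ->
  (forall i, i \in A -> (P (B i) <= p%:E)%E) ->
  exists U : set T, [/\ measurable U, (P U <= (#|A|%:R * p)%:E)%E &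
    forall i, i \in A -> B i `<=` U].
Proof.
move=> mB PB; exists (\big[setU/set0]_(i in A) B i).
have [mU PU] : measurable (\big[setU/set0]_(i in A) B i) /\
    (P (\big[setU/set0]_(i in A) B i) <= \sum_(i in A) p%:E)%E.
  elim/big_rec2: _ => [|i S x iA [mx Px]]; first by rewrite measure0; split.
  split; first exact: measurableU.
  apply: le_trans (measureU2 _ (mB i) mx) _.
  by apply: leeD => //; exact: PB.
split => //; last by move=> i iA; rewrite (bigD1 i)//=; exact: subsetUl.
apply: le_trans PU _.
by rewrite sumEFin lee_fin sumr_const mulr_natl.
Qed.

End UnionBound.

(** * Concentration *)

Section Assembly.
Context {R : realType} dsp (T : measurableType dsp) (P : probability T R).
Variables (cplx gc : bool) (n d : nat) (g : 'I_n -> 'I_d -> bool -> T -> R).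
Hypothesis cg : cplx ==> gc.
Hypothesis iid : iid_std_gaussian P gc g.
Local Notation C := R[i].
Local Notation sq i u w := (sqamp (gauss_vec gc g i w) u).
Local Notation m := (m4 R gc).
Local Notation K := (@Kamp R).
Local Notation ell := (ln (n%:R : R)).

Lemma Fvec_gc (u : 'cV[C]_d) : Fvec cplx u -> Fvec gc u.
Proof. by move: cg; case: cplx; case: gc => //= _ Fu j; rewrite /inF. Qed.

Lemma measurable_ge (f : T -> R) (t : R) : measurable_fun setT f ->
  measurable [set w | t <= f w].
Proof.
move=> mf; rewrite (_ : [set w | _] = f @^-1` `[t, +oo[%classic).
  by rewrite -[X in measurable X]setTI; exact: mf.
by apply/seteqP; split => w /=; rewrite in_itv/= andbT.
Qed.

Lemma measurable_le (f : T -> R) (t : R) : measurable_fun setT f ->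
  measurable [set w | f w <= t].
Proof.
move=> mf; rewrite (_ : [set w | _] = f @^-1` `]-oo, t]%classic).
  by rewrite -[X in measurable X]setTI; exact: mf.
by apply/seteqP; split => w /=; rewrite in_itv.
Qed.

(** Lets the scalar tail bound control the entries of a Gaussian vector, and through them its
    norm. *)
Lemma sqamp_delta (a : 'cV[C]_d) j : sqamp a (delta_mx j 0) =
  complex.Re (a j 0) ^+ 2 + complex.Im (a j 0) ^+ 2.
Proof.
have S (F G : 'I_d -> R) : \sum_k (F k * complex.Re ((delta_mx j 0 : 'cV[C]_d) k 0) +
    G k * complex.Im ((delta_mx j 0 : 'cV[C]_d) k 0)) = F j.
  rewrite (bigD1 j)//= big1 => [|k kj].
    by rewrite mxE !eqxx /= mulr1 mulr0 !addr0.
  by rewrite mxE (negbTE kj) /= !mulr0 addr0.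
rewrite /sqamp; have -> : reip a (delta_mx j 0) = complex.Re (a j 0) by exact: S.
have -> : imip a (delta_mx j 0) = - complex.Im (a j 0).
  rewrite -(S (fun k => - complex.Im (a k 0)) (fun k => complex.Re (a k 0))).
  by apply: eq_bigr => k _; ring.
by rewrite sqrrN.
Qed.

Lemma sqnormv_delta j : sqnormv (delta_mx j 0 : 'cV[C]_d) = 1.
Proof.
rewrite /sqnormv (bigD1 j)//= big1 => [|k kj]; rewrite mxE ?eqxx ?(negbTE kj) /=.
  by rewrite expr1n expr0n !addr0.
by rewrite expr0n addr0.
Qed.

Lemma upper_on_event (xs xi : 'cV[C]_d) N w (t L : R) :
  (0 < N)%N -> (0 < n)%N -> Fvec cplx xs ->
  (forall a, sqamp a xs = sqnormv xs * sqamp a xi) ->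
  101 * ((2 * d)%:R / N%:R ^+ 2) <= 1 / 100 :> R ->
  101 / 99 * (1 + m + t) <= 1 + m + 1 / 10 -> 0 <= 1 + m + t ->
  (forall i, sq i xi w <= L) ->
  (forall z : grid d N, (\sum_p griddist N (z p) <= N ^ 2)%N ->
     sqnormv (gridvec cplx z : 'cV[C]_d) <= 1 ->
     \sum_(i < n) trunc_amp gc g L i xi w * sq i (gridvec cplx z) w <= n%:R * (1 + m + t)) ->
  upper_cond cplx (fun i => sensing_mx cplx (gauss_vec gc g i w)) xs m (1 / 10).
Proof.
move=> N0 n0 Fxs xsE Nd tm t0 HL HB.
have n0R : 0 < n%:R :> R by rewrite ltr0n.
have W u : Fvec cplx u -> wquad (fun i => gauss_vec gc g i w) (fun i => sq i xi w) u <=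
    101 / 99 * (n%:R * (1 + m + t)) * sqnormv u.
  apply: wquad_net Nd _ _ => //; first by move=> i; exact: sqamp_ge0.
  move=> z zc z1; apply: le_trans (HB z zc z1); apply: ler_sum => i _.
  by rewrite /trunc_amp HL.
have B0 : 0 <= sqnormv xs * (101 / 99 * (n%:R * (1 + m + t))).
  by rewrite mulr_ge0 ?sqnormv_ge0// mulr_ge0// mulr_ge0// ltW.
rewrite /upper_cond ler_pdivrMl//.
apply: le_trans (upper_of_wquad Fxs B0 _) _.
  move=> u Fu; have := ler_wpM2l (sqnormv_ge0 xs) (W u Fu).
  rewrite mulrA; apply: le_trans; rewrite /wquad mulr_sumr; apply: ler_sum => i _.
  by rewrite xsE mulrA.
have := ler_wpM2l (mulr_ge0 (ltW n0R) (sqnormv_ge0 xs)) tm.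
set X := sqnormv xs; set A := 1 + m + t; lra.
Qed.

End Assembly.

(** * Numerical balance of grid sizes against tail exponents *)

Section Budget.
Context {R : realType}.
Local Notation K := (@Kamp R).

(* The coarse grid has mesh [1/(143 s)] with [s^2 >= d]: [143^2 >= 2 * 101 * 100]. *)
Definition kap : nat := 143 ^ 2.

(* Dominates the constants lost in the coarse-grid union bound, in the
   fine-grid union bound and in the discretization error. *)
Definition budget : R :=
  128 * 80 * (5 * kap%:R + 6) + 272 * K * 100 ^+ 2 + 128 * 100.

Let k0 : 0 <= kap%:R :> R. Proof. by rewrite ler0n. Qed.

Lemma budget_gt0 : 0 < budget.
Proof.
by have := k0; have := @Kamp_gt0 R => ? ?; rewrite /budget; lra.
Qed.

(** The left side is the logarithm of the coarse-grid count times the tail at one point, with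
    [l = ln n]; the right side is that of n^-2. The condition [2 * K <= l] leaves at least half of
    the margin 1/40. *)
Lemma budget_coarse (n d l : R) : 0 <= d -> 1 <= l -> 2 * K <= l -> 0 < n ->
  d * l <= budget^-1 * n -> l ^+ 2 <= budget^-1 * n ->
  (kap%:R * (4 * d + 1) + 4 * d) -
    (n / (16 * (8 * l)) * (1 / 40 - K / (8 * (8 * l)))) <= - (2 * l).
Proof.
move=> d0 l1 lK n0; set e := budget^-1 * n => H1 H2.
have be : budget * e = n by rewrite /e mulVKf// gt_eqF ?budget_gt0.
have e0 : 0 < e by rewrite mulr_gt0 ?invr_gt0 ?budget_gt0.
have K0 := @Kamp_gt0 R.
have lp : 0 < l by lra.
have h1 : 1 / 80 <= 1 / 40 - K / (8 * (8 * l)).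
  suff : K / (8 * (8 * l)) <= 1 / 80 by lra.
  rewrite ler_pdivrMr; lra.
have h2 : n / (16 * (8 * l)) * (1 / 80) <=
    n / (16 * (8 * l)) * (1 / 40 - K / (8 * (8 * l))).
  by rewrite ler_wpM2l// divr_ge0 ?ltW//; lra.
suff : kap%:R * (4 * d + 1) + 4 * d + 2 * l <= n / (16 * (8 * l)) * (1 / 80) by lra.
rewrite (_ : n / (16 * (8 * l)) * (1 / 80) = n / (128 * 80 * l)); last first.
  by field; rewrite gt_eqF.
rewrite ler_pdivlMr; last by rewrite mulr_gt0//; lra.
have l2 : l <= l ^+ 2 by rewrite expr2 ler_peMr// ltW.
have A1 : 128 * 80 * (5 * kap%:R + 6) * e <= n.
  by rewrite -[leRHS]be ler_wpM2r ?(ltW e0)// /budget; lra.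
have B1 : kap%:R * (d * l) <= kap%:R * e by rewrite ler_wpM2l.
have B2 : kap%:R * l <= kap%:R * e by rewrite ler_wpM2l//; exact: le_trans H2.
apply: le_trans A1.
rewrite (_ : _ * (128 * 80 * l) = 128 * 80 * (4 * (kap%:R * (d * l)) + kap%:R * l
   + 4 * (d * l) + 2 * l ^+ 2)); last by ring.
lra.
Qed.

(** The same balance for pairs of fine-grid points, at most n^(32 d) in number. *)
Lemma budget_fine (n d l : R) : 1 <= l -> 0 < n ->
  d * l <= budget^-1 * n -> l ^+ 2 <= budget^-1 * n ->
  32 * (d * l) - n * (1 / 100) ^+ 2 / (8 * K) <= - (2 * l).
Proof.
move=> l1 n0; set e := budget^-1 * n => H1 H2.
have be : budget * e = n by rewrite /e mulVKf// gt_eqF ?budget_gt0.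
have e0 : 0 < e by rewrite mulr_gt0 ?invr_gt0 ?budget_gt0.
have K0 := @Kamp_gt0 R.
have l2 : l <= l ^+ 2 by rewrite expr2 ler_peMr//; lra.
have A1 : 272 * K * 100 ^+ 2 * e <= n.
  by rewrite -[leRHS]be ler_wpM2r ?(ltW e0)// /budget; have := k0; lra.
have A2 : 34 * e <= n * (1 / 100) ^+ 2 / (8 * K).
  by rewrite ler_pdivlMr ?mulr_gt0//; lra.
lra.
Qed.

Lemma budget_coord (n l : R) : 1 <= l -> 0 < n -> l ^+ 2 <= budget^-1 * n ->
  5 * l <= 3 / 8 * n.
Proof.
move=> l1 n0; set e := budget^-1 * n => H2.
have be : budget * e = n by rewrite /e mulVKf// gt_eqF ?budget_gt0.
have e0 : 0 < e by rewrite mulr_gt0 ?invr_gt0 ?budget_gt0.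
have K0 := @Kamp_gt0 R.
have l2 : l <= l ^+ 2 by rewrite expr2 ler_peMr//; lra.
have A1 : 128 * 100 * e <= n.
  by rewrite -[leRHS]be ler_wpM2r ?(ltW e0)// /budget; have := k0; lra.
lra.
Qed.

Lemma budget_mesh (n l : R) : 1 <= l -> 0 < n -> l ^+ 2 <= budget^-1 * n ->
  128 * 100 <= n.
Proof.
move=> l1 n0; set e := budget^-1 * n => H2.
have be : budget * e = n by rewrite /e mulVKf// gt_eqF ?budget_gt0.
have e1 : 1 <= e by apply: le_trans H2; rewrite expr_ge1//; lra.
have K0 := @Kamp_gt0 R.
rewrite -be; apply: (@le_trans _ _ (128 * 100 * e)).
  by rewrite ler_peMr.
by rewrite ler_wpM2r /budget //; have := k0; lra.
Qed.

Lemma budget_dim (n d l : R) : 0 <= d -> 1 <= l -> 0 < n -> d * l <= budget^-1 * n -> d <= n.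
Proof.
move=> d0 l1 n0; set e := budget^-1 * n => H1.
have be : budget * e = n by rewrite /e mulVKf// gt_eqF ?budget_gt0.
have e0 : 0 < e by rewrite mulr_gt0 ?invr_gt0 ?budget_gt0.
have K0 := @Kamp_gt0 R.
have b1 : 1 <= budget by rewrite /budget; have := k0; lra.
have : d <= d * l by rewrite ler_peMr.
have : e <= budget * e by rewrite ler_peMl// ltW.
lra.
Qed.

End Budget.

(** * The four exceptional events *)

Section Concentration.
Context {R : realType} dsp (T : measurableType dsp) (P : probability T R).
Variables (cplx gc : bool) (n d : nat) (g : 'I_n -> 'I_d -> bool -> T -> R).
Hypothesis cg : cplx ==> gc.
Hypothesis iid : iid_std_gaussian P gc g.
Local Notation C := R[i].
Local Notation sq i u w := (sqamp (gauss_vec gc g i w) u).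
Local Notation m := (m4 R gc).
Local Notation K := (@Kamp R).
Local Notation ell := (ln (n%:R : R)).
Local Notation budget := (@budget R).

Hypotheses (n3 : (3 <= n)%N) (l1 : 1 <= ell) (lK : 2 * K <= ell).
Hypotheses (dl : d%:R * ell <= budget^-1 * n%:R) (ll : ell ^+ 2 <= budget^-1 * n%:R).

Let n0 : (0 < n)%N. Proof. exact: leq_trans n3. Qed.
Let n0R : 0 < n%:R :> R. Proof. by rewrite ltr0n. Qed.
Let n2E : (n%:R ^+ 2)^-1 = expR (- (2 * ell)) :> R.
Proof. by rewrite expRN mulr2n mulrDl mul1r expRD lnK ?posrE// expr2. Qed.

Lemma m4_ge1 : 1 <= m. Proof. by rewrite /m4; case: ifP => _; lra. Qed.
Lemma m4_le2 : m <= 2. Proof. by rewrite /m4; case: ifP => _; lra. Qed.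

Variable xi : 'cV[C]_d.
Hypotheses (Fxi : Fvec cplx xi) (xi1 : sqnormv xi <= 1).

Local Notation L := (8 * ell).
Let L0 : 0 < L. Proof. by rewrite mulr_gt0 ?(lt_le_trans ltr01 l1). Qed.

(** The level 8 ln n gives each vector the tail 2 exp(-3 ln n), so that [n] of them sum to 2 /
    n^2. *)
Lemma event_trunc : exists U : set T, [/\ measurable U,
  (P U <= (2 / n%:R ^+ 2)%:E)%E & forall w, ~ U w -> forall i, sq i xi w <= L].
Proof.
pose B (i : 'I_n) := [set w | L <= sq i xi w].
have mB i : measurable (B i) by apply: measurable_ge; exact: (sqamp_meas iid).
have [U [mU PU BU]] := @union_bound R dsp T P 'I_n [set: 'I_n]%SET B _ mB
  (fun i _ => sqamp_tail iid i L (Fvec_gc cg Fxi) xi1).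
exists U; split => //; last first.
  move=> w nU i; rewrite leNgt; apply/negP => h; apply: nU.
  by apply: (BU i) => //; exact: ltW.
apply: le_trans PU _; rewrite lee_fin cardsT card_ord.
rewrite (_ : - (3 / 8 * L) = - (2 * ell) - ell); last by field.
rewrite expRD -n2E expRN lnK ?posrE//.
by rewrite le_eqVlt; apply/orP; left; apply/eqP; field; rewrite gt_eqF.
Qed.

Let dn : (d <= n)%N.
Proof. by rewrite -(ler_nat R); apply: (budget_dim _ l1 n0R dl); rewrite ler0n. Qed.

(** Every squared entry is at most [n], and d <= n then bounds the squared norm by n^2. This crude
    bound only feeds the Lipschitz estimate of the fine grid. *)
Lemma event_coord : exists U : set T, [/\ measurable U,
  (P U <= (1 / n%:R ^+ 2)%:E)%E &
  forall w, ~ U w -> forall i, sqnormv (gauss_vec gc g i w) <= n%:R ^+ 2].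
Proof.
pose B (k : 'I_n * 'I_d) := [set w | n%:R <= sq k.1 (delta_mx k.2 0) w].
have mB k : measurable (B k) by apply: measurable_ge; exact: (sqamp_meas iid).
have Fd (j : 'I_d) : Fvec gc (delta_mx j 0 : 'cV[C]_d).
  by move=> k; rewrite /inF mxE; case: (_ && _); rewrite /= eqxx orbT.
have d1 (j : 'I_d) : sqnormv (delta_mx j 0 : 'cV[C]_d) <= 1 by rewrite sqnormv_delta.
have [U [mU PU BU]] := @union_bound R dsp T P _ [set: 'I_n * 'I_d]%SET B _ mB
  (fun k _ => sqamp_tail iid k.1 n%:R (Fd k.2) (d1 k.2)).
exists U; split => //; last first.
  move=> w nU i.
  have H j : sq i (delta_mx j 0) w <= n%:R.
    rewrite leNgt; apply/negP => h; apply: nU.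
    by apply: (BU (i, j)) => //; exact: ltW.
  apply: (@le_trans _ _ (\sum_(j < d) n%:R)).
    by apply: ler_sum => j _; rewrite -sqamp_delta.
  by rewrite sumr_const card_ord -[leLHS]mulr_natr expr2 ler_pM2l// ler_nat.
apply: le_trans PU _; rewrite lee_fin cardsT card_prod !card_ord.
rewrite mul1r n2E.
have e1 : 2 <= expR ell by have := expR_ge1Dx ell; have := l1; lra.
have e2 : (n * d)%:R <= expR (2 * ell) :> R.
  rewrite expRM_natl lnK ?posrE// expr2 -natrM ler_nat.
  by rewrite leq_mul2l dn orbT.
have e3 := budget_coord l1 n0R ll.
apply: (@le_trans _ _ (expR (2 * ell) * (expR ell * expR (- (3 / 8 * n%:R))))).
  by rewrite ler_pM ?mulr_ge0 ?expR_ge0// ler_wpM2r ?expR_ge0.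
by rewrite -!expRD ler_expR; lra.
Qed.

Lemma event_coarse : exists N : nat, exists U : set T, [/\ (0 < N)%N,
  101 * ((2 * d)%:R / N%:R ^+ 2) <= 1 / 100 :> R, measurable U,
  (P U <= (1 / n%:R ^+ 2)%:E)%E &
  forall w, ~ U w -> forall z : grid d N, (\sum_p griddist N (z p) <= N ^ 2)%N ->
     sqnormv (gridvec cplx z : 'cV[C]_d) <= 1 ->
     \sum_(i < n) trunc_amp gc g L i xi w * sq i (gridvec cplx z) w <=
       n%:R * (1 + m + 1 / 40)].
Proof.
have [s [s0 ds s4]] := isqrt_up d.
pose N := (143 * s)%N; exists N.
have N0 : (0 < N)%N by rewrite muln_gt0.
have N2 : (N ^ 2 = kap * s ^ 2)%N by rewrite expnMn.
pose good (z : grid d N) := (\sum_p griddist N (z p) <= N ^ 2)%N &&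
  (sqnormv (gridvec cplx z : 'cV[C]_d) <= 1).
pose A := [set z | good z]%SET.
pose B (z : grid d N) := [set w | n%:R * (1 + m + 1 / 40) <=
  \sum_(i < n) trunc_amp gc g L i xi w * sq i (gridvec cplx z) w].
have mB z : measurable (B z).
  apply: measurable_ge; apply: measurable_sum => i.
  apply: measurable_funM; last exact: (sqamp_meas iid).
  apply: measurable_fun_ifT; last exact: measurable_cst; last exact: (sqamp_meas iid).
  by apply: measurable_fun_ler; [exact: (sqamp_meas iid)|exact: measurable_cst].
have PB z : z \in A -> (P (B z) <=
    (expR (- (n%:R / (16 * L) * (1 / 40 - K / (8 * L)))))%:E)%E.
  rewrite finset.inE => /andP[_ z1].
  exact: (upper_tail iid (1 / 40) L0 (Fvec_gc cg Fxi) (Fvec_gc cg (gridvec_Fvec cplx z)) xi1 z1).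
have [U [mU PU BU]] := union_bound mB PB.
exists U; split => //.
- rewrite mulrA ler_pdivrMr ?exprn_gt0 ?ltr0n// -natrX N2.
  have kE : kap%:R = 143 ^+ 2 :> R by rewrite /kap natrX.
  rewrite (natrM _ kap) kE.
  have : d%:R <= (s ^ 2)%:R :> R by rewrite ler_nat.
  have : 0 <= d%:R :> R by rewrite ler0n.
  rewrite natrM; set S := (s ^ 2)%:R; lra.
- apply: le_trans PU _; rewrite lee_fin [leRHS]mul1r n2E.
  have cA : #|A|%:R <= expR (kap%:R * (4 * d%:R + 1) + 4 * d%:R) :> R.
    (* With 2 <= e and 9 <= e^4 the count becomes an exponential whose exponent is linear in [d]. *)
    apply: (@le_trans _ _ (2 ^+ (N ^ 2) * 9 ^+ d)).
      apply: le_trans _ (@grid_count R d N N0 (N ^ 2)%N).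
      rewrite ler_nat; apply: subset_leq_card; apply/fintype.subsetP => z.
      by rewrite !finset.inE => /andP[].
    have e1 : 2 <= expR (1 : R) by have := expR_ge1Dx (1 : R); lra.
    have e4 : 9 <= expR (4 : R).
      have -> : expR (4 : R) = expR (1 : R) ^+ 4 by rewrite -expRM_natl mulr1.
      apply: (@le_trans _ _ (2 ^+ 4)); first lra.
      by rewrite lerXn2r// nnegrE; lra.
    rewrite expRD; apply: ler_pM; rewrite ?exprn_ge0//.
      apply: (@le_trans _ _ (expR (1 : R) ^+ (N ^ 2))).
        by rewrite lerXn2r// nnegrE; lra.
      rewrite -expRM_natl mulr1 ler_expR N2 natrM ler_wpM2l//.
      by rewrite (_ : 4 * d%:R + 1 = (4 * d + 1)%:R) ?ler_nat// natrD natrM.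
    apply: (@le_trans _ _ (expR (4 : R) ^+ d)).
      by rewrite lerXn2r// nnegrE; lra.
    by rewrite -expRM_natl mulrC.
  apply: le_trans (ler_wpM2r (expR_ge0 _) cA) _.
  rewrite -expRD ler_expR.
  by apply: budget_coarse => //; rewrite ler0n.
- move=> w nU z z1 z2; rewrite leNgt; apply/negP => h; apply: nU.
  by apply: (BU z); [rewrite finset.inE /good z1 z2|exact: ltW].
Qed.

Lemma event_fine : exists N : nat, exists U : set T, [/\ (0 < N)%N,
  (2 * d)%:R / N%:R ^+ 2 <= (2 / n%:R ^+ 5) ^+ 2 :> R, measurable U,
  (P U <= (1 / n%:R ^+ 2)%:E)%E &
  forall w, ~ U w -> forall z z' : grid d N,
     sqnormv (gridvec cplx z : 'cV[C]_d) <= 1 ->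
     sqnormv (gridvec cplx z' : 'cV[C]_d) <= 1 ->
     n%:R * (Dform m (gridvec cplx z) (gridvec cplx z') - 1 / 100) <=
     \sum_(i < n) (sq i (gridvec cplx z) w - sq i (gridvec cplx z') w) ^+ 2].
Proof.
pose N := (n ^ 6)%N; exists N.
have N0 : (0 < N)%N by rewrite expn_gt0 n0.
pose good (z : grid d N) := sqnormv (gridvec cplx z : 'cV[C]_d) <= 1.
pose A := [set z : grid d N * grid d N | good z.1 && good z.2]%SET.
pose B (z : grid d N * grid d N) := [set w |
  \sum_(i < n) diff2 gc g i (gridvec cplx z.1) (gridvec cplx z.2) w <=
  n%:R * (Dform m (gridvec cplx z.1) (gridvec cplx z.2) - 1 / 100)].
have mB z : measurable (B z).
  apply: measurable_le; apply: measurable_sum => i.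
  by apply: measurable_funX; apply: measurable_funB; exact: (sqamp_meas iid).
have h100 : (0 : R) < 1 / 100 by lra.
have PB z : z \in A -> (P (B z) <= (expR (- (n%:R * (1 / 100) ^+ 2 / (8 * K))))%:E)%E.
  rewrite finset.inE => /andP[z1 z2].
  by apply: (lower_tail iid h100 (Fvec_gc cg (gridvec_Fvec cplx z.1))
    (Fvec_gc cg (gridvec_Fvec cplx z.2)) z1 z2).
have [U [mU PU BU]] := union_bound mB PB.
exists U; split => //.
- rewrite /N natrX ler_pdivrMr ?exprn_gt0//.
  rewrite (_ : (2 / n%:R ^+ 5) ^+ 2 * (n%:R ^+ 6) ^+ 2 = 4 * n%:R ^+ 2); last first.
    by field; rewrite gt_eqF.
  have h1 : d%:R <= n%:R :> R by rewrite ler_nat.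
  have h2 : n%:R <= n%:R ^+ 2 :> R by rewrite expr2 ler_peMr// ler1n.
  rewrite natrM; have := n0R; lra.
- apply: le_trans PU _; rewrite lee_fin [leRHS]mul1r n2E.
  have cA : #|A|%:R <= expR (32 * (d%:R * ell)) :> R.
    apply: (@le_trans _ _ ((n ^ 8) ^ (d * 2 + d * 2))%:R).
      rewrite ler_nat; apply: leq_trans (max_card _) _.
      rewrite card_prod card_ffun card_prod !card_ord card_bool -expnD.
      (* From n >= 3. A pair of grid points has 4d indices, which gives the exponent 8 * 4 = 32. *)
      have N8 : (N.*2.+1 <= n ^ 8)%N.
        rewrite (_ : 8 = 6 + 2)%N// expnD -/N -addnn -mulnn.
        have : (3 * 3 <= n * n)%N by rewrite leq_mul.
        by move: N0; clearbody N; nia.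
      by move: N8; clearbody N; case: (d * 2 + d * 2)%N => // k N8; rewrite leq_exp2r.
    rewrite -expnM natrX.
    rewrite (_ : 32 * (d%:R * ell) = (8 * (d * 2 + d * 2))%:R * ell); last first.
      by rewrite !(natrM, natrD); ring.
    by rewrite expRM_natl lnK ?posrE.
  apply: le_trans (ler_wpM2r (expR_ge0 _) cA) _.
  rewrite -expRD ler_expR.
  by apply: budget_fine.
- move=> w nU z z' z1 z2; rewrite leNgt; apply/negP => h; apply: nU.
  by apply: (BU (z, z')); [rewrite finset.inE /good z1 z2|exact: ltW].
Qed.

Lemma concentration_event (xs : 'cV[C]_d) : Fvec cplx xs ->
  (forall a, sqamp a xs = sqnormv xs * sqamp a xi) ->
  exists E : set T, [/\ measurable E,
    (P E >= (1 - 5 / n%:R ^+ 2)%:E)%E &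
    forall w, E w ->
      upper_cond cplx (fun i => sensing_mx cplx (gauss_vec gc g i w)) xs m (1 / 10) /\
      lower_cond cplx (fun i => sensing_mx cplx (gauss_vec gc g i w)) xs m (1 / 20)].
Proof.
move=> Fxs xsE.
have m1 := m4_ge1; have m2 := m4_le2.
have [U1 [mU1 PU1 H1]] := event_trunc.
have [U2 [mU2 PU2 H2]] := event_coord.
have [N3 [U3 [N30 N3d mU3 PU3 H3]]] := event_coarse.
have [N4 [U4 [N40 N4d mU4 PU4 H4]]] := event_fine.
pose U := (U1 `|` U2) `|` (U3 `|` U4).
have mU : measurable U by apply: measurableU; exact: measurableU.
have PU : (P U <= (5 / n%:R ^+ 2)%:E)%E.
  apply: le_trans (measureU2 _ _ _) _; [exact: measurableU|exact: measurableU|].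
  rewrite (_ : 5 / n%:R ^+ 2 = (2 / n%:R ^+ 2 + 1 / n%:R ^+ 2) +
    (1 / n%:R ^+ 2 + 1 / n%:R ^+ 2)); last by field; rewrite gt_eqF.
  rewrite !EFinD; apply: leeD.
    by apply: le_trans (measureU2 _ mU1 mU2) _; exact: leeD.
  by apply: le_trans (measureU2 _ mU3 mU4) _; exact: leeD.
exists (~` U); split.
- exact: measurableC.
- by rewrite probability_setC// EFinB; apply: leeB.
move=> w nU; have [n1 n2 n3' n4] : [/\ ~ U1 w, ~ U2 w, ~ U3 w & ~ U4 w].
  by split => h; apply: nU; [left; left|left; right|right; left|right; right].
split.
  (* With t = 1/40 and m <= 2, the net factor 101/99 still stays within 1 + m + 1/10. *)
  by apply: (upper_on_event N30 n0 Fxs xsE N3d _ _ (H1 w n1) (H3 w n3')); lra.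
have nbig := budget_mesh l1 n0R ll.
have m0 : 0 <= m by lra.
have e1 : (0 : R) <= 1 / 20 by lra.
(* The allowance 1/40 is spent as 1/100 on the tail bound, at most 1/100 on discretizing the form
   and at most 1/200 on discretizing the sum; the last two rely on n >= 12800. *)
have e2 : 1 / 40 <= 1 / 20 * (m / 2) by lra.
apply: (lower_of_uniform m0 e1 e2 _ Fxs) => y y' Fy Fy' y1 y1'.
have r0 : 0 <= 2 / n%:R ^+ 5 :> R by rewrite divr_ge0// exprn_ge0.
have := lower_uniform_grid n0 N40 (le_trans ler01 m1) m2 r0 N4d (H2 w n2) (H4 w n4) Fy Fy' y1 y1'.
apply: le_trans; rewrite lerD2l lerN2.
have i5 : n%:R ^+ 5 >= n%:R :> R by rewrite -[leLHS]expr1 ler_eXn2l// ltr1n (leq_trans _ n3).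
have q1 : 64 * (2 / n%:R ^+ 5) <= 128 / n%:R :> R.
  rewrite mulrA (_ : 64 * 2 = 128 :> R); last by ring.
  by rewrite ler_wpM2l// lef_pV2// posrE exprn_gt0.
have q2 : 32 * n%:R ^+ 4 * (2 / n%:R ^+ 5) = 64 / n%:R :> R by field; rewrite gt_eqF.
have q3 : (n%:R)^-1 <= (128 * 100)^-1 :> R by rewrite lef_pV2// posrE// mulr_gt0.
rewrite q2; lra.
Qed.

End Concentration.

Lemma gap_ineq_m4 (R : realType) (gc : bool) : gap_ineq (m4 R gc) (1 / 20) (1 / 10).
Proof. by rewrite /gap_ineq /m4; case: gc; lra. Qed.

Lemma normalize_sqamp (R : realType) (cplx : bool) d (xs : 'cV[R[i]]_d) :
  Fvec cplx xs -> exists xi : 'cV[R[i]]_d,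
  [/\ Fvec cplx xi, sqnormv xi <= 1 &
      forall a, sqamp a xs = sqnormv xs * sqamp a xi].
Proof.
move=> Fxs; pose r := Num.sqrt (sqnormv xs).
have r2 : r ^+ 2 = sqnormv xs by rewrite sqr_sqrtr ?sqnormv_ge0.
(* For [xs = 0] the inverse of 0 is 0, so [xi] is 0 and the identity still holds. *)
exists (r^-1%:C *: xs); split; first exact: FvecZr.
  rewrite sqnormvZr exprVn r2; have [->|x0] := eqVneq (sqnormv xs) 0.
    by rewrite mulr0.
  by rewrite mulVf.
move=> a; rewrite sqampZr exprVn r2; have [x0|x0] := eqVneq (sqnormv xs) 0.
  apply/eqP; rewrite x0 mul0r eq_le sqamp_ge0 andbT.
  by apply: le_trans (sqamp_le _ _) _; rewrite x0 mulr0.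
by rewrite mulVKf.
Qed.

Lemma gaussian_conditions (R : realType) : exists c1 c2 : R, 0 < c1 /\ 0 < c2 /\
     forall (cplx gc : bool), (cplx ==> gc) ->
     forall (n d : nat) (xs : 'cV[R[i]]_d),
       Fvec cplx xs ->
       (0 < n)%N ->
       c1 * d%:R * ln (d%:R : R) <= n%:R ->
     forall (dsp : measure_display) (T : measurableType dsp) (P : probability T R)
            (g : 'I_n -> 'I_d -> bool -> T -> R),
       iid_std_gaussian P gc g ->
       let As := fun w : T => fun i : 'I_n => sensing_mx cplx (gauss_vec gc g i w) in
       exists E : set T, measurable E /\
         E `<=` [set w | exists dL dU : R, 0 < dL /\ 0 < dU /\
                   gap_ineq (m4 R gc) dL dU /\
                   upper_cond cplx (As w) xs (m4 R gc) dU /\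
                   lower_cond cplx (As w) xs (m4 R gc) dL] /\
         (P E >= (1 - c2 / (n%:R ^+ 2))%:E)%E.
Proof.
have b0 : 0 < (@budget R)^-1 by rewrite invr_gt0 budget_gt0.
have [N0 [N00 HN]] := asymp_bounds (2 * @Kamp R) b0.
(* The summand [N0 ^+ 2] in the second constant makes the probability bound nonpositive for n < N0,
   where the empty event will do; 5 is the sum of the four failure bounds. *)
exists (2 / (@budget R)^-1), (N0 ^+ 2 + 5); split; first by rewrite divr_gt0.
split; first by rewrite ltr_wpDl ?sqr_ge0.
move=> cplx gc cg n d xs Fxs n0 Hn dsp T P g iid As.
have n0R : 0 < n%:R :> R by rewrite ltr0n.
have [nN|Nn] := ltP (n%:R : R) N0.
  exists set0; split; first exact: measurable0.
  split; first by move=> w.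
  rewrite measure0 lee_fin subr_le0 ler_pdivlMr ?exprn_gt0// mul1r.
  apply: (@le_trans _ _ (N0 ^+ 2)); last by rewrite lerDl.
  by rewrite lerXn2r// ?nnegrE ltW.
have [n3 l1 lK dl ll] := HN n d Nn Hn.
have [xi [Fxi xi1 xsE]] := normalize_sqamp Fxs.
have [E [mE PE HE]] := concentration_event cg iid n3 l1 lK dl ll Fxi xi1 Fxs xsE.
exists E; split => //; split.
  move=> w Ew; exists (1 / 20), (1 / 10); have [up low] := HE w Ew.
  by split; [lra|split; [lra|split; [exact: gap_ineq_m4|]]].
apply: le_trans PE; rewrite lee_fin lerD2l lerN2 ler_pM2r ?invr_gt0 ?exprn_gt0//.
by rewrite lerDr sqr_ge0.
Qed.

(** * Second-order critical points *)

Section QuarticDerivative.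
Context {R : realType}.

Lemma quartic_derive1 (c0 c1 c2 c3 c4 : R) (t : R) :
  is_derive t 1 (fun t : R => c0 + c1 * t + c2 * t ^+ 2 + c3 * t ^+ 3 + c4 * t ^+ 4 : R)
    (c1 + 2 * c2 * t + 3 * c3 * t ^+ 2 + 4 * c4 * t ^+ 3).
Proof.
apply: is_derive_eq.
rewrite /GRing.scale /=; ring.
Qed.

(** The derivative is rewritten as a quartic with leading coefficient 0, so that the same rule
    applies twice. *)
Lemma quartic_derivatives (c0 c1 c2 c3 c4 : R) (phi : R -> R) :
  (forall t, phi t = c0 + c1 * t + c2 * t ^+ 2 + c3 * t ^+ 3 + c4 * t ^+ 4) ->
  derive1 phi 0 = c1 /\ derive1 (derive1 phi) 0 = 2 * c2.
Proof.
move=> phiE; have -> : phi = fun t => c0 + c1 * t + c2 * t ^+ 2 + c3 * t ^+ 3 + c4 * t ^+ 4.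
  exact/funext.
have d1 : derive1 (fun t : R => c0 + c1 * t + c2 * t ^+ 2 + c3 * t ^+ 3 + c4 * t ^+ 4) =
    fun t => c1 + (2 * c2) * t + (3 * c3) * t ^+ 2 + (4 * c4) * t ^+ 3 + 0 * t ^+ 4.
  apply/funext => t; rewrite derive1E.
  have [_ ->] := quartic_derive1 c0 c1 c2 c3 c4 t; ring.
rewrite d1; split; first by ring.
rewrite derive1E.
have [_ ->] := quartic_derive1 c1 (2 * c2) (3 * c3) (4 * c4) 0 0; ring.
Qed.

End QuarticDerivative.

Section CriticalPoints.
Context {R : realType}.
Local Notation C := R[i].
Local Notation Re := complex.Re.
Local Notation Im := complex.Im.
Variable d : nat.
Implicit Types (x y u v w : 'cV[C]_d) (A M : 'M[C]_d).

(** The real part of u* A v: a real bilinear form, symmetric for Hermitian [A]. *)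
Definition qform A u v : R := reip u (A *m v).

Lemma qformDr A u v w : qform A u (v + w) = qform A u v + qform A u w.
Proof. by rewrite /qform mulmxDr reipD. Qed.

Lemma qformDl A u v w : qform A (u + v) w = qform A u w + qform A v w.
Proof. by rewrite /qform reipC reipD !(reipC (A *m w)). Qed.

Lemma qformZr A (t : R) u v : qform A u (t%:C *: v) = t * qform A u v.
Proof. by rewrite /qform -scalemxAr reipZr. Qed.

Lemma qformZl A (t : R) u v : qform A (t%:C *: u) v = t * qform A u v.
Proof. by rewrite /qform reipC reipZr reipC. Qed.

Lemma qformN A u v : qform A u (- v) = - qform A u v.
Proof. by rewrite /qform mulmxN reipN. Qed.

Lemma qformNl A u v : qform A (- u) v = - qform A u v.
Proof. by rewrite /qform reipC reipN reipC. Qed.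

Lemma hermitian_entry A k j : Defs.hermitian A -> A k j = conjc (A j k).
Proof. by move=> hA; rewrite -{1}hA !mxE. Qed.

Lemma qformC A u v : Defs.hermitian A -> qform A u v = qform A v u.
Proof.
move=> hA; rewrite /qform !reip_mulmx exchange_big; apply: eq_bigr => k _.
apply: eq_bigr => j _; rewrite (hermitian_entry j k hA).
by case: (u k 0) (A k j) (v j 0) => [p1 q1] [p2 q2] [p3 q3] /=; ring.
Qed.

Lemma hip_qform A x : Defs.hermitian A -> hip A (outer x) = qform A x x.
Proof.
move=> hA; rewrite /qform reip_mulmx hipE; apply: eq_bigr => j _.
apply: eq_bigr => k _; rewrite outerE.
by case: (x k 0) (A k j) (x j 0) => [p1 q1] [p2 q2] [p3 q3] /=; ring.
Qed.

Lemma qform_Re A v : Re ((adjmx v *m A *m v) 0 0) = qform A v v.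
Proof.
rewrite -mulmxA mxE Re_sum; apply: eq_bigr => k _; rewrite !mxE.
by case: (v k 0) (\sum_j _) => [p q] [p' q'] /=; ring.
Qed.

Lemma psd_qform_ge0 (cplx : bool) A v : psd cplx A -> Fvec cplx v -> 0 <= qform A v v.
Proof.
move=> [_ pA] Fv; rewrite -qform_Re; move: (pA v Fv).
by case: (_ 0 0) => p q; rewrite lecE /= => /andP[].
Qed.

Lemma psd_cauchy_schwarz (cplx : bool) A u v : psd cplx A ->
  Fvec cplx u -> Fvec cplx v -> qform A u v ^+ 2 <= qform A u u * qform A v v.
Proof.
move=> pA Fu Fv; have hA : Defs.hermitian A by case: pA => -[].
have P (t : R) : 0 <= qform A u u + 2 * t * qform A u v + t ^+ 2 * qform A v v.
  have := psd_qform_ge0 pA (FvecD Fu (FvecZr t Fv)).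
  rewrite qformDl !qformDr !qformZl !qformZr (qformC v u hA).
  by congr (0 <= _); ring.
have u0 := psd_qform_ge0 pA Fu; have v0 := psd_qform_ge0 pA Fv.
move: P u0 v0; move: (qform A u u) (qform A u v) (qform A v v) => a b c P a0 c0.
have [c00|c00] := eqVneq c 0.
  rewrite c00 mulr0; have [->|b0] := eqVneq b 0; first by rewrite expr0n.
  (* When [c = 0] the polynomial is affine in [t], and this [t] gives it the value -1. *)
  have := P (- (a + 1) / (2 * b)); rewrite c00 mulr0 addr0.
  rewrite (_ : 2 * _ * b = - (a + 1)); last by field.
  by move=> ?; exfalso; lra.
have cp : 0 < c by rewrite lt_def c00.
have := P (- b / c).
rewrite (_ : a + _ + _ = (a * c - b ^+ 2) / c); last by field.
by rewrite pmulr_lge0 ?invr_gt0// subr_ge0.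
Qed.

Lemma reip_scale2 (c : C) x y :
  reip (c *: x) (c *: y) = (Re c ^+ 2 + Im c ^+ 2) * reip x y.
Proof.
rewrite reipZ (reipC _ y) (imipC _ y) reipZ imipZ (reipC y x) (imipC y x); ring.
Qed.

Lemma qform_scale A (c : C) x : qform A (c *: x) (c *: x) =
  (Re c ^+ 2 + Im c ^+ 2) * qform A x x.
Proof. by rewrite /qform -scalemxAr reip_scale2. Qed.

(** Moves a complex coefficient into the left slot, where the first-order condition accepts any
    direction over the field. *)
Lemma qform_conj A (c : C) x y : qform A x (c *: y) = qform A (conjc c *: x) y.
Proof.
rewrite /qform -scalemxAr reipZ (reipC (_ *: x)) reipZ (reipC _ x) (imipC _ x).
by case: c => p q /=; ring.
Qed.

Lemma outer_shift_qform A x v (t : R) : Defs.hermitian A ->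
  hip A (outer (x + t%:C *: v)) =
  qform A x x + 2 * t * qform A v x + t ^+ 2 * qform A v v.
Proof.
move=> hA; rewrite hip_qform// qformDl !qformDr !qformZl !qformZr (qformC x v hA).
ring.
Qed.

(** Along any line the objective is a quartic polynomial in [t], so the two derivatives at 0 are
    read off its coefficients of degree 1 and 2. *)
Lemma critical_conditions (cplx : bool) n (As : 'I_n -> 'M[C]_d) (y : 'I_n -> R) x :
  (forall i, Defs.hermitian (As i)) -> second_order_critical cplx (fobj As y) x ->
  forall v, Fvec cplx v ->
    \sum_(i < n) (qform (As i) x x - y i) * qform (As i) v x = 0 /\
    0 <= \sum_(i < n) ((qform (As i) x x - y i) * qform (As i) v v +
                       2 * qform (As i) v x ^+ 2).
Proof.
move=> hA [_ H] v Fv; have [_ [g0 h0]] := H v Fv.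
pose r i := qform (As i) x x - y i; pose b i := qform (As i) v x.
pose q i := qform (As i) v v.
have phiE (t : R) : fobj As y (x + t%:C *: v) = \sum_(i < n) r i ^+ 2 +
    (\sum_(i < n) 4 * (r i * b i)) * t +
    (\sum_(i < n) 2 * (r i * q i + 2 * b i ^+ 2)) * t ^+ 2 +
    (\sum_(i < n) 4 * (b i * q i)) * t ^+ 3 + (\sum_(i < n) q i ^+ 2) * t ^+ 4.
  rewrite /fobj !mulr_suml -!big_split /=; apply: eq_bigr => i _.
  by rewrite outer_shift_qform// /r /b /q; ring.
have [d1 d2] := quartic_derivatives phiE.
rewrite d1 -mulr_sumr in g0; rewrite d2 -mulr_sumr in h0.
split; last by rewrite !pmulr_rge0 in h0.
by move/eqP: g0; rewrite mulf_eq0 pnatr_eq0 /= => /eqP.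
Qed.

(** The coefficient of the orthogonal projection of [y] on the line of [x]; of modulus 1 when the
    outer products agree and are nonzero. *)
Definition phase x y : C := (reip x y / sqnormv x) +i* (imip x y / sqnormv x).

Lemma phase_inF (cplx : bool) x y : Fvec cplx x -> Fvec cplx y -> inF cplx (phase x y).
Proof.
rewrite /inF /phase; case: cplx => //= Fx Fy.
by rewrite imip_real// mul0r.
Qed.

Lemma sqnormv_phase x y : sqnormv x != 0 ->
  sqnormv (y - phase x y *: x) = sqnormv y - sqamp x y / sqnormv x.
Proof.
move=> x0; rewrite sqnormvB sqnormvZ reipZ (reipC y x) (imipC y x) /= /sqamp.
by field.
Qed.

Lemma outer_eq_of_frob x y : frob2 (outer x - outer y) = 0 -> outer x = outer y.
Proof.
move/eqP; rewrite psumr_eq0 => [/allP H|i _]; last first.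
  by apply: sumr_ge0 => j _; rewrite addr_ge0 ?sqr_ge0.
apply/matrixP => i j; have := H i (mem_index_enum _) => /=.
rewrite psumr_eq0 => [/allP /(_ j (mem_index_enum _))|k _]; last first.
  by rewrite addr_ge0 ?sqr_ge0.
rewrite !mxE; set a := \sum_k _; set b := \sum_k _.
case: a b => [p q] [p' q'] /=.
by rewrite paddr_eq0 ?sqr_ge0// !sqrf_eq0 !subr_eq0 => /andP[/eqP -> /eqP ->].
Qed.

Lemma frob2_ge0 M : 0 <= frob2 M.
Proof.
by apply: sumr_ge0 => i _; apply: sumr_ge0 => j _; rewrite addr_ge0 ?sqr_ge0.
Qed.

Lemma phase_of_outer_eq (cplx : bool) x y : Fvec cplx x -> Fvec cplx y ->
  outer x = outer y -> exists s : C, inF cplx s /\ `|s| = 1 /\ x = s *: y.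
Proof.
move=> Fx Fy xy.
have sx : sqnormv x ^+ 2 = sqamp y x by rewrite -hip_outer -xy hip_outer sqamp_xx.
have sy : sqnormv y ^+ 2 = sqamp y x by rewrite sqampC -hip_outer xy hip_outer sqamp_xx.
have nxy : sqnormv x = sqnormv y.
  by apply/eqP; rewrite -(eqrXn2 (n := 2))// ?sqnormv_ge0// sx sy.
have [y0|y0] := eqVneq (sqnormv y) 0.
  exists 1; split; first by rewrite /inF /= eqxx orbT.
  split; first exact: normr1.
  by rewrite scale1r (sqnormv_eq0 y0); apply: sqnormv_eq0; rewrite nxy.
exists (phase y x); split; first exact: phase_inF.
split.
  have H : (reip y x / sqnormv y) ^+ 2 + (imip y x / sqnormv y) ^+ 2 = 1.
    rewrite !expr_div_n -mulrDl -/(sqamp y x) -sy divff//.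
    by rewrite expf_neq0.
  by rewrite normc_def /= H sqrtr1.
apply/eqP; rewrite -subr_eq0; apply/eqP/sqnormv_eq0.
rewrite sqnormv_phase// -sy nxy expr2 mulfK// subrr.
by [].
Qed.

(** Shows that the set defining [opnorm] is bounded above, without which its supremum would carry no
    information. *)
Lemma sqnormv_mulmx_bounded M : exists2 c : R, 0 <= c &
  forall v, sqnormv (M *m v) <= c * sqnormv v.
Proof.
pose a (k : 'I_d) : 'cV[C]_d := \col_j conjc (M k j).
have E v : sqnormv (M *m v) = \sum_(k < d) sqamp (a k) v.
  apply: eq_bigr => k _; rewrite mxE Re_sum Im_sum /sqamp /reip /imip.
  by congr (_ ^+ 2 + _ ^+ 2); apply: eq_bigr => j _; rewrite mxE;
    case: (M k j) (v j 0) => [p q] [p' q'] /=; ring.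
exists (\sum_(k < d) 2 * sqnormv (a k)).
  by apply: sumr_ge0 => k _; rewrite mulr_ge0// sqnormv_ge0.
by move=> v; rewrite E mulr_suml; apply: ler_sum => k _; exact: sqamp_le.
Qed.

Lemma opnorm_qform (cplx : bool) M v : Fmx cplx M -> Fvec cplx v ->
  qform M v v <= opnorm cplx M * sqnormv v.
Proof.
move=> FM Fv; have [v0|v0] := eqVneq (sqnormv v) 0.
  rewrite v0 mulr0 (sqnormv_eq0 v0) /qform mulmx0 reipC /reip big1// => j _.
  by rewrite mxE /= !mul0r addr0.
have vp : 0 < sqnormv v by rewrite lt_def v0 sqnormv_ge0.
pose t := Num.sqrt (sqnormv v).
have t0 : 0 < t by rewrite sqrtr_gt0.
have t2 : t ^+ 2 = sqnormv v by rewrite sqr_sqrtr// ltW.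
have [c c0 Hc] := sqnormv_mulmx_bounded M.
have op : Num.sqrt (sqnormv (M *m (t^-1%:C *: v))) <= opnorm cplx M.
  apply: ub_le_sup.
    exists (Num.sqrt c) => _ [w [_ w1] <-]; rewrite ler_wsqrtr//.
    by apply: le_trans (Hc w) _; rewrite ler_piMr.
  exists (t^-1%:C *: v) => //; split; first exact: FvecZr.
  by rewrite sqnormvZr exprVn t2 mulVf.
have MvE : Num.sqrt (sqnormv (M *m v)) <= opnorm cplx M * t.
  move: op; rewrite -scalemxAr sqnormvZr sqrtrM ?sqr_ge0// sqrtr_sqr gtr0_norm ?invr_gt0//.
  by rewrite ler_pdivrMl// mulrC.
have CS : qform M v v <= t * Num.sqrt (sqnormv (M *m v)).
  have h := reip_sqr_le v (M *m v).
  rewrite /t -sqrtrM ?sqnormv_ge0//; apply: le_trans (ler_norm _) _.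
  by rewrite -sqrtr_sqr ler_wsqrtr.
apply: le_trans CS _; rewrite -t2 expr2.
by have := ler_wpM2l (ltW t0) MvE; congr (_ <= _); ring.
Qed.

End CriticalPoints.

(** The variables stand for s = |x|^2, t = |xs|^2 and p, the squared norm of the projection of [xs]
    on [x], so that t - p = |v|^2; [rho] is the normalized sum of squared residuals. *)
Lemma no_spurious_algebra (R : realType) (m s t p D rho dL dU : R) :
  0 < m -> 0 < dL -> 0 < dU -> gap_ineq m dL dU ->
  0 <= t -> 0 <= p -> p <= t ->
  D = m * (s ^+ 2 + t ^+ 2 - 2 * (p * s)) + (s - t) ^+ 2 ->
  (1 - dL) * D <= rho -> 3 * rho <= 2 * ((1 + m + dU) * t * (t - p)) -> D <= 0.
Proof.
rewrite /gap_ineq => m0 L0 U0 gap t0 p0 pt DE lo up.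
have mm : 0 < m ^+ 2 + 2 * m by rewrite addr_gt0 ?exprn_gt0 ?mulr_gt0.
have L1 : 3 * dL < 1.
  have U1 : 0 <= 2 * (m + 1) * dU by rewrite !mulr_ge0//; lra.
  have : (m ^+ 2 + 2 * m) * (3 * dL) < (m ^+ 2 + 2 * m) * 1 by lra.
  by rewrite ltr_pM2l.
have tw : 0 <= t * (t - p) by rewrite mulr_ge0// subr_ge0.
(* Minimizes D over [s]: after completing the square in [s], the remainder is this multiple of t (t
   - p) plus m^2 p (t - p) >= 0. *)
have key : m * (m + 2) * (t * (t - p)) <= (m + 1) * D.
  have h1 := sqr_ge0 ((m + 1) * s - (m * p + t)).
  have h2 : 0 <= m ^+ 2 * (p * (t - p)).
    by rewrite mulr_ge0 ?sqr_ge0// mulr_ge0// subr_ge0.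
  rewrite (_ : (m + 1) * D = ((m + 1) * s - (m * p + t)) ^+ 2 +
    (m ^+ 2 * (p * (t - p)) + m * (m + 2) * (t * (t - p)))); last by rewrite DE; ring.
  lra.
have M0 : 0 < m + 1 by lra.
have L2 : 0 < 1 - dL by lra.
have h3 := ler_wpM2l (ltW L2) key.
have h4 := ler_wpM2l (ltW M0) lo.
have h5 := ler_wpM2l (ltW M0) up.
(* Positivity of [G] is the gap inequality rearranged, since 3 (m^2 + 2m) - 2 (m+1)^2 = m^2 + 2m -
   2. *)
pose G := 3 * (1 - dL) * (m ^+ 2 + 2 * m) - 2 * (m + 1) * (1 + m + dU).
have G0 : 0 < G by rewrite /G; lra.
have h6 : G * (t * (t - p)) <= 0 by rewrite /G; lra.
have h7 : t * (t - p) <= 0 by rewrite -(pmulr_rle0 _ G0).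
have h8 : rho <= 0.
  have : (1 + m + dU) * (t * (t - p)) = 0.
    by rewrite (_ : t * (t - p) = 0) ?mulr0//; apply/le_anti; rewrite h7 tw.
  by move: up; rewrite -mulrA => up ?; lra.
by rewrite -(pmulr_rle0 _ L2); exact: le_trans h8.
Qed.

(** The residual of the projection has nonnegative squared norm; this removes the factor 2 of
    [sqamp_le]. *)
Lemma sqamp_le_sharp (R : realType) d (x y : 'cV[R[i]]_d) :
  sqamp x y <= sqnormv x * sqnormv y.
Proof.
have [x0|x0] := eqVneq (sqnormv x) 0.
  by have := sqamp_le x y; rewrite x0 mulr0 mul0r.
have xp : 0 < sqnormv x by rewrite lt_def x0 sqnormv_ge0.
have := sqnormv_ge0 (y - phase x y *: x).
by rewrite sqnormv_phase// subr_ge0 ler_pdivrMr// mulrC.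
Qed.

Lemma no_spurious_critical (R : realType) (cplx : bool) (n d : nat) (xs : 'cV[R[i]]_d)
          (As : 'I_n -> 'M[R[i]]_d) (y : 'I_n -> R) (m dL dU : R) :
     Fvec cplx xs ->
     (forall i, psd cplx (As i)) ->
     (forall i, y i = hip (As i) (outer xs)) ->
     0 < m -> 0 < dL -> 0 < dU ->
     upper_cond cplx As xs m dU ->
     lower_cond cplx As xs m dL ->
     gap_ineq m dL dU ->
     forall x : 'cV[R[i]]_d,
       second_order_critical cplx (fobj As y) x ->
       outer x = outer xs.
Proof.
move=> Fxs pA yE m0 L0 U0 up lo gap x crit.
have Fx : Fvec cplx x by case: crit.
have hA i : Defs.hermitian (As i) by case: (pA i) => -[].
have FA i : Fmx cplx (As i) by case: (pA i) => -[].
have cond := critical_conditions hA crit.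
have {yE} yE i : y i = qform (As i) xs xs by rewrite yE hip_qform.
pose r i := qform (As i) x x - y i.
have c1 v (Fv : Fvec cplx v) : \sum_(i < n) r i * qform (As i) v x = 0 := (cond v Fv).1.
pose s := sqnormv x; pose t := sqnormv xs; pose p := sqamp x xs / s.
have s0 : 0 <= s by exact: sqnormv_ge0.
have t0 : 0 <= t by exact: sqnormv_ge0.
(* the component of [xs] orthogonal to [x] *)
have [c [Fc vn]] : exists c, inF cplx c /\ sqnormv (xs - c *: x) = t - p.
  (* For x = 0 division by 0 gives p = 0, and [c = 0] makes [v] equal to [xs]. *)
  have [sx|sx] := eqVneq s 0.
    exists 0; split; first by rewrite /inF /= eqxx orbT.
    by rewrite scale0r subr0 /p sx invr0 mulr0 subr0.
  by exists (phase x xs); split; [exact: phase_inF|exact: sqnormv_phase].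
have ps : p * s = sqamp x xs.
  have [sx|sx] := eqVneq s 0; last by rewrite /p divfK.
  rewrite sx mulr0; apply/le_anti; rewrite sqamp_ge0/=.
  by apply: le_trans (sqamp_le_sharp x xs) _; rewrite -/s sx mul0r.
have p0 : 0 <= p by rewrite divr_ge0// sqamp_ge0.
pose v := xs - c *: x.
have Fv : Fvec cplx v by apply: FvecB => //; exact: FvecZ.
have pt : p <= t by rewrite -subr_ge0 -vn sqnormv_ge0.
(* In the expansion of the form at v = xs - c x, every term other than the one at [xs] contains [x]
   in a slot, and the first-order condition cancels it. *)
have rv : \sum_(i < n) r i * qform (As i) v v = - \sum_(i < n) r i ^+ 2.
  have e1 : \sum_(i < n) r i * qform (As i) v v =
      \sum_(i < n) r i * qform (As i) xs xs.
    have -> : \sum_(i < n) r i * qform (As i) v v =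
        \sum_(i < n) r i * qform (As i) xs xs +
        (complex.Re c ^+ 2 + complex.Im c ^+ 2) * (\sum_(i < n) r i * qform (As i) x x) -
        2 * (\sum_(i < n) r i * qform (As i) (conjc c *: xs) x).
      rewrite !mulr_sumr -big_split -sumrB /=; apply: eq_bigr => i _.
      rewrite /v qformDl !qformDr qformNl qformN qformNl qformN qform_scale.
      by rewrite (qformC (c *: x) xs (hA i)) qform_conj; ring.
    rewrite c1// c1 ?mulr0 ?subr0 ?addr0//.
    by apply: FvecZ => //; move: Fc; rewrite /inF; case: (c) => a b /=; rewrite oppr_eq0.
  rewrite e1 -[LHS]opprK; congr (- _).
  transitivity (\sum_(i < n) r i * qform (As i) x x - \sum_(i < n) r i * qform (As i) xs xs).
    by rewrite c1// sub0r.
  by rewrite -sumrB; apply: eq_bigr => i _; rewrite /r yE; ring.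
have hess := (cond v Fv).2.
have Mv : qform (opAadj As (opA As (outer xs))) v v =
    \sum_(i < n) qform (As i) xs xs * qform (As i) v v.
  rewrite /qform opAadj_mulmx reip_sumr; apply: eq_bigr => i _.
  by rewrite reipZr /opA hip_qform.
have FM : Fmx cplx (opAadj As (opA As (outer xs))) by exact: Fmx_opAadj.
have main : 3 * (\sum_(i < n) r i ^+ 2) <= 2 * qform (opAadj As (opA As (outer xs))) v v.
  (* Cauchy-Schwarz produces x* A_i x = r_i + y_i; the part with r_i is [rv] and the part with y_i
     is the form of A^*A(zz* ) at [v]. *)
  have cs : \sum_(i < n) qform (As i) v x ^+ 2 <=
      \sum_(i < n) qform (As i) xs xs * qform (As i) v v - \sum_(i < n) r i ^+ 2.
    rewrite -rv -big_split /=; apply: ler_sum => i _.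
    apply: le_trans (psd_cauchy_schwarz (pA i) Fv Fx) _.
    by rewrite /r yE le_eqVlt; apply/orP; left; apply/eqP; ring.
  move: hess; rewrite big_split /= rv -mulr_sumr Mv; lra.
have n10 : 0 <= n%:R^-1 :> R by rewrite invr_ge0.
have main2 : 3 * (n%:R^-1 * \sum_(i < n) r i ^+ 2) <= 2 * ((1 + m + dU) * t * (t - p)).
  have h1 := ler_wpM2l n10 main.
  have h2 := ler_wpM2l n10 (opnorm_qform FM Fv).
  have h3 : 0 <= t - p by rewrite subr_ge0.
  have h4 := ler_wpM2r h3 up.
  rewrite /v vn in h2.
  move: h1 h2 h4; rewrite -/t -/v; lra.
have lower := lo x Fx.
have sE : sqnormR (opA As (outer x - outer xs)) = \sum_(i < n) r i ^+ 2.
  apply: eq_bigr => i _; rewrite /opA hipBr !hip_qform// /r yE//.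
rewrite sE -DformE in lower.
have D0 : Dform m x xs <= 0.
  apply: (@no_spurious_algebra R m s t p _ _ dL dU m0 L0 U0 gap t0 p0 pt _ lower main2).
  by rewrite /Dform ps -/s -/t.
apply: outer_eq_of_frob; apply/le_anti; rewrite frob2_ge0 andbT.
rewrite -(pmulr_rle0 _ m0); apply: le_trans D0.
by rewrite DformE lerDl sqr_ge0.
Qed.

Theorem theorem1 (R : realType) :
  (* Part 1 *)
  (forall (cplx : bool) (n d : nat) (xs : 'cV[R[i]]_d)
          (As : 'I_n -> 'M[R[i]]_d) (y : 'I_n -> R) (m dL dU : R),
     Fvec cplx xs ->
     (forall i, psd cplx (As i)) ->
     (forall i, y i = hip (As i) (outer xs)) ->
     0 < m -> 0 < dL -> 0 < dU ->
     upper_cond cplx As xs m dU ->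
     lower_cond cplx As xs m dL ->
     gap_ineq m dL dU ->
     forall x : 'cV[R[i]]_d,
       second_order_critical cplx (fobj As y) x ->
       outer x = outer xs /\
       exists s : R[i], inF cplx s /\ `|s| = 1 /\ x = s *: xs)
  /\
  (* Part 2 *)
  (exists c1 c2 : R, 0 < c1 /\ 0 < c2 /\
     forall (cplx gc : bool), (cplx ==> gc) ->
     forall (n d : nat) (xs : 'cV[R[i]]_d),
       Fvec cplx xs ->
       (0 < n)%N ->
       c1 * d%:R * ln (d%:R : R) <= n%:R ->
     forall (dsp : measure_display) (T : measurableType dsp) (P : probability T R)
            (g : 'I_n -> 'I_d -> bool -> T -> R),
       iid_std_gaussian P gc g ->
       let As := fun w : T => fun i : 'I_n => sensing_mx cplx (gauss_vec gc g i w) in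
       exists E : set T, measurable E /\
         E `<=` [set w | exists dL dU : R, 0 < dL /\ 0 < dU /\
                   gap_ineq (m4 R gc) dL dU /\
                   upper_cond cplx (As w) xs (m4 R gc) dU /\
                   lower_cond cplx (As w) xs (m4 R gc) dL] /\
         (P E >= (1 - c2 / (n%:R ^+ 2))%:E)%E).
Proof.
split; last exact: gaussian_conditions.
move=> cplx n d xs As y m dL dU Fxs pA yE m0 L0 U0 up lo gap x crit.
have xxs := no_spurious_critical Fxs pA yE m0 L0 U0 up lo gap crit.
by split => //; apply: phase_of_outer_eq => //; case: crit.
Qed.
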